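(* Let $\mathbb{H}=\{\tau\in\mathbb{C}:\operatorname{Im}\tau>0\}$. Suppose that the complex coefficients $a_n$ ($n\in\mathbb{Z}$), $b_n$ ($n\in\mathbb{Z}\setminus\{0\}$) are subject to the subexponential growth bound $$\forall\epsilon>0:\quad|a_n|,|b_n|=O(e^{\epsilon|n|})\quad\text{as }|n|\to+\infty,$$ and that the associated harmonic hyperbolic Fourier series is trivial: $$a_0+\sum_{n>0}\big(a_n\,e^{i\pi n\tau}+b_n\,e^{-i\pi n/\tau}\big)+\sum_{n<0}\big(a_n\,e^{i\pi n\bar\tau}+b_n\,e^{-i\pi n/\bar\tau}\big)=0,\qquad\tau\in\mathbb{H}.$$ Suppose, in addition, that for some integer $k=1,2,3,\ldots$, $$|a_n|=o\big(|n|^{-3/4}\exp(2\pi\sqrt{k|n|})\big)\quad\text{as }|n|\to+\infty.$$ Then $\{a_0,a_n,b_n\}_{n\neq0}$ belongs to the space $\mathfrak{E}^{\mathrm{harm}}_{k-1}$ of two-sided exceptional sequences of degree $\le k-1$.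
   Context: The modular lambda function is $\lambda(\tau)=\vartheta_{10}(\tau)^4/\vartheta_{00}(\tau)^4$, $\tau\in\mathbb{H}$, where $\vartheta_{10}(\tau)=\sum_{n\in\mathbb{Z}}e^{i\pi(n+\frac12)^2\tau}$ and $\vartheta_{00}(\tau)=\sum_{n\in\mathbb{Z}}e^{i\pi n^2\tau}$. A one-sided sequence $\{a_0,a_n,b_n\}_{n>0}$ is exceptional of degree $\le k$ if there exists a polynomial $P$ of degree $\le k$ with $P(0)=0$, $P(1)=-a_0$, such that for all $\tau\in\mathbb{H}$ $$\sum_{n=1}^{\infty}a_n\,e^{i\pi n\tau}=P(\lambda(\tau)),\qquad\sum_{n=1}^{\infty}b_n\,e^{i\pi n\tau}=-a_0-P(1-\lambda(\tau)).$$ A two-sided sequence $\{a_0,a_n,b_n\}_{n\neq0}$ is exceptional of degree $\le k$ if for some $c_0\in\mathbb{C}$ the two one-sided sequences $\{a_0-c_0,a_n,b_n\}_{n>0}$ and $\{c_0,a_{-n},b_{-n}\}_{n>0}$ are both exceptional of degree $\le k$. The linear space of all two-sided exceptional sequences of degree $\le k$ is denoted $\mathfrak{E}^{\mathrm{harm}}_k$ (so $\mathfrak{E}^{\mathrm{harm}}_0=\{0\}$). *)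

(* Defs.v *)
From Stdlib Require Export Reals ZArith.
From Coquelicot Require Export Coquelicot.

Open Scope R_scope.

Definition Cexp (z : C) : C := (exp (Re z) * cos (Im z), exp (Re z) * sin (Im z)).

Definition upper_half_plane (tau : C) : Prop := 0 < Im tau.

(* Convergence of a series of complex numbers, in the norm [Cmod]. *)
Definition C_is_series (u : nat -> C) (l : C) : Prop :=
  @is_series C_AbsRing C_NormedModule u l.

(* [C_Series u] is the sum of [u] only when the real and imaginary parts
   converge; below it is applied only to theta series at points of the upper
   half-plane, which converge absolutely. *)
Definition C_Series (u : nat -> C) : C :=
  (Series (fun n => Re (u n)), Series (fun n => Im (u n))).

Definition C_Series_Z (u : Z -> C) : C :=
  (C_Series (fun n => u (Z.of_nat n)) + C_Series (fun n => u (- Z.of_nat (S n))%Z))%C.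

Definition theta00 (tau : C) : C :=
  C_Series_Z (fun n => Cexp (Ci * PI * (IZR n ^ 2)%R * tau)%C).

Definition theta10 (tau : C) : C :=
  C_Series_Z (fun n => Cexp (Ci * PI * ((IZR n + / 2) ^ 2)%R * tau)%C).

Definition modular_lambda (tau : C) : C :=
  (theta10 tau ^ 4 / theta00 tau ^ 4)%C.

(* A polynomial of degree [<= k] is given by its coefficients
   [p 0, ..., p k]; the values of [p] beyond [k] are not used. *)
Definition poly_eval (k : nat) (p : nat -> C) (z : C) : C :=
  @sum_n C_AbelianMonoid (fun j => (p j * z ^ j)%C) k.

(* The one-sided sequence is {a0, a n, b n} for n > 0: the values [a 0] and
   [b 0] are not used. *)
Definition one_sided_exceptional (k : nat) (a0 : C) (a b : nat -> C) : Prop :=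
  exists p : nat -> C,
    poly_eval k p 0 = 0 /\
    poly_eval k p 1 = (- a0)%C /\
    forall tau : C, upper_half_plane tau ->
      C_is_series (fun n => (a (S n) * Cexp (Ci * PI * INR (S n) * tau))%C)
        (poly_eval k p (modular_lambda tau)) /\
      C_is_series (fun n => (b (S n) * Cexp (Ci * PI * INR (S n) * tau))%C)
        (- a0 - poly_eval k p (1 - modular_lambda tau))%C.

(* Membership in the space of two-sided exceptional sequences of degree [<= k].
   The family [b] is indexed by the nonzero integers: [b 0%Z] is not used. *)
Definition E_harm (k : nat) (a b : Z -> C) : Prop :=
  exists c0 : C,
    one_sided_exceptional k (a 0%Z - c0)%C
      (fun n => a (Z.of_nat n)) (fun n => b (Z.of_nat n)) /\
    one_sided_exceptional k c0
      (fun n => a (- Z.of_nat n)%Z) (fun n => b (- Z.of_nat n)%Z).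

(* The filter "|n| -> +oo" on the integers. *)
Definition Z_infty (P : Z -> Prop) : Prop :=
  exists N : Z, forall n : Z, (N <= Z.abs n)%Z -> P n.

Definition subexponential (a : Z -> C) : Prop :=
  forall eps : R, 0 < eps ->
    exists M : R, Z_infty (fun n => Cmod (a n) <= M * exp (eps * IZR (Z.abs n))).

(* [s] is the value of the harmonic hyperbolic Fourier series at [tau]; the
   terms with n < 0 are indexed by n = - (m + 1). *)
Definition is_harmonic_hfs (a b : Z -> C) (tau s : C) : Prop :=
  exists splus sminus : C,
    C_is_series (fun m => let n := Z.of_nat (S m) in
      (a n * Cexp (Ci * PI * IZR n * tau) +
       b n * Cexp (- (Ci * PI * IZR n) / tau))%C) splus /\
    C_is_series (fun m => let n := (- Z.of_nat (S m))%Z in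
      (a n * Cexp (Ci * PI * IZR n * Cconj tau) +
       b n * Cexp (- (Ci * PI * IZR n) / Cconj tau))%C) sminus /\
    s = (a 0%Z + splus + sminus)%C.

(* Main.v *)
Require Import Defs.
From Stdlib Require Import Lra Lia Psatz List Permutation Classical IndefiniteDescription.
Import ListNotations.

(* Write A, B for the power series in q = e^(i pi tau) attached to the positive
   indices and A', B' for those attached to the negative ones. The hypothesis
   says that A(tau) + B(-1/tau) plus the same expression for A', B' at
   -conj(tau) is constant; the first part is holomorphic in tau and the second
   antiholomorphic, so each is constant. Hence A is invariant under
   tau -> tau + 2 and, through B, under tau -> tau / (2 tau + 1), that is, under
   the principal congruence group of level 2, and it is finite at the cusps
   i oo and 0. At the cusp 1 the growth hypothesis gives
   A(1 - 1/tau) = o(e^(pi k Im tau)), while lambda(1 - 1/tau) = 1 - 1/lambda(tau)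
   has size about e^(pi Im tau). Replacing A by (A - A(i oo)) / lambda lowers k by
   one, so it is enough to show that a level 2 function which is finite at
   i oo and 0 and vanishes at 1 is zero; this is a maximum principle on the
   compactified quotient.

   Holomorphic functions enter only as locally uniform limits of polynomials in
   q; for these, roots-of-unity averages against the Poisson kernel give
   Harnack's inequality, which replaces Cauchy's theory. The relation
   lambda(-1/tau) = 1 - lambda(tau) needs the inversion formula only for the ratio
   of two theta constants, which follows from the quasi-periodicity of
   sum_n e^(i pi s (z + n)^2), s = -1/tau, and discrete Fourier analysis. *)

(** * Complex exponentials and averages over roots of unity *)

(** The exponent 3/4 is critical for Laplace's method. In [sum n^(-3/4) exp(2 pi sqrt(k n) - pi t
    n)] the exponent is [pi k / t - pi t (sqrt n - sqrt k / t)^2]; the peak sits at [n = k / t^2]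
    and has width of order [t^(-3/2)], which [n^(-3/4)] cancels. The sum is thus [O(exp(pi k / t))],
    and for [t = Im (1 - 1 / tau)] with [Re tau] bounded, [1 / t] exceeds [Im tau] by a bounded
    amount high up. The little o then makes the last quotient of the induction vanish at the cusp 1,
    so that the degree is [k - 1] and not [k]. Dividing by lambda requires that lambda has no zero
    and that [q / lambda] is a limit of polynomials in [q]. Both come from Landen's doubling: a
    theta constant divides a product of values at [2 tau], so invertibility, clear near the cusp,
    descends to every height. Harnack's inequality does more than the maximum modulus principle: its
    constant depends only on the height, so bounds are uniform on a half-plane [y <= Im tau] up to
    the cusp, and no maximum has to be attained. *)

Lemma Ceq (z w : C) : Re z = Re w -> Im z = Im w -> z = w.
Proof. destruct z, w; simpl; intros; subst; reflexivity. Qed.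

Lemma Cexp_add (z w : C) : Cexp (z + w)%C = (Cexp z * Cexp w)%C.
Proof.
  destruct z as [a b], w as [c d]. unfold Cexp; apply Ceq; simpl;
  rewrite exp_plus, ?cos_plus, ?sin_plus; ring.
Qed.

Lemma Cexp_0 : Cexp 0 = 1.
Proof. unfold Cexp; apply Ceq; simpl; rewrite exp_0, ?cos_0, ?sin_0; ring. Qed.

Lemma Cmod_Cexp (z : C) : Cmod (Cexp z) = exp (Re z).
Proof.
  unfold Cmod, Cexp; simpl.
  replace (_ + _) with (Rsqr (exp (Re z))).
  - apply sqrt_Rsqr. left; apply exp_pos.
  - pose proof (sin2_cos2 (Im z)) as H. unfold Rsqr in *.
    transitivity (exp (Re z) * exp (Re z) * (sin (Im z) * sin (Im z) + cos (Im z) * cos (Im z)));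
    [rewrite H; ring | ring].
Qed.

Lemma Cexp_neq_0 (z : C) : Cexp z <> 0.
Proof. apply Cmod_gt_0. rewrite Cmod_Cexp. apply exp_pos. Qed.

Lemma Cexp_opp (z : C) : Cexp (- z)%C = (/ Cexp z)%C.
Proof.
  pose proof (Cexp_neq_0 z).
  assert (E : (Cexp (- z) * Cexp z = 1)%C)
    by (rewrite <- Cexp_add; replace (- z + z)%C with (0 : C) by ring; apply Cexp_0).
  replace (/ Cexp z)%C with (1 * / Cexp z)%C by ring. rewrite <- E. field; auto.
Qed.

Lemma Cexp_nat_mul (n : nat) (z : C) : Cexp (INR n * z)%C = (Cexp z ^ n)%C.
Proof.
  induction n as [|n IH].
  - simpl. replace (0 * z)%C with (0 : C) by ring. apply Cexp_0.
  - rewrite S_INR, RtoC_plus. replace ((INR n + 1) * z)%C with (INR n * z + z)%C by ring.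
    rewrite Cexp_add, IH. simpl. ring.
Qed.

Lemma Cexp_2PI_nat (n : nat) : Cexp (2 * PI * INR n * Ci)%C = 1.
Proof.
  replace (2 * PI * INR n * Ci)%C with (INR n * (2 * PI * Ci))%C by ring.
  rewrite Cexp_nat_mul.
  replace (Cexp (2 * PI * Ci)) with (1 : C).
  - induction n; simpl; [reflexivity | rewrite IHn; ring].
  - unfold Cexp; apply Ceq; simpl.
    + replace (_ * 0 - _ * 1) with 0 by ring. rewrite exp_0.
      replace (_ + _) with (2 * PI) by ring. rewrite cos_2PI; ring.
    + replace (_ * 0 - _ * 1) with 0 by ring. rewrite exp_0.
      replace (_ + _) with (2 * PI) by ring. rewrite sin_2PI; ring.
Qed.

Lemma Cexp_2PI_Z (n : Z) : Cexp (2 * PI * IZR n * Ci)%C = 1.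
Proof.
  destruct (Z_le_gt_dec 0 n) as [H|H].
  - rewrite <- (Z2Nat.id n H), <- INR_IZR_INZ. apply Cexp_2PI_nat.
  - replace (2 * PI * IZR n * Ci)%C with (- (2 * PI * INR (Z.to_nat (- n)) * Ci))%C.
    + rewrite Cexp_opp, Cexp_2PI_nat. field.
    + rewrite INR_IZR_INZ, Z2Nat.id by lia. rewrite opp_IZR, RtoC_opp. ring.
Qed.

(** Both signs follow from [1 + x <= exp x] at [x] and at [- x], combined through
    [exp x * exp (- x) = 1]. *)
Lemma exp_sub_1_bound (x : R) : Rabs (exp x - 1) <= Rabs x * exp (Rabs x).
Proof.
  pose proof (exp_ineq1_le x). pose proof (exp_ineq1_le (- x)).
  assert (E : exp x * exp (- x) = 1) by (rewrite <- exp_plus, Rplus_opp_r; apply exp_0).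
  unfold Rabs at 2 3; destruct (Rcase_abs x); unfold Rabs; destruct (Rcase_abs _); nra.
Qed.

Lemma exp_sub_affine_bound (x : R) : Rabs (exp x - 1 - x) <= x ^ 2 * exp (Rabs x).
Proof.
  pose proof (exp_ineq1_le x).
  rewrite Rabs_pos_eq by lra.
  pose proof (exp_ineq1_le (- x)).
  pose proof (exp_pos x). pose proof (exp_pos (- x)).
  assert (E : exp x * exp (- x) = 1) by (rewrite <- exp_plus, Rplus_opp_r; apply exp_0).
  unfold Rabs; destruct (Rcase_abs x); nra.
Qed.

Lemma cos_sub_1_bound (y : R) : Rabs (cos y - 1) <= Rabs y.
Proof.
  replace y with (2 * (y / 2)) at 1 by lra. rewrite cos_2a_sin.
  pose proof (SIN_bound (y / 2)).
  assert (H1 : Rabs (sin (y / 2)) <= Rabs (y / 2)).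
  { destruct (Rle_dec 0 (y / 2)) as [h|h].
    - destruct (Rle_lt_or_eq_dec _ _ h) as [h'|h'].
      + pose proof (sin_lt_x _ h'). rewrite (Rabs_pos_eq (y/2)) by lra.
        destruct (Rle_dec 1 (y/2)); [apply Rabs_le; lra|].
        rewrite Rabs_pos_eq; [lra|]. apply sin_ge_0; try lra. pose proof PI2_1; lra.
      + rewrite <- h', sin_0. lra.
    - rewrite <- (Rabs_Ropp (sin _)), <- sin_neg, <- (Rabs_Ropp (y/2)).
      assert (h' : 0 < - (y / 2)) by lra. pose proof (sin_lt_x _ h').
      rewrite (Rabs_pos_eq (- (y/2))) by lra.
      destruct (Rle_dec 1 (-(y/2))). { pose proof (SIN_bound (-(y/2))). apply Rabs_le; lra. }
      rewrite Rabs_pos_eq; [lra|]. apply sin_ge_0; try lra. pose proof PI2_1; lra. }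
  replace (1 - 2 * sin (y / 2) * sin (y / 2) - 1) with (- (2 * sin (y/2) * sin (y/2))) by ring.
  rewrite Rabs_Ropp, !Rabs_mult, (Rabs_pos_eq 2) by lra.
  assert (Rabs (y/2) = Rabs y / 2).
  { unfold Rdiv. rewrite Rabs_mult, (Rabs_pos_eq (/2)) by lra. reflexivity. }
  assert (Rabs (sin (y/2)) <= 1) by (apply Rabs_le; lra).
  pose proof (Rabs_pos (sin (y/2))). nra.
Qed.

Lemma cos_sub_1_bound_sqr (y : R) : Rabs (cos y - 1) <= y ^ 2.
Proof.
  destruct (Req_dec y 0) as [->|Hy]; [rewrite cos_0; replace (1-1) with 0 by ring; rewrite Rabs_R0; nra|].
  destruct (MVT_gen cos 0 y (fun x => - sin x)) as [c [Hc E]].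
  - intros x _. apply is_derive_Reals. apply derivable_pt_lim_cos.
  - intros x _. apply continuity_cos.
  - rewrite cos_0 in E. rewrite E, Rabs_mult, Rminus_0_r, Rabs_Ropp.
    assert (Rabs (sin c) <= Rabs y).
    { assert (Rabs (sin c) <= Rabs c).
      { destruct (MVT_gen sin 0 c cos) as [d [_ Ed]].
        - intros x _. apply is_derive_Reals. apply derivable_pt_lim_sin.
        - intros x _. apply continuity_sin.
        - rewrite sin_0, !Rminus_0_r in Ed. rewrite Ed, Rabs_mult.
          pose proof (COS_bound d). assert (Rabs (cos d) <= 1) by (apply Rabs_le; lra).
          pose proof (Rabs_pos c). nra. }
      assert (Rabs c <= Rabs y).
      { revert Hc. unfold Rmin, Rmax, Rabs. destruct (Rle_dec 0 y), (Rcase_abs c), (Rcase_abs y); lra. }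
      lra. }
    pose proof (Rabs_pos y). rewrite <- (Rsqr_pow2 y), Rsqr_abs. unfold Rsqr. nra.
Qed.

Lemma sin_sub_bound_sqr (y : R) : Rabs (sin y - y) <= y ^ 2.
Proof.
  destruct (MVT_gen (fun x => sin x - x) 0 y (fun x => cos x - 1)) as [c [Hc E]].
  - intros x _. auto_derive; trivial. ring.
  - intros x _. apply derivable_continuous_pt. apply derivable_pt_minus.
    apply derivable_pt_sin. apply derivable_pt_id.
  - rewrite sin_0, !Rminus_0_r in E. rewrite E, Rabs_mult.
    pose proof (cos_sub_1_bound c).
    assert (Rabs c <= Rabs y).
    { revert Hc. unfold Rmin, Rmax, Rabs. destruct (Rle_dec 0 y), (Rcase_abs c), (Rcase_abs y); lra. }
    pose proof (Rabs_pos y). rewrite <- (Rsqr_pow2 y), Rsqr_abs. unfold Rsqr. nra.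
Qed.

Lemma Im_le_Cmod (z : C) : Rabs (Im z) <= Cmod z.
Proof.
  pose proof (Rmax_Cmod z). pose proof (Rmax_r (Rabs (fst z)) (Rabs (snd z))).
  unfold Im. lra.
Qed.

Lemma Cmod_le_sum (z : C) : Cmod z <= Rabs (Re z) + Rabs (Im z).
Proof.
  unfold Cmod, Re, Im. destruct z as [a b]; simpl.
  rewrite <- (sqrt_Rsqr (Rabs a + Rabs b)).
  - apply sqrt_le_1_alt. unfold Rsqr. pose proof (Rabs_pos a). pose proof (Rabs_pos b).
    assert (a * a = Rabs a * Rabs a) by (rewrite <- Rabs_mult, Rabs_pos_eq; nra).
    assert (b * b = Rabs b * Rabs b) by (rewrite <- Rabs_mult, Rabs_pos_eq; nra).
    nra.
  - pose proof (Rabs_pos a). pose proof (Rabs_pos b). lra.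
Qed.

(** The second order remainder behind all differentiability estimates below. The 4 is 2 for the real
    part plus 2 for the imaginary part, each split so that only real remainders of [exp], [cos] and
    [sin] occur. *)
Lemma Cexp_sub_affine_bound (w : C) :
  Cmod (Cexp w - 1 - w)%C <= 4 * Cmod w ^ 2 * exp (Cmod w).
Proof.
  destruct w as [x y]. set (m := Cmod (x, y)).
  assert (Hx : Rabs x <= m) by apply (re_le_Cmod (x, y)).
  assert (Hy : Rabs y <= m) by apply (Im_le_Cmod (x, y)).
  assert (Hx2 : x ^ 2 <= m ^ 2) by (rewrite <- (pow2_abs x); apply pow_incr; split; [apply Rabs_pos | lra]).
  assert (Hy2 : y ^ 2 <= m ^ 2) by (rewrite <- (pow2_abs y); apply pow_incr; split; [apply Rabs_pos | lra]).
  assert (He : exp (Rabs x) <= exp m) by (destruct Hx as [Hx|Hx]; [left; apply exp_increasing; lra | rewrite Hx; lra]).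
  pose proof (exp_ineq1_le m) as He1.
  pose proof (exp_sub_affine_bound x). pose proof (exp_sub_1_bound x).
  pose proof (cos_sub_1_bound_sqr y). pose proof (sin_sub_bound_sqr y).
  eapply Rle_trans; [apply Cmod_le_sum|].
  assert (A : Rabs (Re (Cexp (x, y) - 1 - (x, y))%C) <= 2 * m ^ 2 * exp m).
  { unfold Cexp; simpl.
    replace (_ + _) with ((exp x - 1 - x) * cos y + (1 + x) * (cos y - 1)) by (cbv [Re Im fst snd]; ring).
    eapply Rle_trans; [apply Rabs_triang|]. rewrite !Rabs_mult.
    pose proof (COS_bound y). assert (Rabs (cos y) <= 1) by (apply Rabs_le; lra).
    assert (Rabs (1 + x) <= exp m).
    { eapply Rle_trans; [apply Rabs_triang|]. rewrite Rabs_R1. lra. }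
    pose proof (Rabs_pos (exp x - 1 - x)). pose proof (Rabs_pos (1 + x)). pose proof (Rabs_pos (cos y - 1)).
    pose proof (Rabs_pos (cos y)).
    assert (Rabs (exp x - 1 - x) <= m ^ 2 * exp m).
    { eapply Rle_trans; [eassumption|]. apply Rmult_le_compat; try nra. left; apply exp_pos. }
    assert (Rabs (1 + x) * Rabs (cos y - 1) <= exp m * m ^ 2) by (apply Rmult_le_compat; lra).
    assert (Rabs (exp x - 1 - x) * Rabs (cos y) <= (m ^ 2 * exp m) * 1) by (apply Rmult_le_compat; lra).
    lra. }
  assert (B : Rabs (Im (Cexp (x, y) - 1 - (x, y))%C) <= 2 * m ^ 2 * exp m).
  { unfold Cexp; simpl.
    replace (_ + _) with ((exp x - 1) * sin y + (sin y - y)) by (cbv [Re Im fst snd]; ring).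
    eapply Rle_trans; [apply Rabs_triang|]. rewrite !Rabs_mult.
    assert (Rabs (sin y) <= m).
    { destruct (MVT_gen sin 0 y cos) as [d [_ Ed]].
      - intros z _. apply is_derive_Reals. apply derivable_pt_lim_sin.
      - intros z _. apply continuity_sin.
      - rewrite sin_0, !Rminus_0_r in Ed. rewrite Ed, Rabs_mult.
        pose proof (COS_bound d). assert (Rabs (cos d) <= 1) by (apply Rabs_le; lra).
        pose proof (Rabs_pos y). nra. }
    pose proof (Rabs_pos (exp x - 1)). pose proof (Rabs_pos (sin y)).
    assert (Rabs (exp x - 1) <= m * exp m).
    { eapply Rle_trans; [eassumption|]. apply Rmult_le_compat; try lra. apply Rabs_pos. left; apply exp_pos. }
    nra. }
  lra.
Qed.

(** * Finite sums and means over equally spaced samples *)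

Fixpoint csum (f : nat -> C) (n : nat) : C :=
  match n with O => 0 | S n => (csum f n + f n)%C end.

Lemma csum_ext (f g : nat -> C) (n : nat) :
  (forall i, (i < n)%nat -> f i = g i) -> csum f n = csum g n.
Proof. induction n; simpl; intros H; [reflexivity | rewrite IHn, H; auto]. Qed.

Lemma csum_plus (f g : nat -> C) (n : nat) :
  csum (fun i => f i + g i)%C n = (csum f n + csum g n)%C.
Proof. induction n; simpl; [ring | rewrite IHn; ring]. Qed.

Lemma csum_scal (c : C) (f : nat -> C) (n : nat) :
  csum (fun i => c * f i)%C n = (c * csum f n)%C.
Proof. induction n; simpl; [ring | rewrite IHn; ring]. Qed.

Lemma csum_const (c : C) (n : nat) : csum (fun _ => c) n = (INR n * c)%C.
Proof. induction n; [simpl; ring | rewrite S_INR, RtoC_plus; simpl csum; rewrite IHn; ring]. Qed.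

Lemma csum_zero (f : nat -> C) (n : nat) : (forall i, (i < n)%nat -> f i = 0) -> csum f n = 0.
Proof. induction n; simpl; intros H; [reflexivity | rewrite IHn, H by auto; ring]. Qed.

Lemma csum_exchange (f : nat -> nat -> C) (n m : nat) :
  csum (fun i => csum (f i) m) n = csum (fun j => csum (fun i => f i j) n) m.
Proof.
  induction n; simpl; [symmetry; apply csum_zero; auto|].
  rewrite IHn, <- csum_plus. reflexivity.
Qed.

Lemma csum_shift (f : nat -> C) (n : nat) :
  csum f (S n) = (f O + csum (fun i => f (S i)) n)%C.
Proof. induction n; [simpl; ring | change (csum f (S (S n))) with (csum f (S n) + f (S n))%C; rewrite IHn; simpl; ring]. Qed.

Lemma csum_single (f : nat -> C) (n k : nat) :
  (k < n)%nat -> (forall i, (i < n)%nat -> i <> k -> f i = 0) -> csum f n = f k.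
Proof.
  induction n; intros Hk H; [lia|]. simpl.
  destruct (Nat.eq_dec k n) as [->|Hn].
  - rewrite csum_zero by (intros; apply H; lia). ring.
  - rewrite IHn by (try lia; intros; apply H; lia). rewrite (H n) by lia. ring.
Qed.

Lemma csum_bound (f : nat -> C) (B : R) (n : nat) :
  (forall i, (i < n)%nat -> Cmod (f i) <= B) -> Cmod (csum f n) <= INR n * B.
Proof.
  induction n; intros H.
  - simpl. rewrite Cmod_0. lra.
  - rewrite S_INR. simpl. eapply Rle_trans; [apply Cmod_triangle|].
    pose proof (IHn ltac:(intros; apply H; lia)). pose proof (H n ltac:(lia)). lra.
Qed.

Lemma Re_csum_nonneg (f : nat -> C) (n : nat) :
  (forall i, (i < n)%nat -> 0 <= Re (f i)) -> 0 <= Re (csum f n).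
Proof.
  induction n; intros H; simpl; [lra|].
  pose proof (IHn ltac:(intros; apply H; lia)). pose proof (H n ltac:(lia)).
  unfold Re in *. lra.
Qed.

(** With [f] sampled at the [N]-th roots of unity this is the discrete stand-in for a contour
    integral. It is exact on trigonometric polynomials of degree below [N], so identities for
    polynomials hold without error terms. *)
Definition avg (N : nat) (f : nat -> C) : C := (csum f N / INR N)%C.

Lemma avg_ext (N : nat) (f g : nat -> C) :
  (forall i, (i < N)%nat -> f i = g i) -> avg N f = avg N g.
Proof. intros H. unfold avg. rewrite (csum_ext f g); auto. Qed.

Lemma avg_plus (N : nat) (f g : nat -> C) : avg N (fun i => f i + g i)%C = (avg N f + avg N g)%C.
Proof. unfold avg. rewrite csum_plus. unfold Cdiv. ring. Qed.

Lemma avg_scal (N : nat) (c : C) (f : nat -> C) : avg N (fun i => c * f i)%C = (c * avg N f)%C.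
Proof. unfold avg. rewrite csum_scal. unfold Cdiv. ring. Qed.

Lemma avg_csum (N : nat) (f : nat -> nat -> C) (n : nat) :
  avg N (fun i => csum (fun j => f j i) n) = csum (fun j => avg N (f j)) n.
Proof.
  induction n; simpl.
  - unfold avg. rewrite csum_zero by auto. unfold Cdiv. ring.
  - rewrite <- IHn. apply avg_plus.
Qed.

Lemma INR_C_neq_0 (N : nat) : (0 < N)%nat -> RtoC (INR N) <> 0.
Proof. intros H E. apply RtoC_inj in E. apply (not_0_INR N); [lia | exact E]. Qed.

Lemma avg_const (N : nat) (c : C) : (0 < N)%nat -> avg N (fun _ => c) = c.
Proof. intros H. unfold avg. rewrite csum_const. field. apply INR_C_neq_0; auto. Qed.

Lemma avg_bound (N : nat) (f : nat -> C) (B : R) : (0 < N)%nat ->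
  (forall i, (i < N)%nat -> Cmod (f i) <= B) -> Cmod (avg N f) <= B.
Proof.
  intros HN H. unfold avg. rewrite Cmod_div by (apply INR_C_neq_0; auto).
  rewrite Cmod_R, Rabs_pos_eq by apply pos_INR.
  apply Rle_div_l; [apply lt_0_INR; auto|]. rewrite Rmult_comm. apply csum_bound; auto.
Qed.

Lemma Re_avg_nonneg (N : nat) (f : nat -> C) : (0 < N)%nat ->
  (forall i, (i < N)%nat -> 0 <= Re (f i)) -> 0 <= Re (avg N f).
Proof.
  intros HN H. unfold avg, Cdiv. rewrite <- RtoC_inv by (apply not_0_INR; lia).
  pose proof (Re_csum_nonneg f N H).
  assert (0 < / INR N) by (apply Rinv_0_lt_compat, lt_0_INR; auto).
  unfold Re in *. simpl. nra.
Qed.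

Definition ce (x : R) : C := Cexp (2 * PI * x * Ci)%C.

Lemma ce_add (x y : R) : ce (x + y) = (ce x * ce y)%C.
Proof. unfold ce. rewrite <- Cexp_add. f_equal. rewrite RtoC_plus. ring. Qed.

Lemma ce_Z (n : Z) : ce (IZR n) = 1.
Proof. apply Cexp_2PI_Z. Qed.

Lemma Cmod_ce (x : R) : Cmod (ce x) = 1.
Proof.
  unfold ce. rewrite Cmod_Cexp. replace (Re _) with 0; [apply exp_0|]. simpl. ring.
Qed.

Lemma ce_0 : ce 0 = 1.
Proof. apply (ce_Z 0). Qed.

Lemma ce_pow (x : R) (n : nat) : (ce x ^ n)%C = ce (INR n * x).
Proof. unfold ce. rewrite <- Cexp_nat_mul. f_equal. rewrite RtoC_mult. ring. Qed.

Lemma ce_opp (x : R) : ce (- x) = Cconj (ce x).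
Proof.
  unfold ce, Cexp. apply Ceq; simpl; ring_simplify (2 * PI - 0 * 0);
  repeat rewrite ?Rmult_0_r, ?Rmult_0_l, ?Rminus_0_r, ?Rplus_0_r, ?Rplus_0_l, ?Rmult_1_r.
  - f_equal. rewrite <- cos_neg. f_equal. ring.
  - rewrite Ropp_mult_distr_r, <- sin_neg. f_equal. f_equal. ring.
Qed.

Lemma ce_neq_1 (x : R) : 0 < x < 1 -> ce x <> 1.
Proof.
  intros Hx E.
  assert (H : Re (ce x) = cos (2 * PI * x)).
  { unfold ce, Cexp. simpl.
    repeat rewrite ?Rmult_0_r, ?Rmult_0_l, ?Rminus_0_r, ?Rplus_0_r, ?Rplus_0_l, ?Rmult_1_r.
    rewrite exp_0. ring. }
  rewrite E in H. simpl in H.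
  replace (2 * PI * x) with (2 * (PI * x)) in H by ring. rewrite cos_2a_sin in H.
  pose proof PI_RGT_0.
  assert (0 < sin (PI * x)) by (apply sin_gt_0; nra). nra.
Qed.

(** A geometric progression whose ratio [x] satisfies [x ^ N = 1]; the bounds on [m] exclude
    [x = 1]. *)
Lemma avg_roots (N : nat) (m : Z) : (0 < N)%nat -> (0 < Z.abs m < Z.of_nat N)%Z ->
  avg N (fun j => ce (IZR m * (INR j / INR N))) = 0.
Proof.
  intros HN Hm.
  assert (hN : 0 < INR N) by (apply lt_0_INR; auto).
  set (x := ce (IZR m / INR N)).
  assert (Hx : x <> 1).
  { destruct (Z_lt_ge_dec 0 m).
    - apply ce_neq_1. split; [apply Rdiv_lt_0_compat; auto; apply IZR_lt; auto|].
      apply Rlt_div_l; auto. rewrite Rmult_1_l, INR_IZR_INZ. apply IZR_lt. lia.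
    (* For negative [m] the argument is moved into the open unit interval by the period 1. *)
    - intros E. apply (ce_neq_1 (1 + IZR m / INR N)).
      + assert (-1 < IZR m / INR N).
        { apply (Rlt_div_r (-1)); auto. rewrite INR_IZR_INZ, <- mult_IZR. apply IZR_lt. lia. }
        assert (IZR m / INR N < 0).
        { apply Rlt_div_l; auto. rewrite Rmult_0_l. apply IZR_lt. lia. }
        lra.
      + rewrite ce_add, (ce_Z 1). fold x. rewrite E. ring. }
  assert (E : csum (fun j => ce (IZR m * (INR j / INR N))) N = csum (fun j => x ^ j)%C N).
  { apply csum_ext. intros i _. unfold x. rewrite ce_pow. f_equal. field. lra. }
  unfold avg. rewrite E.
  assert (G : forall n, (csum (fun j => x ^ j) n * (x - 1))%C = (x ^ n - 1)%C).
  { induction n; simpl; [ring | rewrite Cmult_plus_distr_r, IHn; ring]. }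
  specialize (G N).
  assert (EN : (x ^ N)%C = 1).
  { unfold x. rewrite ce_pow. replace (INR N * _) with (IZR m) by (field; lra). apply ce_Z. }
  rewrite EN in G. replace (1 - 1)%C with (0 : C) in G by ring.
  assert (csum (fun j => x ^ j)%C N = 0) as ->.
  { destruct (Ceq_dec (csum (fun j => (x ^ j)%C) N) 0) as [e|n]; auto.
    exfalso. apply (Cmult_neq_0 _ (x - 1)%C n); auto.
    intros e. apply Hx. replace x with (x - 1 + 1)%C by ring. rewrite e. ring. }
  unfold Cdiv. ring.
Qed.

(** * Polynomials, the Poisson kernel, and Harnack's inequality in the nome *)

Definition peval (p : list C) (z : C) : C := fold_right (fun a s => a + z * s)%C 0 p.

Lemma peval_csum (p : list C) (z : C) :
  peval p z = csum (fun n => nth n p 0 * z ^ n)%C (length p).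
Proof.
  induction p as [|a p IH]; [reflexivity|].
  simpl length. rewrite csum_shift. simpl. rewrite IH, <- csum_scal.
  f_equal; [ring|]. apply csum_ext. intros; ring.
Qed.

Fixpoint padd (p r : list C) : list C :=
  match p, r with
  | [], _ => r
  | _, [] => p
  | a :: p, b :: r => (a + b)%C :: padd p r
  end.

Lemma peval_padd (p r : list C) (z : C) : peval (padd p r) z = (peval p z + peval r z)%C.
Proof.
  revert r. induction p as [|a p IH]; intros [|b r]; simpl; try ring. rewrite IH. ring.
Qed.

Lemma peval_map_scal (c : C) (p : list C) (z : C) : peval (map (Cmult c) p) z = (c * peval p z)%C.
Proof. induction p; simpl; [ring | rewrite IHp; ring]. Qed.

Fixpoint pmul (p r : list C) : list C :=
  match p with [] => [] | a :: p => padd (map (Cmult a) r) (RtoC 0 :: pmul p r) end.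

Lemma peval_pmul (p r : list C) (z : C) : peval (pmul p r) z = (peval p z * peval r z)%C.
Proof.
  induction p; simpl; [ring|]. rewrite peval_padd, peval_map_scal. simpl. rewrite IHp. ring.
Qed.

Fixpoint pneg (p : list C) : list C :=
  match p with [] => [] | a :: p => a :: map (Cmult (- 1)%C) (pneg p) end.

Lemma peval_pneg (p : list C) (z : C) : peval (pneg p) z = peval p (- z)%C.
Proof. induction p; simpl; [ring|]. rewrite peval_map_scal, IHp. ring. Qed.

Fixpoint psq (p : list C) : list C :=
  match p with [] => [] | a :: p => a :: RtoC 0 :: psq p end.

Lemma peval_psq (p : list C) (z : C) : peval (psq p) z = peval p (z * z)%C.
Proof. induction p; simpl; [ring|]. rewrite IHp. ring. Qed.

Lemma peval_bound (p : list C) : exists B, 0 <= B /\ forall z, Cmod z <= 1 -> Cmod (peval p z) <= B.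
Proof.
  induction p as [|a p [B [HB H]]].
  - exists 0. split; [lra|]. intros z _. simpl. rewrite Cmod_0. lra.
  - exists (Cmod a + B). pose proof (Cmod_ge_0 a). split; [lra|].
    intros z Hz. simpl. eapply Rle_trans; [apply Cmod_triangle|].
    rewrite Cmod_mult. pose proof (H z Hz). pose proof (Cmod_ge_0 (peval p z)). nra.
Qed.

Lemma avg_monomial (N : nat) (R0 : R) (m : nat) (k : Z) : (0 < N)%nat ->
  (Z.abs (Z.of_nat m + k) < Z.of_nat N)%Z ->
  avg N (fun j => (R0 * ce (INR j / INR N)) ^ m * ce (IZR k * (INR j / INR N)))%C
  = if Z.eq_dec (Z.of_nat m + k) 0 then (R0 ^ m)%C else 0.
Proof.
  intros HN Hk.
  rewrite (avg_ext _ _ (fun j => R0 ^ m * ce (IZR (Z.of_nat m + k) * (INR j / INR N)))%C).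
  - rewrite avg_scal. destruct (Z.eq_dec (Z.of_nat m + k) 0) as [e|n].
    + rewrite e. rewrite (avg_ext _ _ (fun _ => 1)).
      * rewrite avg_const by auto. ring.
      * intros. rewrite Rmult_0_l. apply ce_0.
    + rewrite avg_roots by lia. ring.
  - intros i _. rewrite Cpow_mult_l, ce_pow, plus_IZR, Rmult_plus_distr_r, ce_add, INR_IZR_INZ. ring.
Qed.

(** A discrete Cauchy formula for coefficients, exact because distinct frequencies below [N] are
    incongruent modulo [N]. *)
Lemma avg_peval (N : nat) (p : list C) (R0 : R) (k : nat) :
  (length p <= N)%nat -> (k < N)%nat ->
  avg N (fun j => peval p (R0 * ce (INR j / INR N)) * ce (- INR k * (INR j / INR N)))%C
  = (nth k p 0 * R0 ^ k)%C.
Proof.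
  intros Hp Hk.
  rewrite (avg_ext _ _ (fun j => csum (fun m => nth m p 0 *
     ((R0 * ce (INR j / INR N)) ^ m * ce (IZR (- Z.of_nat k) * (INR j / INR N))))%C (length p))).
  - rewrite (avg_csum N (fun m j => nth m p 0 *
     ((R0 * ce (INR j / INR N)) ^ m * ce (IZR (- Z.of_nat k) * (INR j / INR N))))%C).
    rewrite (csum_ext _ (fun m => nth m p 0 * (if Z.eq_dec (Z.of_nat m + - Z.of_nat k) 0 then (R0 ^ m)%C else 0))%C).
    + destruct (Nat.lt_ge_cases k (length p)) as [h|h].
      * rewrite (csum_single _ _ k); auto.
        -- destruct (Z.eq_dec (Z.of_nat k + - Z.of_nat k) 0); [reflexivity | lia].
        -- intros i _ Hi. destruct (Z.eq_dec (Z.of_nat i + - Z.of_nat k) 0); [lia | ring].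
      * rewrite csum_zero.
        -- rewrite nth_overflow by auto. ring.
        -- intros i Hi. destruct (Z.eq_dec (Z.of_nat i + - Z.of_nat k) 0); [lia | ring].
    + intros i Hi. rewrite avg_scal, avg_monomial by lia. reflexivity.
  - intros i _. rewrite peval_csum, opp_IZR, <- INR_IZR_INZ, Cmult_comm, <- csum_scal. apply csum_ext. intros; ring.
Qed.

(** Cauchy's estimate, from the mean formula with as many samples as coefficients. *)
Lemma coef_bound (p : list C) (R0 E : R) (k : nat) : 0 <= R0 -> 0 <= E ->
  (forall x, Cmod (peval p (R0 * ce x)) <= E) -> Cmod (nth k p 0) * R0 ^ k <= E.
Proof.
  intros HR HE H.
  destruct (Nat.lt_ge_cases k (length p)) as [h|h].
  - replace (Cmod (nth k p 0) * R0 ^ k) with (Cmod (nth k p 0 * R0 ^ k)%C).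
    + rewrite <- (avg_peval (length p)) by lia. apply avg_bound; [lia|].
      intros i _. rewrite Cmod_mult, Cmod_ce, Rmult_1_r. apply H.
    + rewrite Cmod_mult, Cmod_pow, Cmod_R, Rabs_pos_eq; auto.
  - rewrite nth_overflow by auto. rewrite Cmod_0. lra.
Qed.

(* Partial sums of the Poisson kernel Re ((1 + u) / (1 - u)). *)
Definition poisson (D : nat) (u : C) : C :=
  (1 + csum (fun n => u ^ S n + Cconj u ^ S n)%C D)%C.

Lemma poisson_real (D : nat) (u : C) : Im (poisson D u) = 0.
Proof.
  unfold poisson. induction D; [simpl; ring|].
  cbn [csum]. rewrite Cplus_assoc.
  assert (E : forall a b, Im (a + b)%C = Im a + Im b) by reflexivity.
  rewrite E, IHD, E. rewrite <- Cpow_conj, im_conj. ring.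
Qed.

Lemma Re_poisson (D : nat) (u : C) :
  Re (poisson D u) = 1 + 2 * Re (csum (fun n => u ^ S n)%C D).
Proof.
  unfold poisson. rewrite csum_plus.
  assert (E : csum (fun i => Cconj u ^ S i)%C D = Cconj (csum (fun i => u ^ S i)%C D)).
  { induction D; cbn [csum].
    - apply Ceq; simpl; ring.
    - rewrite IHD, Cplus_conj, Cpow_conj. reflexivity. }
  rewrite E.
  assert (E' : forall a b, Re (a + b)%C = Re a + Re b) by reflexivity.
  rewrite !E', re_conj. simpl. ring.
Qed.

Lemma csum_geom (u : C) (D : nat) :
  ((1 - u) * csum (fun n => u ^ S n) D)%C = (u - u ^ S D)%C.
Proof. induction D; cbn [csum]; [simpl; ring | rewrite Cmult_plus_distr_l, IHD; simpl; ring]. Qed.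

Lemma Cmod_sub_lower (z w : C) : Cmod z - Cmod w <= Cmod (z - w)%C.
Proof.
  pose proof (Cmod_triangle (z - w)%C w). replace (z - w + w)%C with z in H by ring. lra.
Qed.

Lemma Cmod_sub_upper (z w : C) : Cmod (z - w)%C <= Cmod z + Cmod w.
Proof. unfold Cminus. rewrite <- (Cmod_opp w). apply Cmod_triangle. Qed.

Lemma Cmod_sub_sym (z w : C) : Cmod (z - w)%C = Cmod (w - z)%C.
Proof. rewrite <- Cmod_opp. f_equal. ring. Qed.

(** The truncation differs from the full kernel by the real part of [2 u^(D+1) / (1 - u)], and the
    full kernel is [(1 - |u|^2) / |1 - u|^2]; then [1 - |u| <= |1 - u| <= 1 + |u|] gives both
    extremes. *)
Lemma poisson_bounds (D : nat) (u : C) (r : R) : Cmod u <= r -> r < 1 ->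
  (1 - r) / (1 + r) - 2 * r ^ S D / (1 - r) <= Re (poisson D u)
  <= (1 + r) / (1 - r) + 2 * r ^ S D / (1 - r).
Proof.
  intros Hu Hr. pose proof (Cmod_ge_0 u) as Hu0.
  set (S := csum (fun n => u ^ S n)%C D).
  assert (Hn : (1 - u)%C <> 0).
  { intros e. pose proof (Cmod_sub_lower 1 u). rewrite e, Cmod_0, Cmod_1 in H. lra. }
  assert (Hm : 1 - r <= Cmod (1 - u)%C).
  { pose proof (Cmod_sub_lower 1 u). rewrite Cmod_1 in H. lra. }
  assert (Hm2 : Cmod (1 - u)%C <= 1 + r).
  { pose proof (Cmod_sub_upper 1 u). rewrite Cmod_1 in H. lra. }
  assert (ES : (1 + 2 * S)%C = ((1 + u) / (1 - u) - 2 * u ^ Datatypes.S D / (1 - u))%C).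
  { assert (E := csum_geom u D). fold S in E.
    replace S with ((u - u ^ Datatypes.S D) / (1 - u))%C by (rewrite <- E; field; auto).
    field; auto. }
  assert (EP : Re (poisson D u) = Re ((1 + u) / (1 - u))%C - Re (2 * u ^ Datatypes.S D / (1 - u))%C).
  { rewrite Re_poisson. fold S.
    transitivity (Re (1 + 2 * S)%C). - simpl. unfold Re. ring. - rewrite ES. reflexivity. }
  assert (EQ : Re ((1 + u) / (1 - u))%C * Cmod (1 - u)%C ^ 2 = 1 - Cmod u ^ 2).
  { rewrite !Cmod2_alt. destruct u as [a b]. simpl.
    assert (Hd : (1 + - a) * ((1 + - a) * 1) + (0 + - b) * ((0 + - b) * 1) <> 0).
    { intros e. apply Hn.
      pose proof (Rle_0_sqr (1 + - a)) as h1. pose proof (Rle_0_sqr (0 + - b)) as h2.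
      rewrite !Rmult_1_r in e. fold (Rsqr (1 + - a)) (Rsqr (0 + - b)) in e.
      assert (1 + - a = 0) by (apply Rsqr_0_uniq; lra).
      assert (0 + - b = 0) by (apply Rsqr_0_uniq; lra).
      apply Ceq; simpl; lra. }
    field. intros e; apply Hd. lra. }
  assert (EE : Rabs (Re (2 * u ^ Datatypes.S D / (1 - u))%C) <= 2 * r ^ Datatypes.S D / (1 - r)).
  { eapply Rle_trans; [apply re_le_Cmod|].
    rewrite Cmod_div, Cmod_mult, Cmod_pow, Cmod_R, Rabs_pos_eq by (auto; lra).
    assert (Cmod u ^ Datatypes.S D <= r ^ Datatypes.S D) by (apply pow_incr; lra).
    assert (0 <= Cmod u ^ Datatypes.S D) by (apply pow_le; lra).
    unfold Rdiv. apply Rmult_le_compat; try lra.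
    - left. apply Rinv_0_lt_compat. lra.
    - apply Rinv_le_contravar; lra. }
  apply Rabs_le_between in EE. rewrite EP.
  assert (L : (1 - r) / (1 + r) <= Re ((1 + u) / (1 - u))%C <= (1 + r) / (1 - r)).
  { set (m := Cmod (1 - u)%C) in *. set (x := Re ((1 + u) / (1 - u))%C) in *.
    set (s := Cmod u) in *.
    assert (1 - s <= m <= 1 + s).
    { unfold m, s. pose proof (Cmod_sub_lower 1 u). pose proof (Cmod_sub_upper 1 u). rewrite Cmod_1 in *. lra. }
    assert (A1 : (1 - s) <= x * (1 + s)).
    { assert (0 <= x) by nra. assert (m ^ 2 <= (1 + s) ^ 2) by (apply pow_incr; lra). nra. }
    assert (A2 : x * (1 - s) <= 1 + s).
    { assert ((1 - s) ^ 2 <= m ^ 2) by (apply pow_incr; lra). nra. }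
    split.
    - apply Rle_div_l; [lra|]. nra.
    - apply Rle_div_r; [lra|]. nra. }
  lra.
Qed.

(** The discrete Poisson formula. A monomial of degree [m >= 1] is matched by the kernel term [u^m]
    alone. The conjugate powers only raise the frequency, to at most [2 * D], so they average to 0
    as long as [2 * D < N]. *)
Lemma avg_peval_poisson (N D : nat) (p : list C) (R0 : R) (w : C) :
  (length p <= S D)%nat -> (2 * D < N)%nat ->
  avg N (fun j => peval p (R0 * ce (INR j / INR N)) * poisson D (w * ce (- (INR j / INR N))))%C
  = peval p (R0 * w)%C.
Proof.
  intros Hp HN.
  set (x := fun j => INR j / INR N).
  rewrite (avg_ext _ _ (fun j => csum (fun m => nth m p 0 *
     ((R0 * ce (x j)) ^ m * ce (IZR 0 * x j) +
      csum (fun n => w ^ S n * ((R0 * ce (x j)) ^ m * ce (IZR (- Z.of_nat (S n)) * x j))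
                     + Cconj w ^ S n * ((R0 * ce (x j)) ^ m * ce (IZR (Z.of_nat (S n)) * x j)))%C D))%C (length p))).
  - rewrite (avg_csum N (fun m j => nth m p 0 *
     ((R0 * ce (x j)) ^ m * ce (IZR 0 * x j) +
      csum (fun n => w ^ S n * ((R0 * ce (x j)) ^ m * ce (IZR (- Z.of_nat (S n)) * x j))
                     + Cconj w ^ S n * ((R0 * ce (x j)) ^ m * ce (IZR (Z.of_nat (S n)) * x j)))%C D))%C).
    rewrite peval_csum. apply csum_ext. intros m Hm.
    rewrite avg_scal, avg_plus. f_equal.
    etransitivity; [apply f_equal2; [exact (avg_monomial N R0 m 0 ltac:(lia) ltac:(lia)) | reflexivity] |].
    rewrite (avg_csum N (fun n j => w ^ S n * ((R0 * ce (x j)) ^ m * ce (IZR (- Z.of_nat (S n)) * x j))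
                     + Cconj w ^ S n * ((R0 * ce (x j)) ^ m * ce (IZR (Z.of_nat (S n)) * x j)))%C).
    rewrite (csum_ext _ (fun n => w ^ S n * if Z.eq_dec (Z.of_nat m + - Z.of_nat (S n)) 0 then R0 ^ m else 0)%C).
    + destruct m as [|m].
      * rewrite csum_zero.
        -- simpl. ring.
        -- intros i _. destruct (Z.eq_dec (Z.of_nat 0 + - Z.of_nat (S i)) 0); [lia | ring].
      * rewrite (csum_single _ _ m); [| lia |].
        -- destruct (Z.eq_dec (Z.of_nat (S m) + 0) 0); [lia|].
           destruct (Z.eq_dec (Z.of_nat (S m) + - Z.of_nat (S m)) 0); [|lia].
           rewrite Cpow_mult_l. ring.
        -- intros i Hi Hn. destruct (Z.eq_dec (Z.of_nat (S m) + - Z.of_nat (S i)) 0); [lia | ring].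
    + intros n Hn. rewrite avg_plus, !avg_scal. unfold x. rewrite !avg_monomial by lia.
      destruct (Z.eq_dec (Z.of_nat m + Z.of_nat (S n)) 0); [lia | ring].
  - intros j _. rewrite peval_csum, Cmult_comm, <- csum_scal. apply csum_ext. intros m _.
    rewrite Cmult_comm, <- Cmult_assoc. f_equal.
    unfold poisson. rewrite Cmult_plus_distr_l, <- csum_scal.
    f_equal.
    + rewrite Rmult_0_l, ce_0. reflexivity.
    + apply csum_ext. intros n _.
      rewrite Cmult_conj, <- ce_opp, Ropp_involutive, !Cpow_mult_l, !ce_pow, opp_IZR, <- INR_IZR_INZ.
      unfold x. rewrite Ropp_mult_distr_l_reverse, <- Ropp_mult_distr_r. ring.
Qed.

(** The nonnegative boundary values are averaged against kernel values that lie between the two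
    extremes. The truncation error [e D] tends to 0 and is removed at the end. *)
Lemma poly_harnack (p : list C) (R0 r : R) (w : C) : Cmod w <= r -> r < 1 ->
  (forall x, 0 <= Re (peval p (R0 * ce x))) ->
  (1 - r) / (1 + r) * Re (peval p 0) <= Re (peval p (R0 * w)) <= (1 + r) / (1 - r) * Re (peval p 0).
Proof.
  intros Hw Hr H.
  set (e := fun D => 2 * r ^ S D / (1 - r)).
  set (P0 := Re (peval p 0)). set (Pw := Re (peval p (R0 * w)%C)).
  assert (Hr0 : 0 <= r) by (pose proof (Cmod_ge_0 w); lra).
  assert (K : forall D, (length p <= S D)%nat ->
     0 <= P0 /\ ((1 - r) / (1 + r) - e D) * P0 <= Pw <= ((1 + r) / (1 - r) + e D) * P0).
  { intros D HD. set (N := S (2 * D)).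
    set (f := fun j => peval p (R0 * ce (INR j / INR N))%C).
    set (k := fun j => poisson D (w * ce (- (INR j / INR N)))%C).
    assert (E1 : avg N (fun j => f j * k j)%C = peval p (R0 * w)%C)
      by (apply avg_peval_poisson; unfold N; lia).
    (* At [w = 0] the kernel is identically 1, so the plain mean gives the value at the centre. *)
    assert (E0 : avg N f = peval p 0).
    { rewrite (avg_ext _ _ (fun j => f j * poisson D (0 * ce (- (INR j / INR N))))%C).
      - unfold f. rewrite avg_peval_poisson by (unfold N; lia). f_equal. ring.
      - intros j _. unfold poisson. rewrite csum_zero; [ring|].
        intros i _. rewrite Cmult_0_l.
        replace (Cconj 0) with (0 : C) by (apply Ceq; simpl; ring). simpl. ring. }
    assert (Hk : forall j, (1 - r) / (1 + r) - e D <= Re (k j) <= (1 + r) / (1 - r) + e D).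
    { intros j. apply poisson_bounds; auto. rewrite Cmod_mult, Cmod_ce. lra. }
    assert (Hki : forall j, Im (k j) = 0) by (intros; apply poisson_real).
    assert (HN : (0 < N)%nat) by (unfold N; lia).
    assert (Hf : forall j, 0 <= Re (f j)) by (intros; apply H).
    clearbody f k.
    split; [|split].
    - unfold P0. rewrite <- E0. apply Re_avg_nonneg; auto.
    - assert (A : 0 <= Re (avg N (fun j => f j * k j + (- ((1 - r) / (1 + r) - e D))%R * f j)%C)).
      { apply Re_avg_nonneg; auto. intros j _.
        replace (Re _) with (Re (f j) * (Re (k j) - ((1 - r) / (1 + r) - e D))).
        - apply Rmult_le_pos; [apply Hf | specialize (Hk j); lra].
        - specialize (Hki j). unfold Re, Im in *. simpl. rewrite Hki. ring. }
      rewrite avg_plus, avg_scal, E1, E0 in A. unfold Pw, P0, Re in *. simpl in *. lra.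
    - assert (A : 0 <= Re (avg N (fun j => ((1 + r) / (1 - r) + e D)%R * f j + (- (1))%R * (f j * k j))%C)).
      { apply Re_avg_nonneg; auto. intros j _.
        replace (Re _) with (Re (f j) * ((1 + r) / (1 - r) + e D - Re (k j))).
        - apply Rmult_le_pos; [apply Hf | specialize (Hk j); lra].
        - specialize (Hki j). unfold Re, Im in *. simpl. rewrite Hki. ring. }
      rewrite avg_plus, !avg_scal, E1, E0 in A. unfold Pw, P0, Re in *. simpl in *. lra. }
  assert (L : forall d, 0 < d -> exists D, (length p <= S D)%nat /\ e D * P0 <= d).
  { intros d Hd.
    assert (HP : 0 <= P0) by (apply (K (length p)); lia).
    destruct (pow_lt_1_zero r ltac:(rewrite Rabs_pos_eq; lra) (d * (1 - r) / (2 * (P0 + 1)))) as [N HN].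
    { apply Rdiv_lt_0_compat; [apply Rmult_lt_0_compat|]; lra. }
    exists (N + length p)%nat. split; [lia|].
    specialize (HN (S (N + length p)) ltac:(lia)).
    rewrite Rabs_pos_eq in HN by (apply pow_le; lra).
    apply Rlt_div_r in HN; [|lra].
    unfold e. replace (_ * _) with (2 * r ^ S (N + length p) * P0 / (1 - r)) by (field; lra).
    apply Rle_div_l; [lra|]. nra. }
  split; apply le_epsilon; intros d Hd; destruct (L d Hd) as [D [HD He]];
  destruct (K D HD) as [_ [K1 K2]]; lra.
Qed.

(** * Functions on half-planes that are limits of polynomials in the nome *)

Definition nome (tau : C) : C := Cexp (Ci * PI * tau)%C.

Lemma Cmod_nome (tau : C) : Cmod (nome tau) = exp (- (PI * Im tau)).
Proof.
  unfold nome. rewrite Cmod_Cexp. f_equal. destruct tau as [a b]. simpl. ring.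
Qed.

Lemma exp_le_compat (x y : R) : x <= y -> exp x <= exp y.
Proof. intros [H|H]; [left; apply exp_increasing; auto | rewrite H; lra]. Qed.

Lemma Cmod_nome_le_1 (tau : C) : 0 <= Im tau -> Cmod (nome tau) <= 1.
Proof.
  intros H. rewrite Cmod_nome, <- exp_0. apply exp_le_compat. pose proof PI_RGT_0. nra.
Qed.

Lemma nome_neq_0 (tau : C) : nome tau <> 0.
Proof. apply Cexp_neq_0. Qed.

Lemma nome_add_1 (tau : C) : nome (tau + 1)%C = (- nome tau)%C.
Proof.
  unfold nome. rewrite Cmult_plus_distr_l, Cexp_add.
  assert (E : Cexp (Ci * PI * 1)%C = (- 1)%C).
  { unfold Cexp. apply Ceq; simpl; replace (_ * 1 - _ * 0) with 0 by ring; rewrite exp_0;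
    replace (_ + _) with PI by ring; rewrite ?cos_PI, ?sin_PI; ring. }
  rewrite E. ring.
Qed.

Lemma nome_double (tau : C) : nome (2 * tau)%C = (nome tau * nome tau)%C.
Proof. unfold nome. rewrite <- Cexp_add. f_equal. ring. Qed.

(* [F] is, on the half-plane [y <= Im tau], a uniform limit of polynomials in
   the nome, and takes the value [c] at the cusp. *)
Definition qholy (y : R) (F : C -> C) (c : C) : Prop :=
  forall eps, 0 < eps -> exists p : list C, forall tau, y <= Im tau ->
    Cmod (F tau - (c + nome tau * peval p (nome tau)))%C <= eps.

Definition qhol (F : C -> C) (c : C) : Prop := forall y, 0 < y -> qholy y F c.

Lemma qholy_ext (y : R) (F G : C -> C) (c : C) :
  (forall tau, y <= Im tau -> F tau = G tau) -> qholy y F c -> qholy y G c.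
Proof.
  intros E H eps He. destruct (H eps He) as [p Hp]. exists p. intros tau Ht. rewrite <- E; auto.
Qed.

Lemma qhol_ext (F G : C -> C) (c : C) :
  (forall tau, 0 < Im tau -> F tau = G tau) -> qhol F c -> qhol G c.
Proof. intros E H y Hy. apply (qholy_ext y F); auto. intros; apply E; lra. Qed.

Lemma qholy_const (y : R) (c : C) : qholy y (fun _ => c) c.
Proof.
  intros eps He. exists []. intros tau _. simpl.
  replace (c - (c + nome tau * 0))%C with (0 : C) by ring. rewrite Cmod_0; lra.
Qed.

Lemma qholy_nome (y : R) : qholy y nome 0.
Proof.
  intros eps He. exists [RtoC 1]. intros tau _. simpl.
  replace (nome tau - _)%C with (0 : C) by ring. rewrite Cmod_0; lra.
Qed.

Lemma qholy_plus (y : R) (F G : C -> C) (c d : C) :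
  qholy y F c -> qholy y G d -> qholy y (fun t => F t + G t)%C (c + d)%C.
Proof.
  intros HF HG eps He.
  destruct (HF (eps / 2) ltac:(lra)) as [p Hp]. destruct (HG (eps / 2) ltac:(lra)) as [r Hr].
  exists (padd p r). intros tau Ht. rewrite peval_padd.
  specialize (Hp tau Ht). specialize (Hr tau Ht).
  replace (_ - _)%C with ((F tau - (c + nome tau * peval p (nome tau))) +
    (G tau - (d + nome tau * peval r (nome tau))))%C by ring.
  eapply Rle_trans; [apply Cmod_triangle|]. lra.
Qed.

Lemma qholy_bounded (y : R) (F : C -> C) (c : C) : 0 < y -> qholy y F c ->
  exists B, 0 < B /\ forall tau, y <= Im tau -> Cmod (F tau) <= B.
Proof.
  intros Hy H. destruct (H 1 ltac:(lra)) as [p Hp].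
  destruct (peval_bound (c :: p)) as [B [HB HpB]].
  exists (B + 1). split; [lra|]. intros tau Ht. specialize (Hp tau Ht).
  specialize (HpB (nome tau) (Cmod_nome_le_1 tau ltac:(lra))). simpl in HpB.
  pose proof (Cmod_sub_lower (F tau) (c + nome tau * peval p (nome tau))%C). lra.
Qed.

Lemma qholy_mult (y : R) (F G : C -> C) (c d : C) : 0 < y ->
  qholy y F c -> qholy y G d -> qholy y (fun t => F t * G t)%C (c * d)%C.
Proof.
  intros Hy HF HG eps He.
  destruct (qholy_bounded y G d Hy HG) as [B [HB HGB]].
  destruct (HF (eps / (2 * B))) as [p Hp]; [apply Rdiv_lt_0_compat; lra|].
  destruct (peval_bound (c :: p)) as [A [HA HpA]].
  destruct (HG (eps / (2 * (A + 1)))) as [r Hr]; [apply Rdiv_lt_0_compat; lra|].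
  (* Read off from [(c + q P) (d + q R) = c d + q (c R + d P + q P R)]. *)
  exists (padd (padd (map (Cmult c) r) (map (Cmult d) p)) (RtoC 0 :: pmul p r)).
  intros tau Ht. rewrite !peval_padd, !peval_map_scal. simpl. rewrite peval_pmul.
  specialize (Hp tau Ht). specialize (Hr tau Ht). specialize (HGB tau Ht).
  specialize (HpA (nome tau) (Cmod_nome_le_1 tau ltac:(lra))). simpl in HpA.
  set (P := (c + nome tau * peval p (nome tau))%C) in *.
  set (Q := (d + nome tau * peval r (nome tau))%C) in *.
  replace (_ - _)%C with ((F tau - P) * G tau + P * (G tau - Q))%C by (unfold P, Q; ring).
  eapply Rle_trans; [apply Cmod_triangle|]. rewrite !Cmod_mult.
  apply Rle_div_r in Hp; [|lra]. apply Rle_div_r in Hr; [|lra].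
  pose proof (Cmod_ge_0 (F tau - P)%C). pose proof (Cmod_ge_0 (G tau - Q)%C).
  nra.
Qed.

Lemma qhol_const (c : C) : qhol (fun _ => c) c.
Proof. intros y _. apply qholy_const. Qed.

Lemma qhol_plus (F G : C -> C) (c d : C) :
  qhol F c -> qhol G d -> qhol (fun t => F t + G t)%C (c + d)%C.
Proof. intros HF HG y Hy. apply qholy_plus; auto. Qed.

Lemma qhol_mult (F G : C -> C) (c d : C) :
  qhol F c -> qhol G d -> qhol (fun t => F t * G t)%C (c * d)%C.
Proof. intros HF HG y Hy. apply qholy_mult; auto. Qed.

Lemma qholy_pow (y : R) (F : C -> C) (c : C) (n : nat) : 0 < y ->
  qholy y F c -> qholy y (fun t => F t ^ n)%C (c ^ n)%C.
Proof.
  intros Hy H. induction n; simpl; [apply qholy_const | apply qholy_mult; auto].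
Qed.

Lemma qholy_limit (y : R) (F : C -> C) (c : C) :
  (forall eps, 0 < eps -> exists G, qholy y G c /\
     forall tau, y <= Im tau -> Cmod (F tau - G tau)%C <= eps) -> qholy y F c.
Proof.
  intros H eps He. destruct (H (eps / 2) ltac:(lra)) as [G [HG E]].
  destruct (HG (eps / 2) ltac:(lra)) as [p Hp]. exists p. intros tau Ht.
  specialize (Hp tau Ht). specialize (E tau Ht).
  replace (_ - _)%C with ((F tau - G tau) + (G tau - (c + nome tau * peval p (nome tau))))%C by ring.
  eapply Rle_trans; [apply Cmod_triangle|]. lra.
Qed.

(** The shift turns [q] into [- q], and [q p(q)] into [- q p(- q)]. *)
Lemma qholy_shift (y : R) (F : C -> C) (c : C) :
  qholy y F c -> qholy y (fun t => F (t + 1)%C) c.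
Proof.
  intros H eps He. destruct (H eps He) as [p Hp]. exists (map (Cmult (- 1)%C) (pneg p)).
  intros tau Ht. rewrite peval_map_scal, peval_pneg, <- nome_add_1.
  assert (Ht' : y <= Im (tau + 1)%C) by (destruct tau; simpl in *; lra).
  specialize (Hp _ Ht').
  replace (nome tau) with (- nome (tau + 1))%C by (rewrite nome_add_1; ring).
  replace (- nome (tau + 1) * (- 1 * peval p (nome (tau + 1))))%C
    with (nome (tau + 1) * peval p (nome (tau + 1)))%C by ring. exact Hp.
Qed.

(** Doubling squares [q]. Only heights above [2 * y] of [F] enter, which the descent for reciprocals
    exploits. *)
Lemma qholy_double (y : R) (F : C -> C) (c : C) :
  qholy (2 * y) F c -> qholy y (fun t => F (2 * t)%C) c.
Proof.
  intros H eps He. destruct (H eps He) as [p Hp]. exists (RtoC 0 :: psq p).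
  intros tau Ht. simpl. rewrite peval_psq, <- nome_double.
  assert (Ht' : 2 * y <= Im (2 * tau)%C) by (destruct tau; simpl in *; lra).
  specialize (Hp _ Ht').
  replace (nome tau * (0 + nome tau * peval p (nome (2 * tau))))%C
    with (nome (2 * tau) * peval p (nome (2 * tau)))%C by (rewrite nome_double; ring). exact Hp.
Qed.

Lemma qhol_double (F : C -> C) (c : C) : qhol F c -> qhol (fun t => F (2 * t)%C) c.
Proof. intros H y Hy. apply qholy_double, H. lra. Qed.

Lemma qholy_lim (y : R) (F : C -> C) (c : C) : qholy y F c ->
  forall eps, 0 < eps -> exists Y, 0 < Y /\ forall tau, Y <= Im tau -> Cmod (F tau - c)%C <= eps.
Proof.
  intros H eps He. destruct (H (eps / 2) ltac:(lra)) as [p Hp].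
  destruct (peval_bound p) as [B [HB HpB]].
  assert (Hpi1 : 1 <= PI) by (pose proof PI2_1; lra).
  exists (Rmax (Rmax y 1) ((B + 1) / (eps / 2))).
  split. { pose proof (Rmax_l (Rmax y 1) ((B + 1) / (eps / 2))). pose proof (Rmax_r y 1). lra. }
  intros tau Ht.
  assert (Hy : y <= Im tau).
  { eapply Rle_trans; [|apply Ht]. eapply Rle_trans; [|apply Rmax_l]. apply Rmax_l. }
  assert (H1 : 1 <= Im tau).
  { eapply Rle_trans; [|apply Ht]. eapply Rle_trans; [|apply Rmax_l]. apply Rmax_r. }
  assert (H2 : (B + 1) / (eps / 2) <= Im tau).
  { eapply Rle_trans; [|apply Ht]. apply Rmax_r. }
  specialize (Hp tau Hy). specialize (HpB (nome tau) (Cmod_nome_le_1 tau ltac:(lra))).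
  replace (F tau - c)%C with ((F tau - (c + nome tau * peval p (nome tau))) + nome tau * peval p (nome tau))%C by ring.
  eapply Rle_trans; [apply Cmod_triangle|]. rewrite Cmod_mult, Cmod_nome.
  assert (exp (- (PI * Im tau)) * Im tau <= 1).
  { rewrite exp_Ropp, Rmult_comm. apply Rle_div_l; [apply exp_pos|].
    pose proof (exp_ineq1_le (PI * Im tau)). nra. }
  apply Rle_div_l in H2; [|lra].
  pose proof (Cmod_ge_0 (peval p (nome tau))).
  nra.
Qed.

Lemma nome_circle (y x : R) : nome ((2 * x)%R, y) = (exp (- (PI * y)) * ce x)%C.
Proof.
  unfold nome, ce. replace (RtoC (exp (- (PI * y)))) with (Cexp (RtoC (- (PI * y)))).
  - rewrite <- Cexp_add. f_equal. apply Ceq; simpl; ring.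
  - unfold Cexp; apply Ceq; simpl; rewrite ?cos_0, ?sin_0; ring.
Qed.

(** The constant is chosen before [F]; this uniformity stands in for compactness in the maximum
    principle. *)
Lemma qhol_harnack (y : R) : 0 < y -> exists k, 0 < k <= 1 /\
  forall (F : C -> C) (c : C), qhol F c -> (forall tau, 0 < Im tau -> 0 <= Re (F tau)) ->
  forall tau, y <= Im tau -> k * Re c <= Re (F tau) /\ k * Re (F tau) <= Re c.
Proof.
  intros Hy.
  (* The circle [|q| = r] belongs to half the height. Points with [y <= Im tau] then have
     [|q| <= r^2], so [r] serves both as radius and as ratio in [poly_harnack]. *)
  set (y' := y / 2). set (r := exp (- (PI * y'))).
  pose proof PI_RGT_0.
  assert (Hr : 0 < r < 1).
  { unfold r. split; [apply exp_pos|]. rewrite <- exp_0. apply exp_increasing. unfold y'; nra. }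
  exists ((1 - r) / (1 + r)). split.
  { split; [apply Rdiv_lt_0_compat; lra | apply Rle_div_l; lra]. }
  intros F c HF Hpos tau Ht.
  assert (Hk : 0 < (1 - r) / (1 + r) <= 1) by (split; [apply Rdiv_lt_0_compat; lra | apply Rle_div_l; lra]).
  assert (K : forall eps, 0 < eps ->
     (1 - r) / (1 + r) * (Re c + eps) <= Re (F tau) + 2 * eps /\
     (1 - r) / (1 + r) * Re (F tau) <= Re c + eps).
  { intros eps He. destruct (HF y' ltac:(unfold y'; lra) eps He) as [p Hp].
    (* The approximation loses nonnegativity by at most [eps]; raising the constant term restores
       it. *)
    set (P := (c + eps)%C :: p).
    assert (HP : forall z, peval P z = (c + eps + z * peval p z)%C) by reflexivity.
    destruct (poly_harnack P r r (nome tau / r)%C) as [h1 h2].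
    - rewrite Cmod_div, Cmod_R, Rabs_pos_eq, Cmod_nome by (try lra; intros e; apply RtoC_inj in e; lra).
      apply Rle_div_l; [lra|]. unfold r. rewrite <- exp_plus. apply exp_le_compat. unfold y'. nra.
    - lra.
    - intros x. unfold r. rewrite <- nome_circle, HP.
      specialize (Hp ((2 * x)%R, y') ltac:(simpl; lra)).
      specialize (Hpos ((2 * x)%R, y') ltac:(simpl; unfold y'; lra)).
      pose proof (re_le_Cmod (F ((2 * x)%R, y') - (c + nome ((2 * x)%R, y') * peval p (nome ((2 * x)%R, y'))))%C) as h.
      assert (h' := Rle_trans _ _ _ h Hp). apply Rabs_le_between in h'.
      unfold Re in *. cbn [fst snd Cplus Cminus Copp RtoC] in *. lra.
    - rewrite !HP in *.
      replace (r * (nome tau / r))%C with (nome tau) in * by (field; intros e; apply RtoC_inj in e; lra).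
      specialize (Hp tau ltac:(unfold y'; lra)).
      pose proof (re_le_Cmod (F tau - (c + nome tau * peval p (nome tau)))%C) as h.
      assert (h' := Rle_trans _ _ _ h Hp). apply Rabs_le_between in h'.
      replace (c + eps + 0 * peval p 0)%C with (c + eps)%C in * by ring.
      assert (A : Re (c + eps)%C = Re c + eps) by (unfold Re; simpl; ring).
      rewrite A in *.
      assert (B : Re (c + eps + nome tau * peval p (nome tau))%C - eps - eps <= Re (F tau)
              /\ Re (F tau) <= Re (c + eps + nome tau * peval p (nome tau))%C).
      { unfold Re in *. cbn [fst snd Cplus Cminus Copp RtoC] in *. lra. }
      split; [lra|].
      assert (h3 : (1 - r) / (1 + r) * ((1 + r) / (1 - r) * (Re c + eps)) = Re c + eps) by (field; lra).
      rewrite <- h3. apply Rmult_le_compat_l; lra. }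
  split; apply le_epsilon; intros eps He.
  - destruct (K (eps / 2) ltac:(lra)) as [k1 _]. nra.
  - destruct (K eps He) as [_ k2]. lra.
Qed.

(** * Reciprocals and division by the nome *)

(** Partial sums of [1 / F = sum (1 - F)^j], in Horner form so that closure under sums and products
    applies by induction. *)
Fixpoint neumann (F : C -> C) (n : nat) (t : C) : C :=
  match n with O => 1 | S n => (1 + (1 - F t) * neumann F n t)%C end.

Lemma near_1_neq_0 (z : C) : Cmod (z - 1)%C <= / 2 -> z <> 0.
Proof.
  intros H e. rewrite e, Cmod_sub_sym in H. replace (1 - 0)%C with (1 : C) in H by ring.
  rewrite Cmod_1 in H. lra.
Qed.

Lemma qholy_recip (y : R) (F : C -> C) : 0 < y -> qholy y F 1 ->
  (forall tau, y <= Im tau -> Cmod (F tau - 1)%C <= / 2) ->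
  qholy y (fun t => / F t)%C 1.
Proof.
  intros Hy HF Hn.
  assert (HG : forall n, qholy y (neumann F n) 1).
  { induction n; simpl; [apply qholy_const|].
    assert (H1F : qholy y (fun t => 1 - F t)%C (1 + (- 1) * 1)%C).
    { apply (qholy_ext y (fun t => 1 + (- 1) * F t)%C); [intros; ring|].
      apply qholy_plus; [apply qholy_const|].
      apply qholy_mult; auto. apply qholy_const. }
    pose proof (qholy_plus y _ _ _ _ (qholy_const y 1) (qholy_mult y _ _ _ _ Hy H1F IHn)) as K.
    replace (1 + (1 + (- 1) * 1) * 1)%C with (1 : C) in K by ring. exact K. }
  (* The start is [|1 / F - 1| <= 2 + 1], and each step multiplies the error by [1 - F], of modulus
     at most 1/2. *)
  assert (HE : forall n tau, y <= Im tau -> Cmod (/ F tau - neumann F n tau)%C <= 3 * (/ 2) ^ n).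
  { intros n tau Ht. specialize (Hn tau Ht). pose proof (near_1_neq_0 _ Hn) as Hz.
    assert (HB : Cmod (/ F tau)%C <= 2).
    { rewrite Cmod_inv by auto. pose proof (Cmod_sub_lower 1 (1 - F tau)%C).
      rewrite (Cmod_sub_sym 1 (F tau)) in H. replace (1 - (1 - F tau))%C with (F tau) in H by ring.
      rewrite Cmod_1 in H. rewrite <- (Rinv_inv 2). apply Rinv_le_contravar; lra. }
    induction n; simpl neumann; simpl pow.
    - eapply Rle_trans; [apply Cmod_sub_upper|]. rewrite Cmod_1. lra.
    - replace (/ F tau - (1 + (1 - F tau) * neumann F n tau))%C
        with ((1 - F tau) * (/ F tau - neumann F n tau))%C by (field; auto).
      rewrite Cmod_mult, (Cmod_sub_sym 1).
      pose proof (Cmod_ge_0 (/ F tau - neumann F n tau)%C). nra. }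
  apply qholy_limit. intros eps He.
  destruct (pow_lt_1_zero (/ 2) ltac:(rewrite Rabs_pos_eq; lra) (eps / 3) ltac:(lra)) as [N HN].
  exists (neumann F N). split; auto. intros tau Ht.
  specialize (HN N (le_n _)). rewrite Rabs_pos_eq in HN by (apply pow_le; lra).
  pose proof (HE N tau Ht). lra.
Qed.

Lemma peval_hd_tl (p : list C) (z : C) : peval p z = (nth 0 p 0 + z * peval (tl p) z)%C.
Proof. destruct p; simpl; ring. Qed.

Lemma csum_half_bound (f : nat -> C) (B : R) (n : nat) :
  (forall i, Cmod (f i) <= B * (/ 2) ^ i) -> Cmod (csum f n) <= 2 * B.
Proof.
  intros H. assert (HB : 0 <= B).
  { specialize (H O). pose proof (Cmod_ge_0 (f O)). simpl in H. lra. }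
  assert (Cmod (csum f n) <= B * (2 - 2 * (/ 2) ^ n)).
  { induction n; cbn [csum].
    - rewrite Cmod_0. simpl. lra.
    - eapply Rle_trans; [apply Cmod_triangle|]. specialize (H n). simpl. lra. }
  pose proof (pow_le (/ 2) n ltac:(lra)). nra.
Qed.

(** Dividing by [z] costs [1 / r] in Cauchy's estimate for each coefficient. Summing these on the
    disc of half the radius takes the place of the maximum principle and costs the factor 2. *)
Lemma peval_div_bound (s : list C) (r E : R) : 0 < r -> 0 <= E ->
  (forall x, Cmod (r * ce x * peval s (r * ce x))%C <= E) ->
  Cmod (nth 0 s 0) <= E / r /\ forall z, Cmod z <= r / 2 -> Cmod (peval s z) <= 2 * (E / r).
Proof.
  intros Hr HE H.
  assert (K : forall k, Cmod (nth k s 0) * r ^ k <= E / r).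
  { intros k. pose proof (coef_bound (RtoC 0 :: s) r E (S k) ltac:(lra) HE) as h.
    simpl in h. apply (Rle_div_r _ _ r Hr). eapply Rle_trans; [|apply h].
    - right; ring.
    - intros x. rewrite Cplus_0_l. apply H. }
  split.
  - specialize (K O). simpl in K. lra.
  - intros z Hz. rewrite peval_csum. apply csum_half_bound. intros i.
    rewrite Cmod_mult, Cmod_pow.
    assert (Cmod z ^ i <= (r / 2) ^ i) by (apply pow_incr; split; [apply Cmod_ge_0 | auto]).
    unfold Rdiv in H0 at 1. rewrite Rpow_mult_distr in H0.
    pose proof (pow_le (/ 2) i ltac:(lra)). pose proof (Cmod_ge_0 (nth i s 0)).
    eapply Rle_trans; [apply Rmult_le_compat_l; [auto | apply H0]|].
    rewrite <- Rmult_assoc. apply Rmult_le_compat_r; auto.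
Qed.

Definition approx (y : R) (F : C -> C) (c : C) (eps : R) (p : list C) : Prop :=
  forall tau, y <= Im tau -> Cmod (F tau - (c + nome tau * peval p (nome tau)))%C <= eps.

(** Approximations of one function stay close after division by [q]: for [|q| <= r / 2] by the
    coefficient estimates, elsewhere because [1 / |q|] is below [2 / r]. *)
Lemma approx_diff (y : R) (F : C -> C) (c : C) (e1 e2 : R) (p1 p2 : list C) : 0 < y ->
  approx y F c e1 p1 -> approx y F c e2 p2 ->
  Cmod (nth 0 p1 0 - nth 0 p2 0)%C <= (e1 + e2) / exp (- (PI * y)) /\
  forall tau, y <= Im tau ->
    Cmod (peval p1 (nome tau) - peval p2 (nome tau))%C <= 2 * ((e1 + e2) / exp (- (PI * y))).
Proof.
  intros Hy H1 H2. set (r := exp (- (PI * y))). assert (Hr : 0 < r) by apply exp_pos.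
  set (s := padd p1 (map (Cmult (- 1)%C) p2)).
  assert (Hs : forall z, peval s z = (peval p1 z - peval p2 z)%C).
  { intros z. unfold s. rewrite peval_padd, peval_map_scal. ring. }
  assert (HB : forall tau, y <= Im tau -> Cmod (nome tau * peval s (nome tau))%C <= e1 + e2).
  { intros tau Ht. specialize (H1 tau Ht). specialize (H2 tau Ht). rewrite Hs.
    replace (_ * _)%C with ((F tau - (c + nome tau * peval p2 (nome tau))) -
       (F tau - (c + nome tau * peval p1 (nome tau))))%C by ring.
    eapply Rle_trans; [apply Cmod_sub_upper|]. lra. }
  assert (He : 0 <= e1 + e2).
  { specialize (HB (0, y) ltac:(simpl; lra)). pose proof (Cmod_ge_0 (nome (0, y) * peval s (nome (0, y)))%C). lra. }
  destruct (peval_div_bound s r (e1 + e2) Hr He) as [K1 K2].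
  { intros x. unfold r. rewrite <- nome_circle. apply HB. simpl. lra. }
  split.
  - replace (nth 0 p1 0 - nth 0 p2 0)%C with (nth 0 s 0); auto.
    transitivity (peval s 0).
    + rewrite (peval_hd_tl s). ring.
    + rewrite Hs, (peval_hd_tl p1), (peval_hd_tl p2). ring.
  - intros tau Ht. rewrite <- Hs. destruct (Rle_dec (Cmod (nome tau)) (r / 2)) as [h|h]; auto.
    specialize (HB tau Ht). rewrite Cmod_mult in HB.
    replace (2 * ((e1 + e2) / r)) with ((e1 + e2) / (r / 2)) by (field; lra).
    apply Rle_div_r; [lra|]. nra.
Qed.

Lemma approx_quotient (y : R) (F : C -> C) (c : C) (e : R) (p : list C) : 0 < y ->
  qholy y F c -> approx y F c e p -> forall tau, y <= Im tau ->
  Cmod ((F tau - c) / nome tau - peval p (nome tau))%C <= 2 * (e / exp (- (PI * y))).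
Proof.
  intros Hy HF Hp tau Ht. set (r := exp (- (PI * y))). assert (Hr : 0 < r) by apply exp_pos.
  apply le_epsilon. intros d Hd.
  pose proof (nome_neq_0 tau) as Hq. assert (Hq0 : 0 < Cmod (nome tau)) by (apply Cmod_gt_0; auto).
  set (m := Cmod (nome tau)) in *.
  (* The finer approximation [p2] may depend on [tau]: its error is small against [|q|] at this very
     point, so dividing it by [q] is harmless. *)
  set (d' := Rmin (d / 2 * m) (d / 4 * r)).
  assert (Hd' : 0 < d') by (unfold d'; apply Rmin_case; nra).
  destruct (HF d' Hd') as [p2 Hp2].
  destruct (approx_diff y F c e d' p p2 Hy Hp Hp2) as [_ K]. specialize (K tau Ht). fold r in K.
  specialize (Hp2 tau Ht).
  replace (_ - _)%C with ((F tau - (c + nome tau * peval p2 (nome tau))) / nome tau -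
     (peval p (nome tau) - peval p2 (nome tau)))%C by (field; auto).
  eapply Rle_trans; [apply Cmod_sub_upper|].
  rewrite Cmod_div by auto. fold m.
  assert (A1 : d' <= d / 2 * m) by apply Rmin_l. assert (A2 : d' <= d / 4 * r) by apply Rmin_r.
  assert (B1 : Cmod (F tau - (c + nome tau * peval p2 (nome tau)))%C / m <= d / 2).
  { apply Rle_div_l; lra. }
  assert (B2 : d' / r <= d / 4) by (apply Rle_div_l; lra).
  replace ((e + d') / r) with (e / r + d' / r) in K by (field; lra). lra.
Qed.

Lemma C_cauchy_lim (u : nat -> C) :
  (forall eps, 0 < eps -> exists N, forall n m, (N <= n)%nat -> (N <= m)%nat -> Cmod (u n - u m)%C <= eps) ->
  exists l, forall eps, 0 < eps -> exists N, forall n, (N <= n)%nat -> Cmod (u n - l)%C <= eps.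
Proof.
  intros H.
  assert (L : forall g : C -> R, (forall z w, Rabs (g z - g w) <= Cmod (z - w)%C) ->
     exists l : R, is_lim_seq (fun n => g (u n)) l).
  { intros g Hg. apply ex_lim_seq_cauchy_corr. intros eps.
    destruct (H (eps / 2)) as [N HN]; [pose proof (cond_pos eps); lra|].
    exists N. intros n m Hn Hm. pose proof (HN n m Hn Hm). pose proof (Hg (u n) (u m)).
    pose proof (cond_pos eps). lra. }
  destruct (L Re) as [a Ha].
  { intros z w. pose proof (re_le_Cmod (z - w)%C). exact H0. }
  destruct (L Im) as [b Hb].
  { intros z w. pose proof (Im_le_Cmod (z - w)%C). exact H0. }
  exists (a, b). intros eps He.
  apply is_lim_seq_spec in Ha. apply is_lim_seq_spec in Hb.
  assert (He2 : 0 < eps / 2) by lra.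
  destruct (Ha (mkposreal _ He2)) as [N1 H1]. destruct (Hb (mkposreal _ He2)) as [N2 H2].
  exists (N1 + N2)%nat. intros n Hn.
  specialize (H1 n ltac:(lia)). specialize (H2 n ltac:(lia)). simpl in H1, H2.
  eapply Rle_trans; [apply Cmod_le_sum|]. unfold Re, Im in *. simpl. unfold Rminus in *. lra.
Qed.

(** A removable singularity at the cusp. The new value [d] is the limit of the constant coefficients
    of approximations at height 1, a Cauchy sequence by [approx_diff]. *)
Lemma qhol_div_nome (F : C -> C) (c : C) : qhol F c ->
  exists d, qhol (fun t => (F t - c) / nome t)%C d.
Proof.
  intros HF.
  destruct (functional_choice (fun n p => approx 1 F c (/ INR (S n)) p)) as [p Hp].
  { intros n. apply (HF 1); [lra|]. apply Rinv_0_lt_compat, lt_0_INR. lia. }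
  set (r := exp (- (PI * 1))). assert (Hr : 0 < r) by apply exp_pos.
  assert (small : forall eps, 0 < eps -> exists N, forall n, (N <= n)%nat -> / INR (S n) <= eps).
  { intros eps He. destruct (archimed_cor1 eps He) as [N [HN HN0]]. exists N. intros n Hn.
    eapply Rle_trans; [|left; apply HN]. apply Rinv_le_contravar; [apply lt_0_INR; lia | apply le_INR; lia]. }
  destruct (C_cauchy_lim (fun n => nth 0 (p n) 0)) as [d Hd].
  { intros eps He. destruct (small (eps * r / 2)) as [N HN]; [apply Rdiv_lt_0_compat; [apply Rmult_lt_0_compat|]; lra|].
    exists N. intros n m Hn Hm.
    destruct (approx_diff 1 F c _ _ _ _ ltac:(lra) (Hp n) (Hp m)) as [K _].
    eapply Rle_trans; [apply K|]. fold r. apply Rle_div_l; auto.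
    pose proof (HN n Hn). pose proof (HN m Hm). lra. }
  exists d. intros y Hy eps He.
  (* An approximation at height [y1] is also one at height 1, which ties its constant coefficient to
     [d]. *)
  set (y1 := Rmin y 1). assert (Hy1 : 0 < y1) by (unfold y1; apply Rmin_case; lra).
  set (r1 := exp (- (PI * y1))). assert (Hr1 : 0 < r1) by apply exp_pos.
  set (e1 := Rmin (eps / 6 * r) (eps / 6 * r1)).
  assert (He1 : 0 < e1) by (unfold e1; apply Rmin_case; nra).
  assert (A1 : e1 <= eps / 6 * r) by apply Rmin_l. assert (A2 : e1 <= eps / 6 * r1) by apply Rmin_r.
  destruct (HF y1 Hy1 e1 He1) as [s Hs].
  assert (Hs1 : approx 1 F c e1 s).
  { intros tau Ht. apply Hs. eapply Rle_trans; [apply Rmin_r | exact Ht]. }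
  assert (Hsd : Cmod (nth 0 s 0 - d)%C <= eps / 2).
  { destruct (Hd (eps / 6) ltac:(lra)) as [N1 HN1]. destruct (small (eps / 6 * r)) as [N2 HN2]; [nra|].
    specialize (HN1 (N1 + N2)%nat ltac:(lia)). specialize (HN2 (N1 + N2)%nat ltac:(lia)).
    destruct (approx_diff 1 F c _ _ _ _ ltac:(lra) Hs1 (Hp (N1 + N2)%nat)) as [K _]. fold r in K.
    replace (nth 0 s 0 - d)%C with ((nth 0 s 0 - nth 0 (p (N1 + N2)%nat) 0) + (nth 0 (p (N1 + N2)%nat) 0 - d))%C by ring.
    eapply Rle_trans; [apply Cmod_triangle|].
    assert ((e1 + / INR (S (N1 + N2))) / r <= eps / 3) by (apply Rle_div_l; lra). lra. }
  exists (tl s). intros tau Ht.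
  assert (Ht1 : y1 <= Im tau) by (eapply Rle_trans; [apply Rmin_l | exact Ht]).
  pose proof (approx_quotient y1 F c e1 s Hy1 (HF y1 Hy1) Hs tau Ht1) as K. fold r1 in K.
  assert (e1 / r1 <= eps / 6) by (apply Rle_div_l; lra).
  rewrite (peval_hd_tl s) in K.
  replace (_ - _)%C with (((F tau - c) / nome tau - (nth 0 s 0 + nome tau * peval (tl s) (nome tau)))
     + (nth 0 s 0 - d))%C by ring.
  eapply Rle_trans; [apply Cmod_triangle|]. lra.
Qed.

(** * Unordered sums *)

Definition lsum {I : Type} (f : I -> C) (L : list I) : C :=
  fold_right (fun i s => f i + s)%C 0 L.

Definition lsumR {I : Type} (f : I -> R) (L : list I) : R :=
  fold_right (fun i s => f i + s) 0 L.

Lemma lsum_app {I} (f : I -> C) (L M : list I) : lsum f (L ++ M) = (lsum f L + lsum f M)%C.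
Proof. induction L; simpl; [ring | rewrite IHL; ring]. Qed.

Lemma lsumR_app {I} (f : I -> R) (L M : list I) : lsumR f (L ++ M) = lsumR f L + lsumR f M.
Proof. induction L; simpl; [ring | rewrite IHL; ring]. Qed.

Lemma lsum_perm {I} (f : I -> C) (L M : list I) : Permutation L M -> lsum f L = lsum f M.
Proof. induction 1; simpl; try congruence. ring. Qed.

Lemma lsumR_perm {I} (f : I -> R) (L M : list I) : Permutation L M -> lsumR f L = lsumR f M.
Proof. induction 1; simpl; try congruence. ring. Qed.

Lemma lsum_map {I J} (g : I -> J) (f : J -> C) (L : list I) :
  lsum f (map g L) = lsum (fun i => f (g i)) L.
Proof. induction L; simpl; congruence. Qed.

Lemma lsumR_map {I J} (g : I -> J) (f : J -> R) (L : list I) :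
  lsumR f (map g L) = lsumR (fun i => f (g i)) L.
Proof. induction L; simpl; congruence. Qed.

Lemma lsum_plus {I} (f g : I -> C) (L : list I) :
  lsum (fun i => f i + g i)%C L = (lsum f L + lsum g L)%C.
Proof. induction L; simpl; [ring | rewrite IHL; ring]. Qed.

Lemma lsum_scal {I} (c : C) (f : I -> C) (L : list I) : lsum (fun i => c * f i)%C L = (c * lsum f L)%C.
Proof. induction L; simpl; [ring | rewrite IHL; ring]. Qed.

Lemma lsumR_scal {I} (c : R) (f : I -> R) (L : list I) : lsumR (fun i => c * f i) L = c * lsumR f L.
Proof. induction L; simpl; [ring | rewrite IHL; ring]. Qed.

Lemma lsum_ext {I} (f g : I -> C) (L : list I) : (forall i, f i = g i) -> lsum f L = lsum g L.
Proof. intros H. induction L; simpl; congruence. Qed.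

Lemma lsum_RtoC {I} (f : I -> R) (L : list I) : lsum (fun i => RtoC (f i)) L = RtoC (lsumR f L).
Proof. induction L; simpl; [reflexivity | rewrite IHL, RtoC_plus; reflexivity]. Qed.

Lemma lsum_Cmod {I} (f : I -> C) (L : list I) : Cmod (lsum f L) <= lsumR (fun i => Cmod (f i)) L.
Proof.
  induction L; simpl; [rewrite Cmod_0; lra|].
  eapply Rle_trans; [apply Cmod_triangle|]. lra.
Qed.

Lemma lsumR_nonneg {I} (f : I -> R) (L : list I) : (forall i, 0 <= f i) -> 0 <= lsumR f L.
Proof. intros H. induction L; simpl; [lra | specialize (H a); lra]. Qed.

Lemma lsumR_le {I} (f g : I -> R) (L : list I) :
  (forall i, f i <= g i) -> lsumR f L <= lsumR g L.
Proof. intros H. induction L; simpl; [lra | specialize (H a); lra]. Qed.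

Lemma NoDup_incl_perm {I} (L M : list I) : NoDup L -> incl L M ->
  exists K, Permutation M (L ++ K).
Proof.
  revert M. induction L as [|a L IH]; intros M HL HM.
  - exists M. apply Permutation_refl.
  - inversion HL; subst.
    destruct (in_split a M) as [M1 [M2 E]]; [apply HM; left; auto|]. subst.
    destruct (IH (M1 ++ M2)) as [K HK]; auto.
    + intros x Hx. specialize (HM x (or_intror Hx)). apply in_app_or in HM.
      apply in_or_app. simpl in HM. destruct HM as [h|[h|h]]; auto. congruence.
    + exists K. simpl. rewrite <- HK. symmetry. apply Permutation_middle.
Qed.

Lemma lsum_incl_diff {I} (f : I -> C) (L M : list I) : NoDup L -> incl L M ->
  Cmod (lsum f M - lsum f L)%C <= lsumR (fun i => Cmod (f i)) M - lsumR (fun i => Cmod (f i)) L.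
Proof.
  intros HL HM. destruct (NoDup_incl_perm L M HL HM) as [K HK].
  rewrite (lsum_perm f _ _ HK), (lsumR_perm _ _ _ HK), lsum_app, lsumR_app.
  replace (_ - _)%C with (lsum f K) by ring. pose proof (lsum_Cmod f K). lra.
Qed.

Lemma lsumR_incl {I} (f : I -> R) (L M : list I) : (forall i, 0 <= f i) -> NoDup L -> incl L M ->
  lsumR f L <= lsumR f M.
Proof.
  intros Hf HL HM. destruct (NoDup_incl_perm L M HL HM) as [K HK].
  rewrite (lsumR_perm _ _ _ HK), lsumR_app. pose proof (lsumR_nonneg f K Hf). lra.
Qed.

Lemma NoDup_exists {I} (L : list I) : exists M, NoDup M /\ incl L M /\ incl M L.
Proof.
  induction L as [|a L [M [H1 [H2 H3]]]].
  - exists []. repeat split; try constructor; intros x [].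
  - destruct (classic (In a M)) as [h|h].
    + exists M. repeat split; auto.
      * intros x [e|Hx]; [subst; auto | auto].
      * intros x Hx. right. auto.
    + exists (a :: M). repeat split.
      * constructor; auto.
      * intros x [e|Hx]; [subst; left; auto | right; auto].
      * intros x [e|Hx]; [subst; left; auto | right; auto].
Qed.

(** Convergence along finite subsets, coded by duplicate-free lists. It is invariant under
    bijections of the index set, as the change of lattice in Landen's identities requires. *)
Definition has_sum {I : Type} (f : I -> C) (s : C) : Prop :=
  forall eps, 0 < eps -> exists L0, forall L, NoDup L -> incl L0 L -> Cmod (lsum f L - s)%C <= eps.

Lemma has_sum_pick {I} (f : I -> C) (s : C) (L1 : list I) : has_sum f s -> forall eps, 0 < eps ->
  exists L0, NoDup L0 /\ incl L1 L0 /\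
    forall L, NoDup L -> incl L0 L -> Cmod (lsum f L - s)%C <= eps.
Proof.
  intros H eps He. destruct (H eps He) as [L0 HL0].
  destruct (NoDup_exists (L1 ++ L0)) as [M [h1 [h2 h3]]]. exists M. repeat split; auto.
  - intros x Hx. apply h2, in_or_app; auto.
  - intros L HL Hi. apply HL0; auto. intros x Hx. apply Hi, h2, in_or_app; auto.
Qed.

Lemma Cmod_small_eq (z w : C) : (forall eps, 0 < eps -> Cmod (z - w)%C <= eps) -> z = w.
Proof.
  intros H. assert (Cmod (z - w)%C <= 0) by (apply le_epsilon; intros e He; rewrite Rplus_0_l; auto).
  assert (Cmod (z - w)%C = 0) by (pose proof (Cmod_ge_0 (z - w)%C); lra).
  apply Cmod_eq_0 in H1. replace z with (z - w + w)%C by ring. rewrite H1. ring.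
Qed.

Lemma has_sum_unique {I} (f : I -> C) (s t : C) : has_sum f s -> has_sum f t -> s = t.
Proof.
  intros Hs Ht. apply Cmod_small_eq. intros eps He.
  destruct (Ht (eps / 2) ltac:(lra)) as [L1 HL1].
  destruct (has_sum_pick f s L1 Hs (eps / 2) ltac:(lra)) as [L [h1 [h2 h3]]].
  pose proof (HL1 L h1 h2). pose proof (h3 L h1 (incl_refl L)).
  replace (s - t)%C with ((lsum f L - t) - (lsum f L - s))%C by ring.
  unfold Cminus at 1. eapply Rle_trans; [apply Cmod_triangle|]. rewrite Cmod_opp. lra.
Qed.

Lemma has_sum_ext {I} (f g : I -> C) (s : C) : (forall i, f i = g i) -> has_sum f s -> has_sum g s.
Proof.
  intros E H eps He. destruct (H eps He) as [L0 H0]. exists L0. intros L h1 h2.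
  rewrite <- (lsum_ext f g); auto.
Qed.

Lemma has_sum_plus {I} (f g : I -> C) (s t : C) :
  has_sum f s -> has_sum g t -> has_sum (fun i => f i + g i)%C (s + t)%C.
Proof.
  intros Hf Hg eps He. destruct (Hf (eps / 2) ltac:(lra)) as [L1 H1].
  destruct (Hg (eps / 2) ltac:(lra)) as [L2 H2]. exists (L1 ++ L2). intros L h1 h2.
  rewrite lsum_plus.
  assert (i1 : incl L1 L) by (intros x Hx; apply h2, in_or_app; auto).
  assert (i2 : incl L2 L) by (intros x Hx; apply h2, in_or_app; auto).
  specialize (H1 L h1 i1). specialize (H2 L h1 i2).
  replace (_ - _)%C with ((lsum f L - s) + (lsum g L - t))%C by ring.
  eapply Rle_trans; [apply Cmod_triangle|]. lra.
Qed.

Lemma has_sum_scal {I} (c : C) (f : I -> C) (s : C) :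
  has_sum f s -> has_sum (fun i => c * f i)%C (c * s)%C.
Proof.
  intros Hf eps He. pose proof (Cmod_ge_0 c).
  destruct (Hf (eps / (Cmod c + 1))) as [L1 H1]; [apply Rdiv_lt_0_compat; lra|].
  exists L1. intros L h1 h2. specialize (H1 L h1 h2). rewrite lsum_scal.
  replace (_ - _)%C with (c * (lsum f L - s))%C by ring. rewrite Cmod_mult.
  apply Rle_div_r in H1; [|lra]. nra.
Qed.

Lemma has_sum_bound {I} (f : I -> C) (s : C) (B : R) : has_sum f s ->
  (forall L, NoDup L -> lsumR (fun i => Cmod (f i)) L <= B) -> Cmod s <= B.
Proof.
  intros H HB. apply le_epsilon. intros eps He.
  destruct (has_sum_pick f s [] H eps He) as [L [h1 [_ h3]]].
  pose proof (h3 L h1 (incl_refl L)). pose proof (HB L h1). pose proof (lsum_Cmod f L).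
  replace s with (lsum f L - (lsum f L - s))%C by ring.
  unfold Cminus at 1. eapply Rle_trans; [apply Cmod_triangle|]. rewrite Cmod_opp. lra.
Qed.

Lemma has_sum_reindex {I J} (f : J -> C) (s : C) (g : I -> J) (h : J -> I) :
  (forall i, h (g i) = i) -> (forall j, g (h j) = j) ->
  has_sum f s -> has_sum (fun i => f (g i)) s.
Proof.
  intros hg gh H eps He. destruct (H eps He) as [L0 H0]. exists (map h L0).
  intros L h1 h2. rewrite <- lsum_map. apply H0.
  - apply FinFun.Injective_map_NoDup; auto. intros x y E. rewrite <- (hg x), <- (hg y), E. reflexivity.
  - intros x Hx. rewrite <- (gh x). apply in_map. apply h2. apply in_map. auto.
Qed.

Lemma sum_list_split {I J} (f : I + J -> C) (L : list (I + J)) : NoDup L ->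
  exists LI LJ, NoDup LI /\ NoDup LJ /\ (forall i, In i LI <-> In (inl i) L) /\
   (forall j, In j LJ <-> In (inr j) L) /\
   lsum f L = (lsum (fun i => f (inl i)) LI + lsum (fun j => f (inr j)) LJ)%C.
Proof.
  induction L as [|[i|j] L IH]; intros HL.
  - exists [], []. repeat split; try constructor; simpl; auto; try (intros []). ring.
  - inversion HL; subst. destruct (IH H2) as [LI [LJ [h1 [h2 [h3 [h4 h5]]]]]].
    exists (i :: LI), LJ. repeat split; auto.
    + constructor; auto. intros h. apply H1, h3, h.
    + intros [e|e]; [subst; left; auto | right; apply h3; auto].
    + intros [e|e]; [injection e as e; subst; left; auto | right; apply h3; auto].
    + intros e. right. apply h4; auto.
    + intros [e|e]; [discriminate | apply h4; auto].
    + simpl. rewrite h5. ring.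
  - inversion HL; subst. destruct (IH H2) as [LI [LJ [h1 [h2 [h3 [h4 h5]]]]]].
    exists LI, (j :: LJ). repeat split; auto.
    + constructor; auto. intros h. apply H1, h4, h.
    + intros e. right. apply h3; auto.
    + intros [e|e]; [discriminate | apply h3; auto].
    + intros [e|e]; [subst; left; auto | right; apply h4; auto].
    + intros [e|e]; [injection e as e; subst; left; auto | right; apply h4; auto].
    + simpl. rewrite h5. ring.
Qed.

Lemma has_sum_sum {I J} (f : I + J -> C) (s t : C) :
  has_sum (fun i => f (inl i)) s -> has_sum (fun j => f (inr j)) t -> has_sum f (s + t)%C.
Proof.
  intros Hs Ht eps He. destruct (Hs (eps / 2) ltac:(lra)) as [L1 H1].
  destruct (Ht (eps / 2) ltac:(lra)) as [L2 H2].
  exists (map inl L1 ++ map inr L2). intros L HL Hi.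
  destruct (sum_list_split f L HL) as [LI [LJ [h1 [h2 [h3 [h4 h5]]]]]]. rewrite h5.
  specialize (H1 LI h1). specialize (H2 LJ h2).
  assert (A1 : incl L1 LI). { intros x Hx. apply h3, Hi, in_or_app. left. apply in_map; auto. }
  assert (A2 : incl L2 LJ). { intros x Hx. apply h4, Hi, in_or_app. right. apply in_map; auto. }
  specialize (H1 A1). specialize (H2 A2).
  replace (_ - _)%C with ((lsum (fun i => f (inl i)) LI - s) + (lsum (fun j => f (inr j)) LJ - t))%C by ring.
  eapply Rle_trans; [apply Cmod_triangle|]. lra.
Qed.

Lemma lsum_prod {I J} (f : I -> C) (g : J -> C) (L : list I) (M : list J) :
  lsum (fun p => f (fst p) * g (snd p))%C (list_prod L M) = (lsum f L * lsum g M)%C.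
Proof.
  induction L; simpl; [ring|]. rewrite lsum_app, IHL, lsum_map. simpl. rewrite lsum_scal. ring.
Qed.

Lemma lsumR_prod {I J} (f : I -> R) (g : J -> R) (L : list I) (M : list J) :
  lsumR (fun p => f (fst p) * g (snd p)) (list_prod L M) = lsumR f L * lsumR g M.
Proof.
  induction L; simpl; [ring|]. rewrite lsumR_app, IHL, lsumR_map. simpl. rewrite lsumR_scal. ring.
Qed.

Lemma NoDup_list_prod {I J} (L : list I) (M : list J) : NoDup L -> NoDup M -> NoDup (list_prod L M).
Proof.
  intros HL HM. induction HL; simpl; [constructor|].
  apply NoDup_app; auto.
  - apply FinFun.Injective_map_NoDup; auto. intros a b e. congruence.
  - intros [a b] Ha Hb. apply in_map_iff in Ha. destruct Ha as [c [e _]]. injection e as e1 e2. subst.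
    apply in_prod_iff in Hb. tauto.
Qed.

Lemma has_sum_abs_near {I} (f : I -> C) (S : R) (L0 : list I) (eps : R) :
  (forall L, NoDup L -> incl L0 L -> Cmod (lsum (fun i => RtoC (Cmod (f i))) L - S)%C <= eps) ->
  forall L, NoDup L -> incl L0 L -> Rabs (lsumR (fun i => Cmod (f i)) L - S) <= eps.
Proof.
  intros H L h1 h2. specialize (H L h1 h2). rewrite lsum_RtoC, <- RtoC_minus, Cmod_R in H. exact H.
Qed.

(** The sum of the absolute values is carried along because it controls products of unordered
    sums. *)
Definition abs_sum {I} (f : I -> C) (s : C) (S : R) : Prop :=
  has_sum f s /\ has_sum (fun i => RtoC (Cmod (f i))) (RtoC S).

(** A finite set [L] of pairs that contains [K x M] lies inside the product [K' x M'] of its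
    enlarged projections. The sum over that product factors, and what [L] misses is at most the gap
    between the absolute sums over [K' x M'] and [K x M], which are both close to [S T]. *)
Lemma has_sum_prod {I J} (f : I -> C) (g : J -> C) (s t : C) (S T : R) :
  abs_sum f s S -> abs_sum g t T ->
  has_sum (fun p => f (fst p) * g (snd p))%C (s * t)%C.
Proof.
  intros [Hf HF] [Hg HG] eps He.
  set (A := Cmod s + Cmod t + Rabs S + Rabs T + 2).
  assert (HA : 0 < A).
  { unfold A. pose proof (Cmod_ge_0 s). pose proof (Cmod_ge_0 t). pose proof (Rabs_pos S). pose proof (Rabs_pos T). lra. }
  set (d := Rmin 1 (eps / (4 * A))).
  assert (Hd : 0 < d) by (unfold d; apply Rmin_case; [lra | apply Rdiv_lt_0_compat; lra]).
  assert (Hd1 : d <= 1) by apply Rmin_l.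
  assert (Hd2 : d * A <= eps / 4).
  { assert (h : d <= eps / (4 * A)) by apply Rmin_r. apply Rle_div_r in h; [|lra]. lra. }
  destruct (Hf d Hd) as [K1 HK1]. destruct (Hg d Hd) as [M1 HM1].
  destruct (has_sum_pick _ _ K1 HF d Hd) as [K [k1 [k2 k3]]].
  destruct (has_sum_pick _ _ M1 HG d Hd) as [M [m1 [m2 m3]]].
  pose proof (has_sum_abs_near f S K d k3) as k4. pose proof (has_sum_abs_near g T M d m3) as m4.
  clear k3 m3.
  exists (list_prod K M). intros L HL Hi.
  destruct (NoDup_exists (K ++ map fst L)) as [K' [n1 [n2 n3]]].
  destruct (NoDup_exists (M ++ map snd L)) as [M' [o1 [o2 o3]]].
  assert (iK : incl K K') by (intros x Hx; apply n2, in_or_app; auto).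
  assert (iM : incl M M') by (intros x Hx; apply o2, in_or_app; auto).
  set (F := fun p : I * J => (f (fst p) * g (snd p))%C).
  assert (E1 : Cmod (lsum F (list_prod K' M') - lsum F L)%C <=
     lsumR (fun p => Cmod (F p)) (list_prod K' M') - lsumR (fun p => Cmod (F p)) L).
  { apply lsum_incl_diff; auto. intros [a b] Hab. apply in_prod.
    - apply n2, in_or_app. right. apply (in_map fst) in Hab. exact Hab.
    - apply o2, in_or_app. right. apply (in_map snd) in Hab. exact Hab. }
  assert (E2 : lsumR (fun p => Cmod (F p)) (list_prod K M) <= lsumR (fun p => Cmod (F p)) L).
  { apply lsumR_incl; auto. intros; apply Cmod_ge_0. apply NoDup_list_prod; auto. }
  assert (EF : forall X Y, lsumR (fun p => Cmod (F p)) (list_prod X Y) =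
     lsumR (fun i => Cmod (f i)) X * lsumR (fun j => Cmod (g j)) Y).
  { intros X Y. rewrite <- lsumR_prod. unfold F.
    induction (list_prod X Y) as [|p l IH]; simpl; [reflexivity | rewrite IH, Cmod_mult; reflexivity]. }
  rewrite !EF in *. unfold F in E1 at 1. rewrite lsum_prod in E1.
  pose proof (k4 K k1 (incl_refl _)) as a1. pose proof (k4 K' n1 iK) as a2.
  pose proof (m4 M m1 (incl_refl _)) as b1. pose proof (m4 M' o1 iM) as b2.
  pose proof (HK1 K' n1 ltac:(intros x Hx; apply iK, k2, Hx)) as c1.
  pose proof (HM1 M' o1 ltac:(intros x Hx; apply iM, m2, Hx)) as c2.
  set (sK := lsumR (fun i => Cmod (f i)) K) in *. set (sK' := lsumR (fun i => Cmod (f i)) K') in *.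
  set (sM := lsumR (fun i => Cmod (g i)) M) in *. set (sM' := lsumR (fun i => Cmod (g i)) M') in *.
  set (x := lsum f K') in *. set (y := lsum g M') in *.
  assert (D1 : sK' * sM' - sK * sM <= eps / 2).
  { apply Rabs_le_between in a1. apply Rabs_le_between in a2. apply Rabs_le_between in b1. apply Rabs_le_between in b2.
    assert (hS : Rabs S <= A - 2 - Rabs T) by (unfold A; pose proof (Cmod_ge_0 s); pose proof (Cmod_ge_0 t); lra).
    assert (S <= Rabs S) by apply RRle_abs. assert (T <= Rabs T) by apply RRle_abs.
    assert (0 <= sM') by (apply lsumR_nonneg; intros; apply Cmod_ge_0).
    assert (0 <= sK) by (apply lsumR_nonneg; intros; apply Cmod_ge_0).
    replace (sK' * sM' - sK * sM) with ((sK' - sK) * sM' + sK * (sM' - sM)) by ring.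
    nra. }
  assert (D2 : Cmod (x * y - s * t)%C <= eps / 4).
  { replace (x * y - s * t)%C with ((x - s) * y + s * (y - t))%C by ring.
    eapply Rle_trans; [apply Cmod_triangle|]. rewrite !Cmod_mult.
    assert (hy : Cmod y <= Cmod t + d).
    { replace y with (t + (y - t))%C by ring. eapply Rle_trans; [apply Cmod_triangle|]. lra. }
    pose proof (Cmod_ge_0 s). pose proof (Cmod_ge_0 y). pose proof (Cmod_ge_0 (x - s)%C).
    assert (Cmod s + Cmod t + 2 <= A) by (unfold A; pose proof (Rabs_pos S); pose proof (Rabs_pos T); lra).
    nra. }
  replace (lsum F L - s * t)%C with ((x * y - s * t) - (x * y - lsum F L))%C by ring.
  unfold Cminus at 1. eapply Rle_trans; [apply Cmod_triangle|]. rewrite Cmod_opp. lra.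
Qed.

(** * From unordered sums to convergent series *)

Lemma sum_n_csum (u : nat -> C) (n : nat) : @sum_n C_AbelianMonoid u n = csum u (S n).
Proof.
  induction n.
  - rewrite sum_O. simpl. ring.
  - rewrite sum_Sn, IHn. reflexivity.
Qed.

Lemma C_is_series_spec (u : nat -> C) (l : C) :
  C_is_series u l <->
  forall eps, 0 < eps -> exists N, forall n, (N <= n)%nat -> Cmod (csum u n - l)%C <= eps.
Proof.
  unfold C_is_series, is_series. split.
  - intros H eps He.
    pose proof (proj1 (filterlim_locally_ball_norm (K := C_AbsRing) (U := C_NormedModule) _ _) H (mkposreal eps He)) as [N HN].
    exists (S N). intros n Hn. destruct n as [|n]; [lia|].
    specialize (HN n ltac:(lia)). unfold ball_norm in HN. rewrite <- sum_n_csum. left. exact HN.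
  - intros H. apply (proj2 (filterlim_locally_ball_norm (K := C_AbsRing) (U := C_NormedModule) _ _)).
    intros eps. destruct (H (eps / 2)) as [N HN]; [pose proof (cond_pos eps); lra|].
    exists N. intros n Hn. specialize (HN (S n) ltac:(lia)).
    unfold ball_norm. rewrite <- sum_n_csum in HN.
    change (Cmod (@sum_n C_AbelianMonoid u n - l)%C < eps). pose proof (cond_pos eps). lra.
Qed.

Lemma C_is_series_unique (u : nat -> C) (l l' : C) : C_is_series u l -> C_is_series u l' -> l = l'.
Proof.
  rewrite !C_is_series_spec. intros H H'. apply Cmod_small_eq. intros eps He.
  destruct (H (eps / 2) ltac:(lra)) as [N HN]. destruct (H' (eps / 2) ltac:(lra)) as [N' HN'].
  specialize (HN (N + N')%nat ltac:(lia)). specialize (HN' (N + N')%nat ltac:(lia)).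
  replace (l - l')%C with ((csum u (N + N') - l') - (csum u (N + N') - l))%C by ring.
  eapply Rle_trans; [apply Cmod_sub_upper|]. lra.
Qed.

Lemma Re_csum (u : nat -> C) (n : nat) : Re (csum u (S n)) = sum_n (fun i => Re (u i)) n.
Proof.
  induction n.
  - rewrite sum_O. unfold Re. simpl. ring.
  - rewrite sum_Sn, <- IHn. reflexivity.
Qed.

Lemma Im_csum (u : nat -> C) (n : nat) : Im (csum u (S n)) = sum_n (fun i => Im (u i)) n.
Proof.
  induction n.
  - rewrite sum_O. unfold Im. simpl. ring.
  - rewrite sum_Sn, <- IHn. reflexivity.
Qed.

Lemma C_Series_eq (u : nat -> C) (l : C) : C_is_series u l -> C_Series u = l.
Proof.
  rewrite C_is_series_spec. intros H. unfold C_Series.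
  assert (Hl : forall g : C -> R, (forall z w, Rabs (g z - g w) <= Cmod (z - w)%C) ->
    (forall n, g (csum u (S n)) = sum_n (fun i => g (u i)) n) ->
    Series (fun n => g (u n)) = g l).
  { intros g Hg Hs. apply is_series_unique.
    change (is_lim_seq (sum_n (fun n => g (u n))) (g l)). apply is_lim_seq_spec. intros eps.
    destruct (H (eps / 2)) as [N HN]; [pose proof (cond_pos eps); lra|].
    exists N. intros n Hn. rewrite <- Hs. specialize (HN (S n) ltac:(lia)).
    specialize (Hg (csum u (S n)) l). pose proof (cond_pos eps). lra. }
  apply Ceq; simpl; apply Hl; auto using Re_csum, Im_csum.
  - intros z w. apply (re_le_Cmod (z - w)%C).
  - intros z w. apply (Im_le_Cmod (z - w)%C).
Qed.

Lemma csum_lsum (u : nat -> C) (n : nat) : csum u n = lsum u (seq 0 n).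
Proof.
  induction n; [reflexivity|].
  rewrite seq_S, lsum_app, <- IHn. simpl. ring.
Qed.

Lemma geom_lsumR_seq (r : R) (N K : nat) : r < 1 ->
  lsumR (fun n => r ^ n) (seq N K) = (r ^ N - r ^ (N + K)) / (1 - r).
Proof.
  intros Hr. revert N. induction K; intros N; simpl.
  - rewrite Nat.add_0_r. field. lra.
  - rewrite IHK. replace (N + S K)%nat with (S N + K)%nat by lia. simpl. field. lra.
Qed.

Lemma geom_tail_bound (r : R) (N : nat) (L : list nat) : 0 <= r < 1 -> NoDup L ->
  (forall n, In n L -> (N <= n)%nat) -> lsumR (fun n => r ^ n) L <= r ^ N / (1 - r).
Proof.
  intros Hr HL HN.
  apply Rle_trans with (lsumR (fun n => r ^ n) (seq N (S (list_max L)))).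
  - apply lsumR_incl; auto. intros; apply pow_le; lra.
    intros x Hx. apply in_seq. split; auto.
    pose proof (proj1 (list_max_le L (list_max L)) (le_n _)) as h.
    rewrite Forall_forall in h. specialize (h x Hx). lia.
  - rewrite geom_lsumR_seq by lra. unfold Rdiv. apply Rmult_le_compat_r.
    + left. apply Rinv_0_lt_compat. lra.
    + pose proof (pow_le r (N + S (list_max L)) ltac:(lra)). lra.
Qed.

Lemma geom_tail_Cmod (u : nat -> C) (C0 r : R) (N : nat) (L : list nat) : 0 <= r < 1 ->
  (forall n, Cmod (u n) <= C0 * r ^ n) -> NoDup L -> (forall n, In n L -> (N <= n)%nat) ->
  lsumR (fun n => Cmod (u n)) L <= C0 * (r ^ N / (1 - r)).
Proof.
  intros Hr Hu HL HN.
  assert (HC : 0 <= C0).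
  { specialize (Hu O). pose proof (Cmod_ge_0 (u O)). simpl in Hu. lra. }
  eapply Rle_trans; [apply lsumR_le; apply Hu|]. rewrite lsumR_scal.
  apply Rmult_le_compat_l; auto. apply geom_tail_bound; auto.
Qed.

Lemma pow_small (r C0 eps : R) : 0 <= r < 1 -> 0 < eps ->
  exists N, forall n, (N <= n)%nat -> C0 * (r ^ n / (1 - r)) <= eps.
Proof.
  intros Hr He. pose proof (Rabs_pos C0).
  destruct (pow_lt_1_zero r ltac:(rewrite Rabs_pos_eq; lra) (eps * (1 - r) / (Rabs C0 + 1))) as [N HN].
  { apply Rdiv_lt_0_compat; [apply Rmult_lt_0_compat|]; lra. }
  exists N. intros n Hn. specialize (HN n Hn).
  assert (Hp : 0 <= r ^ n) by (apply pow_le; lra). rewrite Rabs_pos_eq in HN by auto.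
  apply Rlt_div_r in HN; [|lra].
  apply Rle_trans with (Rabs C0 * (r ^ n / (1 - r))).
  - apply Rmult_le_compat_r; [apply Rdiv_le_0_compat; lra | apply RRle_abs].
  - replace (_ * _) with (Rabs C0 * r ^ n / (1 - r)) by (field; lra). apply Rle_div_l; nra.
Qed.

(** The explicit tail, in addition to the sum, later yields uniform approximation on half-planes. *)
Lemma geom_has_sum (u : nat -> C) (C0 r : R) : 0 <= r < 1 ->
  (forall n, Cmod (u n) <= C0 * r ^ n) ->
  exists s, has_sum u s /\ forall N, Cmod (s - csum u N)%C <= C0 * (r ^ N / (1 - r)).
Proof.
  intros Hr Hu.
  assert (HT : forall N L, NoDup L -> incl (seq 0 N) L -> Cmod (lsum u L - csum u N)%C <= C0 * (r ^ N / (1 - r))).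
  { intros N L HL Hi. rewrite csum_lsum.
    destruct (NoDup_incl_perm _ _ (seq_NoDup N 0) Hi) as [K HK].
    rewrite (lsum_perm _ _ _ HK), lsum_app.
    replace (_ - _)%C with (lsum u K) by ring.
    assert (HN : NoDup (seq 0 N ++ K)) by (eapply Permutation_NoDup; eauto).
    eapply Rle_trans; [apply lsum_Cmod|]. apply geom_tail_Cmod; auto.
    - apply NoDup_app_remove_l in HN. auto.
    - intros n Hn. destruct (Nat.lt_ge_cases n N) as [h|h]; auto. exfalso.
      clear - HN Hn h. assert (Hs : In n (seq 0 N)) by (apply in_seq; lia).
      apply in_split in Hs. destruct Hs as [l1 [l2 e]]. rewrite e, <- app_assoc in HN.
      apply NoDup_remove_2 in HN. apply HN. apply in_or_app; right. apply in_or_app. auto. }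
  destruct (C_cauchy_lim (csum u)) as [s Hs].
  { intros eps He. destruct (pow_small r C0 (eps / 2) Hr ltac:(lra)) as [N HN]. exists N.
    intros n m Hn Hm.
    assert (A : forall k, (N <= k)%nat -> Cmod (csum u k - csum u N)%C <= eps / 2).
    { intros k Hk. rewrite (csum_lsum u k). eapply Rle_trans; [|apply (HN N); lia]. apply HT.
      - apply seq_NoDup.
      - intros x Hx. apply in_seq in Hx. apply in_seq. lia. }
    replace (csum u n - csum u m)%C with ((csum u n - csum u N) - (csum u m - csum u N))%C by ring.
    eapply Rle_trans; [apply Cmod_sub_upper|]. pose proof (A n Hn). pose proof (A m Hm). lra. }
  assert (HB : forall N, Cmod (s - csum u N)%C <= C0 * (r ^ N / (1 - r))).
  { intros N. apply le_epsilon. intros eps He. destruct (Hs eps He) as [M HM].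
    specialize (HM (N + M)%nat ltac:(lia)).
    assert (A : Cmod (csum u (N + M) - csum u N)%C <= C0 * (r ^ N / (1 - r))).
    { rewrite (csum_lsum u (N + M)). apply HT; [apply seq_NoDup|].
      intros x Hx. apply in_seq in Hx. apply in_seq. lia. }
    replace (s - csum u N)%C with ((csum u (N + M) - csum u N) - (csum u (N + M) - s))%C by ring.
    eapply Rle_trans; [apply Cmod_sub_upper|]. lra. }
  exists s. split; auto.
  intros eps He. destruct (pow_small r C0 (eps / 2) Hr ltac:(lra)) as [N HN].
  exists (seq 0 N). intros L HL Hi.
  specialize (HT N L HL Hi). specialize (HB N). specialize (HN N (le_n _)).
  replace (lsum u L - s)%C with ((lsum u L - csum u N) - (s - csum u N))%C by ring.
  eapply Rle_trans; [apply Cmod_sub_upper|]. lra.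
Qed.

Lemma geom_is_series (u : nat -> C) (C0 r : R) (s : C) : 0 <= r < 1 ->
  (forall N, Cmod (s - csum u N)%C <= C0 * (r ^ N / (1 - r))) -> C_is_series u s.
Proof.
  intros Hr H. apply C_is_series_spec. intros eps He.
  destruct (pow_small r C0 eps Hr He) as [N HN]. exists N. intros n Hn.
  rewrite Cmod_sub_sym. eapply Rle_trans; [apply H | apply HN; auto].
Qed.

Lemma Im_lsum_RtoC {I} (f : I -> R) (L : list I) : Im (lsum (fun i => RtoC (f i)) L) = 0.
Proof. rewrite lsum_RtoC. reflexivity. Qed.

Lemma has_sum_real {I} (f : I -> R) (s : C) : has_sum (fun i => RtoC (f i)) s -> s = RtoC (Re s).
Proof.
  intros H. apply Ceq; [reflexivity|]. simpl.
  apply Rabs_eq_0. apply Rle_antisym; [|apply Rabs_pos]. apply le_epsilon. intros eps He.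
  destruct (has_sum_pick _ _ [] H eps He) as [L [h1 [_ h3]]]. specialize (h3 L h1 (incl_refl _)).
  pose proof (Im_le_Cmod (lsum (fun i => RtoC (f i)) L - s)%C) as K.
  assert (E : Im (lsum (fun i => RtoC (f i)) L - s)%C = - Im s).
  { pose proof (Im_lsum_RtoC f L) as E. unfold Im in *. simpl. rewrite E. ring. }
  rewrite E, Rabs_Ropp in K. lra.
Qed.

Lemma geom_abs_sum (u : nat -> C) (C0 r : R) : 0 <= r < 1 ->
  (forall n, Cmod (u n) <= C0 * r ^ n) ->
  exists S, abs_sum u (C_Series u) S.
Proof.
  intros Hr Hu. destruct (geom_has_sum u C0 r Hr Hu) as [s [Hs HB]].
  destruct (geom_has_sum (fun n => RtoC (Cmod (u n))) C0 r Hr) as [S [HS _]].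
  { intros n. rewrite Cmod_R, Rabs_pos_eq by apply Cmod_ge_0. auto. }
  exists (Re S). split.
  - rewrite (C_Series_eq u s); auto. eapply geom_is_series; eauto.
  - rewrite <- (has_sum_real _ _ HS). auto.
Qed.

(** The split at 0, with [-1] as first negative index, is that of [C_Series_Z]. *)
Definition Z_of_sum (x : nat + nat) : Z :=
  match x with inl n => Z.of_nat n | inr n => (- Z.of_nat (S n))%Z end.

Definition sum_of_Z (z : Z) : nat + nat :=
  if Z_le_gt_dec 0 z then inl (Z.to_nat z) else inr (Z.to_nat (- z - 1)).

Lemma Z_of_sum_of_Z (z : Z) : Z_of_sum (sum_of_Z z) = z.
Proof. unfold sum_of_Z. destruct (Z_le_gt_dec 0 z); unfold Z_of_sum; lia. Qed.

Lemma sum_of_Z_of_sum (x : nat + nat) : sum_of_Z (Z_of_sum x) = x.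
Proof. unfold sum_of_Z, Z_of_sum. destruct x, (Z_le_gt_dec _ _); try lia; f_equal; lia. Qed.

Lemma has_sum_Z (u : Z -> C) (s t : C) :
  has_sum (fun n => u (Z.of_nat n)) s -> has_sum (fun n => u (- Z.of_nat (S n))%Z) t ->
  has_sum u (s + t)%C.
Proof.
  intros Hs Ht.
  pose proof (has_sum_sum (fun x => u (Z_of_sum x)) s t Hs Ht) as H.
  apply (has_sum_reindex _ _ sum_of_Z Z_of_sum Z_of_sum_of_Z sum_of_Z_of_sum) in H.
  eapply has_sum_ext; [|apply H]. intros z. simpl. rewrite Z_of_sum_of_Z. reflexivity.
Qed.

Lemma Z_abs_sum (u : Z -> C) (C0 r : R) : 0 <= r < 1 ->
  (forall n, Cmod (u n) <= C0 * r ^ Z.abs_nat n) ->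
  exists S, abs_sum u (C_Series_Z u) S.
Proof.
  intros Hr Hu.
  assert (HC : 0 <= C0).
  { specialize (Hu 0%Z). pose proof (Cmod_ge_0 (u 0%Z)). simpl in Hu. lra. }
  destruct (geom_abs_sum (fun n => u (Z.of_nat n)) C0 r Hr) as [S1 [A1 B1]].
  { intros n. specialize (Hu (Z.of_nat n)). replace (Z.abs_nat (Z.of_nat n)) with n in Hu by lia. auto. }
  destruct (geom_abs_sum (fun n => u (- Z.of_nat (S n))%Z) C0 r Hr) as [S2 [A2 B2]].
  { intros n. specialize (Hu (- Z.of_nat (S n))%Z).
    replace (Z.abs_nat (- Z.of_nat (S n))) with (S n) in Hu by lia.
    eapply Rle_trans; [apply Hu|]. apply Rmult_le_compat_l; auto.
    simpl. pose proof (pow_le r n ltac:(lra)). nra. }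
  exists (S1 + S2). split.
  - apply has_sum_Z; auto.
  - rewrite RtoC_plus. apply has_sum_Z; auto.
Qed.

Lemma Z_lsumR_bound (u : Z -> C) (C0 r : R) (L : list Z) : 0 <= r < 1 ->
  (forall n, Cmod (u n) <= C0 * r ^ Z.abs_nat n) -> NoDup L ->
  lsumR (fun n => Cmod (u n)) L <= 2 * C0 / (1 - r).
Proof.
  intros Hr Hu HL.
  assert (HC : 0 <= C0).
  { specialize (Hu 0%Z). pose proof (Cmod_ge_0 (u 0%Z)). simpl in Hu. lra. }
  assert (HL' : NoDup (map sum_of_Z L)).
  { apply FinFun.Injective_map_NoDup; auto. intros x y e.
    rewrite <- (Z_of_sum_of_Z x), <- (Z_of_sum_of_Z y), e. reflexivity. }
  set (v := fun x => RtoC (Cmod (u (Z_of_sum x)))).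
  destruct (sum_list_split v _ HL') as [L1 [L2 [h1 [h2 [_ [_ h5]]]]]].
  assert (E : lsum v (map sum_of_Z L) = RtoC (lsumR (fun n => Cmod (u n)) L)).
  { rewrite lsum_map, <- lsum_RtoC. apply lsum_ext. intros z. unfold v. rewrite Z_of_sum_of_Z. reflexivity. }
  rewrite E in h5. unfold v in h5. rewrite !lsum_RtoC, <- RtoC_plus in h5. apply RtoC_inj in h5. rewrite h5.
  pose proof (geom_tail_Cmod (fun i => u (Z_of_sum (inl i))) C0 r 0 L1 Hr) as K1.
  pose proof (geom_tail_Cmod (fun i => u (Z_of_sum (inr i))) C0 r 0 L2 Hr) as K2.
  simpl pow in *.
  replace (2 * C0 / (1 - r)) with (C0 * (1 / (1 - r)) + C0 * (1 / (1 - r))) by (field; lra).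
  apply Rplus_le_compat; [apply K1 | apply K2]; auto; try (intros; lia).
  - intros n. specialize (Hu (Z.of_nat n)). replace (Z.abs_nat (Z.of_nat n)) with n in Hu by lia. auto.
  - intros n. simpl. specialize (Hu (- Z.of_nat (S n))%Z).
    replace (Z.abs_nat (- Z.of_nat (S n))) with (S n) in Hu by lia.
    eapply Rle_trans; [apply Hu|]. apply Rmult_le_compat_l; auto.
    simpl. pose proof (pow_le r n ltac:(lra)). nra.
Qed.

(** Completing the square: [C0] is the maximum of [exp (- s y^2 + (b + 1) y)]. *)
Lemma gauss_bound (s b : R) : 0 < s ->
  exists C0, 0 < C0 /\ forall x, exp (- s * x ^ 2 + b * Rabs x) <= C0 * exp (- Rabs x).
Proof.
  intros Hs. exists (exp ((b + 1) ^ 2 / (4 * s))). split; [apply exp_pos|].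
  intros x. rewrite <- exp_plus. apply exp_le_compat.
  rewrite <- (pow2_abs x). set (y := Rabs x).
  assert (0 <= (2 * s * y - (b + 1)) ^ 2) by apply pow2_ge_0.
  apply Rmult_le_reg_r with (4 * s); [lra|].
  replace (((b + 1) ^ 2 / (4 * s) + - y) * (4 * s)) with ((b + 1) ^ 2 - 4 * s * y) by (field; lra).
  nra.
Qed.

Lemma exp_opp_abs_pow (n : Z) : exp (- Rabs (IZR n)) = exp (- 1) ^ Z.abs_nat n.
Proof.
  rewrite <- abs_IZR, <- (Zabs2Nat.id_abs n), <- INR_IZR_INZ.
  induction (Z.abs_nat n).
  - simpl. rewrite Ropp_0. apply exp_0.
  - rewrite S_INR. simpl. rewrite <- IHn0, <- exp_plus. f_equal. ring.
Qed.

Lemma exp_opp_1_bounds : 0 <= exp (- 1) < 1.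
Proof. split; [left; apply exp_pos|]. rewrite <- exp_0. apply exp_increasing. lra. Qed.

(** * Theta constants and Landen's transformation *)

Definition gauss (tau : C) (x : R) : C := Cexp (Ci * PI * (x ^ 2)%R * tau)%C.

Lemma Cmod_gauss (tau : C) (x : R) : Cmod (gauss tau x) = exp (- (PI * Im tau) * x ^ 2).
Proof.
  unfold gauss. rewrite Cmod_Cexp. f_equal. destruct tau. simpl. ring.
Qed.

Lemma gauss_shift_bound (tau : C) (a : R) : 0 < Im tau -> exists C0, 0 < C0 /\
  forall n, Cmod (gauss tau (IZR n + a)) <= C0 * exp (- 1) ^ Z.abs_nat n.
Proof.
  intros Ht. pose proof PI_RGT_0. set (s := PI * Im tau). assert (Hs : 0 < s) by (unfold s; nra).
  destruct (gauss_bound s (2 * s * Rabs a) Hs) as [C0 [HC H0]].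
  exists C0. split; auto. intros n. rewrite <- exp_opp_abs_pow, Cmod_gauss.
  eapply Rle_trans; [|apply H0]. apply exp_le_compat. fold s.
  assert (- (IZR n * a) <= Rabs (IZR n) * Rabs a).
  { rewrite <- Rabs_mult, <- Rabs_Ropp. apply RRle_abs. }
  replace (- s * (IZR n + a) ^ 2) with (- s * IZR n ^ 2 + 2 * s * (- (IZR n * a)) - s * a ^ 2) by ring.
  nra.
Qed.

Lemma gauss_abs_sum (tau : C) (a : R) : 0 < Im tau -> exists S,
  abs_sum (fun n : Z => gauss tau (IZR n + a)) (C_Series_Z (fun n => gauss tau (IZR n + a))) S.
Proof.
  intros Ht. destruct (gauss_shift_bound tau a Ht) as [C0 [HC H]].
  eapply Z_abs_sum; [apply exp_opp_1_bounds | exact H].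
Qed.

Lemma C_Series_ext (u v : nat -> C) : (forall n, u n = v n) -> C_Series u = C_Series v.
Proof. intros H. unfold C_Series. f_equal; apply Series_ext; intros n; rewrite H; reflexivity. Qed.

Lemma C_Series_Z_ext (u v : Z -> C) : (forall n, u n = v n) -> C_Series_Z u = C_Series_Z v.
Proof. intros H. unfold C_Series_Z. f_equal; apply C_Series_ext; auto. Qed.

Lemma theta00_abs_sum (tau : C) : 0 < Im tau ->
  exists S, abs_sum (fun n : Z => gauss tau (IZR n)) (theta00 tau) S.
Proof.
  intros Ht. destruct (gauss_abs_sum tau 0 Ht) as [S [H1 H2]]. exists S. split.
  - replace (theta00 tau) with (C_Series_Z (fun n => gauss tau (IZR n + 0))).
    + eapply has_sum_ext; [|apply H1]. intros i; simpl. rewrite Rplus_0_r. reflexivity.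
    + apply C_Series_Z_ext. intros n. rewrite Rplus_0_r. reflexivity.
  - eapply has_sum_ext; [|apply H2]. intros i; simpl. rewrite Rplus_0_r. reflexivity.
Qed.

Lemma theta10_abs_sum (tau : C) : 0 < Im tau ->
  exists S, abs_sum (fun n : Z => gauss tau (IZR n + / 2)) (theta10 tau) S.
Proof. apply (gauss_abs_sum tau (/ 2)). Qed.

(** The parallelogram identity [(x + y)^2 + (x - y)^2 = 2 x^2 + 2 y^2] in the exponent. *)
Lemma gauss_landen (tau : C) (x y : R) :
  (gauss tau (x + y) * gauss tau (x - y) = gauss (2 * tau) x * gauss (2 * tau) y)%C.
Proof.
  unfold gauss. rewrite <- !Cexp_add. f_equal.
  replace ((x + y) ^ 2)%R with (x * x + 2 * (x * y) + y * y) by ring.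
  replace ((x - y) ^ 2)%R with (x * x - 2 * (x * y) + y * y) by ring.
  replace (x ^ 2)%R with (x * x) by ring. replace (y ^ 2)%R with (y * y) by ring.
  rewrite ?RtoC_plus, ?RtoC_minus, ?RtoC_plus. ring.
Qed.

(** The lattice change of Landen's transformation: [inl] covers the pairs of even sum, a sublattice
    of index two, and [inr] its other coset. *)
Definition diag (x : Z * Z + Z * Z) : Z * Z :=
  match x with inl (a, b) => (a + b, a - b)%Z | inr (a, b) => (a + b + 1, a - b)%Z end.

Definition undiag (p : Z * Z) : Z * Z + Z * Z :=
  let (m, n) := p in
  if Z.even (m + n) then inl ((m + n) / 2, (m - n) / 2)%Z
  else inr ((m + n) / 2, (m - n) / 2)%Z.

Lemma undiag_diag (x : Z * Z + Z * Z) : undiag (diag x) = x.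
Proof.
  destruct x as [[a b]|[a b]]; unfold diag, undiag.
  - replace (a + b + (a - b))%Z with (2 * a)%Z by ring. replace (a + b - (a - b))%Z with (2 * b)%Z by ring.
    rewrite Z.even_mul. simpl orb. cbv iota. rewrite !(Z.mul_comm 2), !Z.div_mul by lia. reflexivity.
  - replace (a + b + 1 + (a - b))%Z with (1 + a * 2)%Z by ring.
    replace (a + b + 1 - (a - b))%Z with (1 + b * 2)%Z by ring.
    rewrite Z.even_add, Z.even_mul, Bool.orb_true_r. simpl Bool.eqb. cbv iota.
    rewrite !Z.div_add by lia. reflexivity.
Qed.

Lemma diag_undiag (p : Z * Z) : diag (undiag p) = p.
Proof.
  destruct p as [m n]. unfold undiag.
  pose proof (Z.div_mod (m + n) 2 ltac:(lia)) as h1. pose proof (Z.div_mod (m - n) 2 ltac:(lia)) as h2.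
  rewrite Zmod_even in h1. rewrite Zmod_even in h2.
  assert (E : Z.even (m - n) = Z.even (m + n)).
  { replace (m - n)%Z with (m + n + (- n) * 2)%Z by ring. rewrite Z.even_add, Z.even_mul, Bool.orb_true_r.
    destruct (Z.even (m + n)); reflexivity. }
  rewrite E in h2. destruct (Z.even (m + n)); unfold diag; f_equal; lia.
Qed.

Lemma has_sum_diag (f : Z * Z -> C) (s t : C) :
  has_sum (fun p => f (fst p + snd p, fst p - snd p)%Z) s ->
  has_sum (fun p => f (fst p + snd p + 1, fst p - snd p)%Z) t ->
  has_sum f (s + t)%C.
Proof.
  intros Hs Ht.
  assert (H : has_sum (fun x => f (diag x)) (s + t)%C).
  { apply has_sum_sum.
    - eapply has_sum_ext; [|apply Hs]. intros [a b]; reflexivity.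
    - eapply has_sum_ext; [|apply Ht]. intros [a b]; reflexivity. }
  apply (has_sum_reindex _ _ undiag diag diag_undiag undiag_diag) in H.
  eapply has_sum_ext; [|apply H]. intros p. simpl. rewrite diag_undiag. reflexivity.
Qed.

Lemma Im_double (tau : C) : Im (2 * tau)%C = 2 * Im tau.
Proof. destruct tau; simpl; ring. Qed.

(** In the double series, pairs of even sum give the square of [theta00]. On pairs of odd sum the
    parallelogram identity is used at [a + 1/2] and [b + 1/2], which gives the square of
    [theta10]. *)
Lemma theta00_sqr (tau : C) : 0 < Im tau ->
  (theta00 tau * theta00 tau = theta00 (2 * tau) * theta00 (2 * tau) + theta10 (2 * tau) * theta10 (2 * tau))%C.
Proof.
  intros Ht. assert (Ht2 : 0 < Im (2 * tau)%C) by (rewrite Im_double; lra).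
  destruct (theta00_abs_sum tau Ht) as [S0 H0].
  destruct (theta00_abs_sum _ Ht2) as [S1 H1]. destruct (theta10_abs_sum _ Ht2) as [S2 H2].
  pose proof (has_sum_prod _ _ _ _ _ _ H0 H0) as P0.
  pose proof (has_sum_prod _ _ _ _ _ _ H1 H1) as P1.
  pose proof (has_sum_prod _ _ _ _ _ _ H2 H2) as P2.
  eapply has_sum_unique; [exact P0|]. apply has_sum_diag.
  - eapply has_sum_ext; [|exact P1]. intros [a b]; simpl.
    rewrite plus_IZR, minus_IZR, gauss_landen. reflexivity.
  - eapply has_sum_ext; [|exact P2]. intros [a b]; simpl.
    rewrite <- gauss_landen, !plus_IZR, minus_IZR. f_equal; f_equal; field.
Qed.

Lemma theta10_sqr (tau : C) : 0 < Im tau ->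
  (theta10 tau * theta10 tau = 2 * theta00 (2 * tau) * theta10 (2 * tau))%C.
Proof.
  intros Ht. assert (Ht2 : 0 < Im (2 * tau)%C) by (rewrite Im_double; lra).
  destruct (theta10_abs_sum tau Ht) as [S0 H0].
  destruct (theta00_abs_sum _ Ht2) as [S1 H1]. destruct (theta10_abs_sum _ Ht2) as [S2 H2].
  pose proof (has_sum_prod _ _ _ _ _ _ H0 H0) as P0.
  pose proof (has_sum_prod _ _ _ _ _ _ H2 H1) as P1.
  (* On pairs of odd sum the arguments are [a + b + 3/2] and [a - b + 1/2], so the parallelogram
     identity is used at [a + 1] and [b + 1/2]; hence a copy of [theta00] with its index shifted. *)
  assert (H1' : abs_sum (fun n : Z => gauss (2 * tau) (IZR (n + 1))) (theta00 (2 * tau)%C) S1).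
  { destruct H1 as [h1 h2]. split.
    - apply (has_sum_reindex _ _ (fun n => n + 1)%Z (fun n => n - 1)%Z) in h1; auto; intros; lia.
    - apply (has_sum_reindex _ _ (fun n => n + 1)%Z (fun n => n - 1)%Z) in h2; auto; intros; lia. }
  pose proof (has_sum_prod _ _ _ _ _ _ H1' H2) as P2.
  eapply has_sum_unique; [exact P0|].
  replace (2 * theta00 (2 * tau) * theta10 (2 * tau))%C with
    (theta10 (2 * tau) * theta00 (2 * tau) + theta00 (2 * tau) * theta10 (2 * tau))%C by ring.
  apply has_sum_diag.
  - eapply has_sum_ext; [|exact P1]. intros [a b]; simpl.
    rewrite <- gauss_landen, plus_IZR, minus_IZR. f_equal; f_equal; field.
  - eapply has_sum_ext; [|exact P2]. intros [a b]; simpl.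
    rewrite <- gauss_landen, !plus_IZR, minus_IZR. f_equal; f_equal; field.
Qed.

(** The multiplier of [theta10] under the unit shift: [(n + 1/2)^2 / 2] is 1/8 plus the integer
    [n (n + 1) / 2]. *)
Definition zeta8 : C := ce (/ 8).

Lemma zeta8_pow_4 : (zeta8 ^ 4 = - (1))%C.
Proof.
  unfold zeta8. rewrite ce_pow. replace (INR 4 * / 8) with (/ 2) by (simpl; field).
  unfold ce, Cexp. apply Ceq; simpl; replace (_ * 0 - _ * 1) with 0 by ring; rewrite exp_0;
  replace (_ + _) with PI by field; rewrite ?cos_PI, ?sin_PI; ring.
Qed.

Lemma gauss_add_1 (tau : C) (x : R) : gauss (tau + 1)%C x = (ce (x ^ 2 / 2) * gauss tau x)%C.
Proof.
  unfold gauss, ce. rewrite <- Cexp_add. f_equal. unfold Rdiv. rewrite RtoC_mult.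
  replace (RtoC (/ 2)) with (/ 2)%C by (rewrite RtoC_inv by lra; reflexivity).
  field.
Qed.

Lemma theta10_add_1 (tau : C) : 0 < Im tau -> theta10 (tau + 1)%C = (zeta8 * theta10 tau)%C.
Proof.
  intros Ht. assert (Ht2 : 0 < Im (tau + 1)%C) by (destruct tau; simpl in *; lra).
  destruct (theta10_abs_sum tau Ht) as [S0 [H0 _]]. destruct (theta10_abs_sum _ Ht2) as [S1 [H1 _]].
  eapply has_sum_unique; [exact H1|].
  eapply has_sum_ext; [|apply (has_sum_scal zeta8), H0].
  intros n. simpl. rewrite gauss_add_1. f_equal. unfold zeta8.
  destruct (Zeven_odd_dec (n * (n + 1))) as [h|h].
  - destruct (Zeven_ex _ h) as [m Hm].
    replace ((IZR n + / 2) ^ 2 / 2) with (IZR m + / 8).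
    + rewrite ce_add, ce_Z. ring.
    + assert (E : IZR n * (IZR n + 1) = 2 * IZR m) by (rewrite <- plus_IZR, <- !mult_IZR; f_equal; lia).
      simpl. lra.
  - exfalso. destruct (Zeven_odd_dec n) as [e|o].
    + apply (Zeven_not_Zodd (n * (n + 1))); auto. apply Zeven_mult_Zeven_l; auto.
    + apply (Zeven_not_Zodd (n * (n + 1))); auto. apply Zeven_mult_Zeven_r, Zodd_plus_Zodd; auto. exact I.
Qed.

(** Jacobi's [sum (-1)^n q^(n^2)], encoded as a translate so that results for [theta00] carry over
    by [qholy_shift]; the series is recovered in [theta01_series]. *)
Definition theta01 (tau : C) : C := theta00 (tau + 1)%C.

Lemma theta00_add_2 (tau : C) : 0 < Im tau -> theta00 (tau + 1 + 1)%C = theta00 tau.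
Proof.
  intros Ht. assert (Ht2 : 0 < Im (tau + 1 + 1)%C) by (destruct tau; simpl in *; lra).
  destruct (theta00_abs_sum tau Ht) as [S0 [H0 _]]. destruct (theta00_abs_sum _ Ht2) as [S1 [H1 _]].
  eapply has_sum_unique; [exact H1|]. eapply has_sum_ext; [|exact H0].
  intros n. rewrite !gauss_add_1, Cmult_assoc, <- ce_add.
  replace (IZR n ^ 2 / 2 + IZR n ^ 2 / 2) with (IZR (n * n)) by (rewrite mult_IZR; field).
  rewrite ce_Z. ring.
Qed.

Lemma theta01_sqr (tau : C) : 0 < Im tau ->
  (theta01 tau * theta01 tau = theta00 (2 * tau) * theta00 (2 * tau) - theta10 (2 * tau) * theta10 (2 * tau))%C.
Proof.
  intros Ht. unfold theta01.
  assert (Ht2 : 0 < Im (tau + 1)%C) by (destruct tau; simpl in *; lra).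
  assert (Ht3 : 0 < Im (2 * tau)%C) by (rewrite Im_double; lra).
  assert (Ht4 : 0 < Im (2 * tau + 1)%C) by (destruct tau; simpl in *; lra).
  rewrite theta00_sqr by auto.
  replace (2 * (tau + 1))%C with (2 * tau + 1 + 1)%C by ring.
  rewrite theta00_add_2, !theta10_add_1 by auto.
  pose proof zeta8_pow_4 as h. simpl in h.
  transitivity (theta00 (2 * tau) * theta00 (2 * tau) +
    (zeta8 * (zeta8 * (zeta8 * (zeta8 * 1)))) * (theta10 (2 * tau) * theta10 (2 * tau)))%C; [ring|].
  rewrite h. ring.
Qed.

(** With [A] and [B] the values of [theta00] and [theta10] at [2 tau], this is [(A^2 + B^2)^2 = (A^2
    - B^2)^2 + (2 A B)^2]. *)
Lemma theta_jacobi (tau : C) : 0 < Im tau -> (theta00 tau ^ 4 = theta01 tau ^ 4 + theta10 tau ^ 4)%C.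
Proof.
  intros Ht. pose proof (theta00_sqr tau Ht) as h0. pose proof (theta01_sqr tau Ht) as h1.
  pose proof (theta10_sqr tau Ht) as h2.
  replace (theta00 tau ^ 4)%C with ((theta00 tau * theta00 tau) * (theta00 tau * theta00 tau))%C by ring.
  replace (theta01 tau ^ 4)%C with ((theta01 tau * theta01 tau) * (theta01 tau * theta01 tau))%C by ring.
  replace (theta10 tau ^ 4)%C with ((theta10 tau * theta10 tau) * (theta10 tau * theta10 tau))%C by ring.
  rewrite h0, h1, h2. ring.
Qed.

(** The left side is [A^4 - B^4] in terms of the values at [2 tau], which Jacobi's identity there
    evaluates. Nonvanishing thus passes from [2 tau] to [tau]. *)
Lemma theta_landen (tau : C) : 0 < Im tau ->
  (theta00 tau ^ 2 * theta01 tau ^ 2 = theta01 (2 * tau) ^ 4)%C.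
Proof.
  intros Ht. pose proof (theta00_sqr tau Ht) as h0. pose proof (theta01_sqr tau Ht) as h1.
  assert (Ht2 : 0 < Im (2 * tau)%C) by (rewrite Im_double; lra).
  pose proof (theta_jacobi _ Ht2) as hj.
  replace (theta00 tau ^ 2)%C with (theta00 tau * theta00 tau)%C by ring.
  replace (theta01 tau ^ 2)%C with (theta01 tau * theta01 tau)%C by ring.
  rewrite h0, h1.
  replace (theta01 (2 * tau) ^ 4)%C with (theta01 (2 * tau) ^ 4 + theta10 (2 * tau) ^ 4 - theta10 (2 * tau) ^ 4)%C by ring.
  rewrite <- hj. ring.
Qed.

(** * Expansions of the theta constants in the nome *)

Lemma nome_pow (k : nat) (tau : C) : (nome tau ^ k)%C = Cexp (Ci * PI * INR k * tau)%C.
Proof. unfold nome. rewrite <- Cexp_nat_mul. f_equal. ring. Qed.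

Lemma Cmod_nome_pow_le (k : nat) (y : R) (tau : C) : y <= Im tau ->
  Cmod (nome tau ^ k)%C <= exp (- (PI * y * INR k)).
Proof.
  intros H. rewrite nome_pow, Cmod_Cexp. apply exp_le_compat.
  replace (Re _) with (- (PI * Im tau * INR k)) by (destruct tau; simpl; ring).
  pose proof PI_RGT_0. pose proof (pos_INR k).
  assert (PI * y * INR k <= PI * Im tau * INR k) by (apply Rmult_le_compat_r; nra). lra.
Qed.

Lemma qholy_csum (y : R) (f : nat -> C -> C) (c : nat -> C) (n : nat) :
  (forall i, qholy y (f i) (c i)) -> qholy y (fun t => csum (fun i => f i t) n) (csum c n).
Proof.
  intros H. induction n; simpl; [apply qholy_const|]. apply qholy_plus; auto.
Qed.

(** One statement for theta series and for power series. By the convention [0 ^ 0 = 1] the value at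
    the cusp is [c 0] if [e 0 = 0], and 0 otherwise. *)
Lemma qhol_lacunary (c : nat -> C) (e : nat -> nat) (F : C -> C) :
  (forall n, (0 < e (S n))%nat) ->
  (forall y, 0 < y -> exists C0 r, 0 <= r < 1 /\
     forall n, Cmod (c n) * exp (- (PI * y * INR (e n))) <= C0 * r ^ n) ->
  (forall tau, 0 < Im tau -> C_is_series (fun n => c n * nome tau ^ e n)%C (F tau)) ->
  qhol F (c O * 0 ^ e O)%C.
Proof.
  intros He Hc HF y Hy. destruct (Hc y Hy) as [C0 [r [Hr HB]]].
  apply qholy_limit. intros eps Heps.
  destruct (pow_small r C0 eps Hr Heps) as [N HN].
  exists (fun t => csum (fun n => c n * nome t ^ e n)%C (S N)). split.
  - replace (c O * 0 ^ e O)%C with (csum (fun n => c n * 0 ^ e n)%C (S N)).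
    + apply (qholy_csum y (fun n t => c n * nome t ^ e n)%C (fun n => c n * 0 ^ e n)%C). intros i.
      apply (qholy_mult y (fun _ => c i)); auto; [apply qholy_const|].
      apply qholy_pow; auto. apply qholy_nome.
    + rewrite csum_shift, csum_zero; [ring|]. intros i _. specialize (He i).
      destruct (e (S i)); [lia|]. simpl. ring.
  - intros tau Ht.
    assert (Hb : forall n, Cmod (c n * nome tau ^ e n)%C <= C0 * r ^ n).
    { intros n. rewrite Cmod_mult. eapply Rle_trans; [|apply HB].
      apply Rmult_le_compat_l; [apply Cmod_ge_0 | apply Cmod_nome_pow_le; auto]. }
    destruct (geom_has_sum _ C0 r Hr Hb) as [s [_ Hs]].
    pose proof (geom_is_series _ C0 r s Hr Hs) as Hs'.
    rewrite (C_is_series_unique _ _ _ (HF tau ltac:(lra)) Hs').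
    eapply Rle_trans; [apply Hs | apply HN; lia].
Qed.

Lemma nome_pow_series (e : nat -> nat) (tau : C) : (forall n, (n <= e n)%nat) -> 0 < Im tau ->
  C_is_series (fun n => 1 * nome tau ^ e n)%C (C_Series (fun n => nome tau ^ e n)%C).
Proof.
  intros He Ht. pose proof PI_RGT_0 as Hpi.
  assert (Hr : 0 <= exp (- (PI * Im tau)) < 1).
  { split; [left; apply exp_pos|]. rewrite <- exp_0. apply exp_increasing. nra. }
  destruct (geom_has_sum (fun n => 1 * nome tau ^ e n)%C 1 (exp (- (PI * Im tau))) Hr) as [s [_ Hs]].
  - intros n. rewrite Cmult_1_l, Cmod_pow, Cmod_nome, Rmult_1_l.
    replace (e n) with (n + (e n - n))%nat by (specialize (He n); lia).
    rewrite pow_add. rewrite <- (Rmult_1_r (exp _ ^ n)) at 2. apply Rmult_le_compat_l.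
    + apply pow_le; lra.
    + rewrite <- (pow1 (e n - n)). apply pow_incr. lra.
  - pose proof (geom_is_series _ 1 _ s Hr Hs) as Hs'.
    rewrite (C_Series_ext _ (fun n => 1 * nome tau ^ e n)%C) by (intros; ring).
    rewrite (C_Series_eq _ s); auto.
Qed.

Lemma qhol_nome_pow_series (e : nat -> nat) : (forall n, (n <= e n)%nat) ->
  qhol (fun t => C_Series (fun n => nome t ^ e n)%C) (0 ^ e O)%C.
Proof.
  intros He. replace (0 ^ e O)%C with (1 * 0 ^ e O)%C by ring.
  apply (qhol_lacunary (fun _ => RtoC 1) e).
  - intros n. specialize (He (S n)). lia.
  - intros y Hy. pose proof PI_RGT_0.
    exists 1, (exp (- (PI * y))). split.
    + split; [left; apply exp_pos|]. rewrite <- exp_0. apply exp_increasing. nra.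
    + intros n. rewrite Cmod_1, !Rmult_1_l.
      assert (E : exp (- (PI * y)) ^ n = exp (- (PI * y * INR n))).
      { induction n; [simpl; rewrite Rmult_0_r, Ropp_0, exp_0; reflexivity|].
        rewrite S_INR. simpl. rewrite IHn, <- exp_plus. f_equal. ring. }
      rewrite E. apply exp_le_compat. pose proof (le_INR _ _ (He n)).
      assert (PI * y * INR n <= PI * y * INR (e n)) by (apply Rmult_le_compat_l; nra). lra.
  - intros tau Ht. apply nome_pow_series; auto.
Qed.

Lemma theta00_qhol : qhol theta00 1.
Proof.
  apply (qhol_ext (fun t => C_Series (fun n => nome t ^ (n * n)) + C_Series (fun n => nome t ^ (S n * S n)))%C).
  - intros tau _. unfold theta00, C_Series_Z. f_equal; apply C_Series_ext; intros n; rewrite nome_pow; f_equal.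
    + rewrite <- INR_IZR_INZ, mult_INR. simpl. rewrite Rmult_1_r, RtoC_mult. ring.
    + rewrite opp_IZR, <- INR_IZR_INZ, mult_INR. replace ((- INR (S n)) ^ 2)%R with (INR (S n) * INR (S n)) by ring. ring.
  - replace (RtoC 1) with (0 ^ (0 * 0) + 0 ^ (1 * 1))%C by (simpl; ring).
    apply qhol_plus.
    + apply (qhol_nome_pow_series (fun n => n * n)%nat). intros n. nia.
    + apply (qhol_nome_pow_series (fun n => S n * S n)%nat). intros n. nia.
Qed.

(** This is [theta10] without its factor [2 q^(1/4)], which is no power of the nome. The terms [n]
    and [- n - 1] of the theta series coincide, whence the 2 and the summation over natural
    numbers. *)
Definition Psi (tau : C) : C := C_Series (fun n => nome tau ^ (n * n + n))%C.

Lemma Psi_qhol : qhol Psi 1.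
Proof.
  replace (RtoC 1) with (0 ^ (0 * 0 + 0))%C by reflexivity.
  apply (qhol_nome_pow_series (fun n => n * n + n)%nat). intros; nia.
Qed.

Lemma C_Series_scal (c : C) (u : nat -> C) (s : C) :
  C_is_series u s -> C_Series (fun n => c * u n)%C = (c * s)%C.
Proof.
  intros H. apply C_Series_eq. apply C_is_series_spec. intros eps He.
  pose proof (Cmod_ge_0 c).
  destruct (proj1 (C_is_series_spec _ _) H (eps / (Cmod c + 1))) as [N HN].
  { apply Rdiv_lt_0_compat; lra. }
  exists N. intros n Hn. specialize (HN n Hn). rewrite csum_scal.
  replace (_ - _)%C with (c * (csum u n - s))%C by ring. rewrite Cmod_mult.
  apply Rle_div_r in HN; [|lra]. nra.
Qed.

Lemma theta10_Psi (tau : C) : 0 < Im tau ->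
  theta10 tau = (2 * Cexp (Ci * PI * (/ 4)%R * tau) * Psi tau)%C.
Proof.
  intros Ht.
  assert (HP : C_is_series (fun n => nome tau ^ (n * n + n))%C (Psi tau)).
  { assert (H : C_is_series (fun n => 1 * nome tau ^ (n * n + n))%C (Psi tau)).
    { apply (nome_pow_series (fun n => n * n + n)%nat tau); auto. intros; nia. }
    apply C_is_series_spec. intros eps He. destruct (proj1 (C_is_series_spec _ _) H eps He) as [N HN].
    exists N. intros n Hn. rewrite (csum_ext _ (fun n => 1 * nome tau ^ (n * n + n))%C); [apply HN; auto|].
    intros; ring. }
  unfold theta10, C_Series_Z.
  rewrite (C_Series_ext _ (fun n => Cexp (Ci * PI * (/ 4)%R * tau) * nome tau ^ (n * n + n))%C).
  rewrite (C_Series_ext (fun n => Cexp (Ci * PI * ((IZR (- Z.of_nat (S n)) + / 2) ^ 2)%R * tau)%C)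
    (fun n => Cexp (Ci * PI * (/ 4)%R * tau) * nome tau ^ (n * n + n))%C).
  - rewrite !(C_Series_scal _ _ _ HP). ring.
  - intros n. rewrite nome_pow, <- Cexp_add. f_equal.
    rewrite opp_IZR, <- INR_IZR_INZ, S_INR, plus_INR, mult_INR.
    replace ((- (INR n + 1) + / 2) ^ 2)%R with (/ 4 + (INR n * INR n + INR n)) by field.
    rewrite RtoC_plus. ring.
  - intros n. rewrite nome_pow, <- Cexp_add. f_equal.
    rewrite <- INR_IZR_INZ, plus_INR, mult_INR.
    replace ((INR n + / 2) ^ 2)%R with (/ 4 + (INR n * INR n + INR n)) by field.
    rewrite RtoC_plus. ring.
Qed.

(** The factor [q^(1/4)] at [2 tau] is the square of the one at [tau], so it cancels from the
    duplication formula [theta10_sqr]. *)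
Lemma Psi_sqr (tau : C) : 0 < Im tau -> (Psi tau * Psi tau = theta00 (2 * tau) * Psi (2 * tau))%C.
Proof.
  intros Ht. assert (Ht2 : 0 < Im (2 * tau)%C) by (rewrite Im_double; lra).
  pose proof (theta10_sqr tau Ht) as h. rewrite (theta10_Psi tau Ht), (theta10_Psi _ Ht2) in h.
  set (w := Cexp (Ci * PI * (/ 4)%R * tau)) in *.
  assert (E : Cexp (Ci * PI * (/ 4)%R * (2 * tau)) = (w * w)%C).
  { unfold w. rewrite <- Cexp_add. f_equal. ring. }
  rewrite E in h. assert (Hw : w <> 0) by apply Cexp_neq_0.
  transitivity ((2 * w * Psi tau * (2 * w * Psi tau)) / (4 * (w * w)))%C.
  - field; repeat split; auto; intros e; apply RtoC_inj in e; lra.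
  - rewrite h. field; repeat split; auto; intros e; apply RtoC_inj in e; lra.
Qed.

(** * The modular lambda function *)

(* Since [F t] is near 1 high in the half-plane, a relation expressing [1 / F t]
   through [F] and [1 / F (2 t)] propagates invertibility downwards. *)
Lemma qhol_recip_descent (F : C -> C) : qhol F 1 ->
  (forall y, 0 < y ->
     (forall tau, 2 * y <= Im tau -> F tau <> 0) -> qholy (2 * y) (fun t => / F t)%C 1 ->
     (forall tau, y <= Im tau -> F tau <> 0) /\ qholy y (fun t => / F t)%C 1) ->
  (forall tau, 0 < Im tau -> F tau <> 0) /\ qhol (fun t => / F t)%C 1.
Proof.
  intros HF Hstep.
  destruct (qholy_lim 1 F 1 (HF 1 ltac:(lra)) (/ 2) ltac:(lra)) as [Y [HY HB]].
  (* [m] doublings lead from height [y] to the region above [Y], where [F] is within 1/2 of 1 and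
     the Neumann series applies. *)
  assert (K : forall m y, 0 < y -> Y <= 2 ^ m * y ->
     (forall tau, y <= Im tau -> F tau <> 0) /\ qholy y (fun t => / F t)%C 1).
  { induction m; intros y Hy Hm.
    - simpl in Hm. split.
      + intros tau Ht. apply near_1_neq_0, HB. lra.
      + apply qholy_recip; auto. intros tau Ht. apply HB. lra.
    - simpl in Hm. destruct (IHm (2 * y) ltac:(lra)) as [A B]; [lra|]. apply Hstep; auto. }
  assert (K' : forall y, 0 < y -> (forall tau, y <= Im tau -> F tau <> 0) /\ qholy y (fun t => / F t)%C 1).
  { intros y Hy. destruct (Pow_x_infinity 2 ltac:(rewrite Rabs_pos_eq; lra) (Y / y)) as [m Hm].
    apply (K m); auto. specialize (Hm m (le_n _)). rewrite Rabs_pos_eq in Hm by (apply pow_le; lra).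
    apply Rge_le in Hm. apply Rle_div_l in Hm; auto. }
  split.
  - intros tau Ht. apply (proj1 (K' (Im tau) Ht)). lra.
  - intros y Hy. apply K'; auto.
Qed.

Lemma Im_add_1 (tau : C) : Im (tau + 1)%C = Im tau.
Proof. destruct tau; simpl; ring. Qed.

Lemma Cinv_neq_0 (z : C) : z <> 0 -> (/ z)%C <> 0.
Proof.
  intros h e. apply C1_nz. rewrite <- (Cinv_r z h), e. ring.
Qed.

Lemma qholy_eq (y : R) (F G : C -> C) (c d : C) :
  qholy y F c -> (forall tau, y <= Im tau -> F tau = G tau) -> c = d -> qholy y G d.
Proof. intros H E <-. eapply qholy_ext; eauto. Qed.

(** By [theta_landen], [1 / theta00] is [theta00 theta01^2] divided by the fourth power of [theta01]
    at [2 tau], that is, of [theta00] at [2 tau + 1], a point of twice the height. *)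
Lemma theta00_recip :
  (forall tau, 0 < Im tau -> theta00 tau <> 0) /\ qhol (fun t => / theta00 t)%C 1.
Proof.
  apply qhol_recip_descent; [apply theta00_qhol|].
  intros y Hy Hne Hq.
  assert (Hn2 : forall tau, y <= Im tau -> theta01 (2 * tau)%C <> 0).
  { intros tau Ht. apply Hne. rewrite Im_add_1, Im_double. lra. }
  assert (Hn : forall tau, y <= Im tau -> theta00 tau <> 0).
  { intros tau Ht e. apply (Cpow_nz _ 4 (Hn2 tau Ht)). rewrite <- theta_landen by lra.
    rewrite e. simpl. ring. }
  split; auto.
  assert (Q1 : qholy y (fun t => / theta01 (2 * t))%C 1).
  { apply (qholy_double y (fun t => / theta01 t)%C). apply (qholy_shift (2 * y) (fun t => / theta00 t)%C). exact Hq. }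
  pose proof (qholy_mult y _ _ _ _ Hy (theta00_qhol y Hy)
    (qholy_mult y _ _ _ _ Hy (qholy_pow y _ _ 2 Hy (qholy_shift y _ _ (theta00_qhol y Hy)))
       (qholy_pow y _ _ 4 Hy Q1))) as Q.
  eapply qholy_eq; [exact Q | |].
  - intros tau Ht. simpl. fold (theta01 tau). pose proof (Hn2 tau Ht) as H2. pose proof (theta_landen tau ltac:(lra)) as E.
    assert (H1 : theta01 tau <> 0).
    { intros e. apply (Cpow_nz _ 4 H2). rewrite <- E, e. simpl. ring. }
    transitivity (theta00 tau * theta01 tau ^ 2 / theta01 (2 * tau) ^ 4)%C.
    + field. auto.
    + rewrite <- E. field. auto.
  - rewrite !Cpow_1_l. ring.
Qed.

Lemma theta00_neq_0 (tau : C) : 0 < Im tau -> theta00 tau <> 0.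
Proof. apply (proj1 theta00_recip). Qed.

Lemma theta01_neq_0 (tau : C) : 0 < Im tau -> theta01 tau <> 0.
Proof. intros H. apply theta00_neq_0. rewrite Im_add_1. auto. Qed.

(** By [Psi_sqr], [1 / Psi] is [Psi] divided by the product of [theta00] and [Psi] at [2 tau], where
    [theta00] is already invertible. *)
Lemma Psi_recip : (forall tau, 0 < Im tau -> Psi tau <> 0) /\ qhol (fun t => / Psi t)%C 1.
Proof.
  apply qhol_recip_descent; [apply Psi_qhol|].
  intros y Hy Hne Hq.
  assert (Hn2 : forall tau, y <= Im tau -> Psi (2 * tau)%C <> 0).
  { intros tau Ht. apply Hne. rewrite Im_double. lra. }
  assert (Hn0 : forall tau, y <= Im tau -> theta00 (2 * tau)%C <> 0).
  { intros tau Ht. apply theta00_neq_0. rewrite Im_double. lra. }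
  assert (Hn : forall tau, y <= Im tau -> Psi tau <> 0).
  { intros tau Ht e. apply (Cmult_neq_0 _ _ (Hn0 tau Ht) (Hn2 tau Ht)). rewrite <- Psi_sqr by lra.
    rewrite e. ring. }
  split; auto.
  pose proof (qholy_mult y _ _ _ _ Hy (Psi_qhol y Hy)
    (qholy_mult y _ _ _ _ Hy (qhol_double _ _ (proj2 theta00_recip) y Hy)
       (qholy_double y _ _ Hq))) as Q.
  eapply qholy_eq; [exact Q | |].
  - intros tau Ht. simpl. transitivity (Psi tau / (theta00 (2 * tau) * Psi (2 * tau)))%C.
    + field. auto.
    + rewrite <- Psi_sqr by lra. field. auto.
  - ring.
Qed.

Lemma Psi_neq_0 (tau : C) : 0 < Im tau -> Psi tau <> 0.
Proof. apply (proj1 Psi_recip). Qed.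

Lemma lambda_Psi (tau : C) : 0 < Im tau ->
  modular_lambda tau = (16 * nome tau * Psi tau ^ 4 / theta00 tau ^ 4)%C.
Proof.
  intros Ht. unfold modular_lambda. f_equal. rewrite theta10_Psi by auto.
  replace (nome tau) with (Cexp (Ci * PI * (/ 4)%R * tau) ^ 4)%C; [ring|].
  rewrite <- Cexp_nat_mul. unfold nome. f_equal. simpl INR.
  replace (1 + 1 + 1 + 1) with 4 by ring.
  replace (4 * (Ci * PI * (/ 4)%R * tau))%C with ((4 * / 4)%R * (Ci * PI * tau))%C by (rewrite RtoC_mult; ring).
  replace (4 * / 4)%R with 1 by field. ring.
Qed.

Lemma lambda_neq_0 (tau : C) : 0 < Im tau -> modular_lambda tau <> 0.
Proof.
  intros Ht. rewrite lambda_Psi by auto. unfold Cdiv.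
  apply Cmult_neq_0; [apply Cmult_neq_0; [apply Cmult_neq_0|]|].
  - intros e; apply RtoC_inj in e; lra.
  - apply nome_neq_0.
  - apply Cpow_nz, Psi_neq_0; auto.
  - apply Cinv_neq_0, Cpow_nz, theta00_neq_0; auto.
Qed.

Lemma one_minus_lambda (tau : C) : 0 < Im tau ->
  (1 - modular_lambda tau = theta01 tau ^ 4 / theta00 tau ^ 4)%C.
Proof.
  intros Ht. unfold modular_lambda. pose proof (theta00_neq_0 tau Ht) as h.
  pose proof (theta_jacobi tau Ht) as hj.
  replace (theta01 tau ^ 4)%C with (theta00 tau ^ 4 - theta10 tau ^ 4)%C by (rewrite hj; ring).
  field. auto.
Qed.

Lemma lambda_qhol : qhol modular_lambda 0.
Proof.
  intros y Hy.
  pose proof (qholy_mult y _ _ _ _ Hy (qholy_mult y _ _ _ _ Hy (qholy_const y 16) (qholy_nome y))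
    (qholy_mult y _ _ _ _ Hy (qholy_pow y _ _ 4 Hy (Psi_qhol y Hy)) (qholy_pow y _ _ 4 Hy (proj2 theta00_recip y Hy)))) as Q.
  eapply qholy_eq; [exact Q | |].
  - intros tau Ht. simpl. rewrite lambda_Psi by lra.
    pose proof (theta00_neq_0 tau ltac:(lra)). field. auto.
  - ring.
Qed.

(** Lambda has a simple zero at the cusp, with leading coefficient 16, so division by lambda reduces
    to division by the nome. *)
Lemma nome_div_lambda_qhol : qhol (fun t => nome t / modular_lambda t)%C (/ 16)%C.
Proof.
  intros y Hy.
  pose proof (qholy_mult y _ _ _ _ Hy (qholy_const y (/ 16)%C)
    (qholy_mult y _ _ _ _ Hy (qholy_pow y _ _ 4 Hy (theta00_qhol y Hy)) (qholy_pow y _ _ 4 Hy (proj2 Psi_recip y Hy)))) as Q.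
  eapply qholy_eq; [exact Q | |].
  - intros tau Ht. simpl. rewrite lambda_Psi by lra.
    pose proof (theta00_neq_0 tau ltac:(lra)). pose proof (Psi_neq_0 tau ltac:(lra)).
    pose proof (nome_neq_0 tau). field. repeat split; auto; intros e; apply RtoC_inj in e; lra.
  - rewrite !Cpow_1_l. ring.
Qed.

Lemma recip_one_minus_lambda_qhol : qhol (fun t => / (1 - modular_lambda t))%C 1.
Proof.
  intros y Hy.
  pose proof (qholy_mult y _ _ _ _ Hy (qholy_pow y _ _ 4 Hy (theta00_qhol y Hy))
     (qholy_pow y _ _ 4 Hy (qholy_shift y _ _ (proj2 theta00_recip y Hy)))) as Q.
  eapply qholy_eq; [exact Q | |].
  - intros tau Ht. simpl. fold (theta01 tau). rewrite one_minus_lambda by lra.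
    pose proof (theta00_neq_0 tau ltac:(lra)). pose proof (theta01_neq_0 tau ltac:(lra)).
    field. auto.
  - rewrite !Cpow_1_l. ring.
Qed.

Lemma qhol_div_lambda (F : C -> C) (c : C) : qhol F c ->
  exists d, qhol (fun t => (F t - c) / modular_lambda t)%C d.
Proof.
  intros HF. destruct (qhol_div_nome F c HF) as [d Hd].
  exists (d * / 16)%C. eapply qhol_ext; [|apply (qhol_mult _ _ _ _ Hd nome_div_lambda_qhol)].
  intros tau Ht. simpl. pose proof (nome_neq_0 tau). pose proof (lambda_neq_0 tau Ht). field. auto.
Qed.

Lemma lambda_add_1 (tau : C) : 0 < Im tau ->
  modular_lambda (tau + 1)%C = (- (modular_lambda tau / (1 - modular_lambda tau)))%C.
Proof.
  intros Ht. rewrite one_minus_lambda by auto. unfold modular_lambda.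
  rewrite theta10_add_1 by auto. fold (theta01 tau).
  pose proof (theta00_neq_0 tau Ht). pose proof (theta01_neq_0 tau Ht).
  rewrite Cpow_mult_l, zeta8_pow_4. field. auto.
Qed.

(** * The inversion of the theta constants *)

(** The range [-L <= m < L] is a complete set of residues modulo [2 L], as finite Fourier inversion
    requires. *)
Definition zsum (f : Z -> C) (L : nat) : C :=
  (csum (fun n => f (Z.of_nat n)) L + csum (fun n => f (- Z.of_nat (S n))%Z) L)%C.

Lemma zsum_S (f : Z -> C) (L : nat) :
  zsum f (S L) = (zsum f L + f (Z.of_nat L) + f (- Z.of_nat (S L))%Z)%C.
Proof. unfold zsum. cbn [csum]. ring. Qed.

Lemma zsum_csum (f : Z -> C) (L : nat) :
  zsum f L = csum (fun i => f (Z.of_nat i - Z.of_nat L)%Z) (2 * L).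
Proof.
  induction L; [unfold zsum; simpl; ring|].
  rewrite zsum_S, IHL. replace (2 * S L)%nat with (S (S (2 * L))) by lia.
  rewrite csum_shift. cbn [csum].
  replace (Z.of_nat (S (2 * L)) - Z.of_nat (S L))%Z with (Z.of_nat L) by lia.
  replace (Z.of_nat 0 - Z.of_nat (S L))%Z with (- Z.of_nat (S L))%Z by lia.
  rewrite (csum_ext (fun i => f (Z.of_nat (S i) - Z.of_nat (S L))%Z) (fun i => f (Z.of_nat i - Z.of_nat L)%Z)).
  - ring.
  - intros; f_equal; lia.
Qed.

Lemma zsum_ext (f g : Z -> C) (L : nat) : (forall m, f m = g m) -> zsum f L = zsum g L.
Proof. intros H. unfold zsum. f_equal; apply csum_ext; auto. Qed.

Lemma zsum_scal (c : C) (f : Z -> C) (L : nat) : zsum (fun m => c * f m)%C L = (c * zsum f L)%C.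
Proof. unfold zsum. rewrite !csum_scal. ring. Qed.

(** Comparison with the telescoping differences of [1 / (x - 1)]. The decay is assumed only up to
    [M + K] because a discrete Fourier coefficient, being periodic in its frequency, decays only
    over half a period. *)
Lemma zsum_tail (f : Z -> C) (B : R) (M K : nat) : (2 <= M)%nat ->
  (forall m, (Z.abs m <= Z.of_nat (M + K))%Z -> Cmod (f m) * IZR m ^ 2 <= B) ->
  Cmod (zsum f (M + K) - zsum f M)%C <= 2 * B / (INR M - 1).
Proof.
  intros HM HB.
  assert (HB0 : 0 <= B).
  { specialize (HB 0%Z ltac:(lia)). simpl in HB. lra. }
  assert (hM : 2 <= INR M) by (apply (le_INR 2); auto).
  assert (H : Cmod (zsum f (M + K) - zsum f M)%C <= 2 * B * (/ (INR M - 1) - / (INR (M + K) - 1))).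
  { induction K.
    - rewrite Nat.add_0_r. replace (zsum f M - zsum f M)%C with (0 : C) by ring. rewrite Cmod_0. lra.
    - replace (M + S K)%nat with (S (M + K)) in * by lia. rewrite zsum_S.
      specialize (IHK ltac:(intros m Hm; apply HB; lia)).
      assert (h : 2 <= INR (M + K)) by (rewrite plus_INR; pose proof (pos_INR K); lra).
      pose proof (HB (Z.of_nat (M + K)) ltac:(lia)) as h1.
      pose proof (HB (- Z.of_nat (S (M + K)))%Z ltac:(lia)) as h2.
      rewrite opp_IZR in h2. rewrite <- INR_IZR_INZ in h1, h2. rewrite S_INR in *.
      set (x := INR (M + K)) in *.
      replace (zsum f (M + K) + f (Z.of_nat (M + K)) + f (- Z.of_nat (S (M + K)))%Z - zsum f M)%C
        with ((zsum f (M + K) - zsum f M) + f (Z.of_nat (M + K)) + f (- Z.of_nat (S (M + K)))%Z)%C by ring.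
      eapply Rle_trans; [apply Cmod_triangle|].
      pose proof (Cmod_triangle (zsum f (M + K) - zsum f M)%C (f (Z.of_nat (M + K)))).
      set (u := Cmod (f (Z.of_nat (M + K)))) in *. set (v := Cmod (f (- Z.of_nat (S (M + K)))%Z)) in *.
      assert (hv : 0 <= v) by apply Cmod_ge_0.
      assert (E : / (x - 1) - / (x + 1 - 1) = / (x * (x - 1))) by (field; lra).
      assert (hu' : u <= B * / (x * (x - 1))).
      { apply Rle_div_r; nra. }
      assert (hv' : v <= B * / (x * (x - 1))).
      { apply Rle_div_r; nra. }
      nra. }
  eapply Rle_trans; [apply H|]. unfold Rdiv. apply Rmult_le_compat_l; [lra|].
  assert (0 < / (INR (M + K) - 1)).
  { apply Rinv_0_lt_compat. rewrite plus_INR. pose proof (pos_INR K). lra. }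
  lra.
Qed.

Lemma Z_series_lim (u : Z -> C) (C0 r : R) : 0 <= r < 1 ->
  (forall n, Cmod (u n) <= C0 * r ^ Z.abs_nat n) ->
  forall eps, 0 < eps -> exists M0, forall M, (M0 <= M)%nat -> Cmod (C_Series_Z u - zsum u M)%C <= eps.
Proof.
  intros Hr Hu eps He.
  assert (HC : 0 <= C0).
  { specialize (Hu 0%Z). pose proof (Cmod_ge_0 (u 0%Z)). simpl in Hu. lra. }
  assert (K : forall v : nat -> C, (forall n, Cmod (v n) <= C0 * r ^ n) ->
    forall N, Cmod (C_Series v - csum v N)%C <= C0 * (r ^ N / (1 - r))).
  { intros v Hv N. destruct (geom_has_sum v C0 r Hr Hv) as [s [_ Hs]].
    rewrite (C_Series_eq v s); auto. eapply geom_is_series; eauto. }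
  destruct (pow_small r C0 (eps / 2) Hr ltac:(lra)) as [M0 HM0].
  exists M0. intros M HM. specialize (HM0 M HM).
  pose proof (K (fun n => u (Z.of_nat n))) as K1. pose proof (K (fun n => u (- Z.of_nat (S n))%Z)) as K2.
  unfold C_Series_Z, zsum.
  replace (_ - _)%C
      with ((C_Series (fun n => u (Z.of_nat n)) - csum (fun n => u (Z.of_nat n)) M) +
        (C_Series (fun n => u (- Z.of_nat (S n))%Z) - csum (fun n => u (- Z.of_nat (S n))%Z) M))%C by ring.
  eapply Rle_trans; [apply Cmod_triangle|].
  assert (Cmod (C_Series (fun n => u (Z.of_nat n)) - csum (fun n => u (Z.of_nat n)) M)%C <= eps / 2).
  { eapply Rle_trans; [apply K1 | exact HM0]. intros n. specialize (Hu (Z.of_nat n)).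
    replace (Z.abs_nat (Z.of_nat n)) with n in Hu by lia. auto. }
  assert (Cmod (C_Series (fun n => u (- Z.of_nat (S n))%Z) - csum (fun n => u (- Z.of_nat (S n))%Z) M)%C <= eps / 2).
  { eapply Rle_trans; [apply K2 | exact HM0]. intros n. specialize (Hu (- Z.of_nat (S n))%Z).
    replace (Z.abs_nat (- Z.of_nat (S n))) with (S n) in Hu by lia.
    eapply Rle_trans; [apply Hu|]. apply Rmult_le_compat_l; auto.
    simpl. pose proof (pow_le r n ltac:(lra)). nra. }
  lra.
Qed.

(* The terms of [sum_n exp (i pi s (z + n)^2 - 2 pi i m z)], whose sum over [n]
   is 1-periodic in [z]. *)
Definition gterm (s : C) (m n : Z) (z : C) : C :=
  Cexp (Ci * PI * s * (z + IZR n) * (z + IZR n) - 2 * PI * Ci * IZR m * z)%C.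

Definition gper (s : C) (m : Z) (z : C) : C := C_Series_Z (fun n => gterm s m n z).

Lemma Re_le_Cmod_pos (z : C) : Re z <= Cmod z.
Proof. pose proof (re_le_Cmod z). pose proof (RRle_abs (Re z)). lra. Qed.

(** What is linear in [n] goes into [b] and the rest into [c]. Uniformity in [z] makes the constant
    of [gper_diff] independent of the sample point. *)
Lemma gterm_bound (s : C) (m : Z) (rho : R) : 0 <= rho -> exists b c, forall n z, Cmod z <= rho ->
  Cmod (gterm s m n z) <= exp (- (PI * Im s) * IZR n ^ 2 + b * Rabs (IZR n) + c).
Proof.
  intros Hrho. pose proof PI_RGT_0 as Hpi.
  exists (2 * PI * Cmod s * rho), (PI * Cmod s * rho * rho + 2 * PI * Rabs (IZR m) * rho).
  intros n z Hz. unfold gterm. rewrite Cmod_Cexp. apply exp_le_compat.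
  replace (Ci * PI * s * (z + IZR n) * (z + IZR n) - 2 * PI * Ci * IZR m * z)%C with
    (Ci * PI * s * (IZR n * IZR n) + (2 * PI * IZR n * Ci * s * z + (PI * Ci * s * z * z + 2 * PI * (- IZR m)%R * Ci * z)))%C
    by (rewrite RtoC_opp; ring).
  assert (E : forall a b, Re (a + b)%C = Re a + Re b) by reflexivity.
  rewrite !E.
  replace (Re (Ci * PI * s * (IZR n * IZR n))%C) with (- (PI * Im s) * IZR n ^ 2) by (destruct s; simpl; ring).
  pose proof (Re_le_Cmod_pos (2 * PI * IZR n * Ci * s * z)%C) as h1.
  pose proof (Re_le_Cmod_pos (PI * Ci * s * z * z)%C) as h2.
  pose proof (Re_le_Cmod_pos (2 * PI * (- IZR m)%R * Ci * z)%C) as h3.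
  rewrite !Cmod_mult, Cmod_Ci, !Cmod_R, (Rabs_pos_eq 2), (Rabs_pos_eq PI) in h1 by lra.
  rewrite !Cmod_mult, Cmod_Ci, !Cmod_R, (Rabs_pos_eq PI) in h2 by lra.
  rewrite !Cmod_mult, Cmod_Ci, !Cmod_R, Rabs_Ropp, (Rabs_pos_eq 2), (Rabs_pos_eq PI) in h3 by lra.
  pose proof (Cmod_ge_0 z). pose proof (Cmod_ge_0 s). pose proof (Rabs_pos (IZR n)). pose proof (Rabs_pos (IZR m)).
  assert (2 * PI * Rabs (IZR n) * 1 * Cmod s * Cmod z <= 2 * PI * Rabs (IZR n) * 1 * Cmod s * rho).
  { apply Rmult_le_compat_l; auto. repeat (apply Rmult_le_pos; [|lra]); lra. }
  assert (PI * 1 * Cmod s * Cmod z * Cmod z <= PI * 1 * Cmod s * rho * rho).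
  { replace (PI * 1 * Cmod s * Cmod z * Cmod z) with ((PI * Cmod s) * (Cmod z * Cmod z)) by ring.
    replace (PI * 1 * Cmod s * rho * rho) with ((PI * Cmod s) * (rho * rho)) by ring.
    apply Rmult_le_compat_l; nra. }
  assert (2 * PI * Rabs (IZR m) * 1 * Cmod z <= 2 * PI * Rabs (IZR m) * 1 * rho).
  { apply Rmult_le_compat_l; auto. repeat (apply Rmult_le_pos; [|lra]); lra. }
  lra.
Qed.

Lemma gauss_bound_Z (s b c : R) : 0 < s -> exists C0, 0 < C0 /\
  forall n : Z, exp (- s * IZR n ^ 2 + b * Rabs (IZR n) + c) <= C0 * exp (- 1) ^ Z.abs_nat n.
Proof.
  intros Hs. destruct (gauss_bound s b Hs) as [C0 [HC H]].
  exists (C0 * exp c). pose proof (exp_pos c). split; [apply Rmult_lt_0_compat; auto|]. intros n.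
  rewrite exp_plus, <- exp_opp_abs_pow. specialize (H (IZR n)).
  apply Rle_trans with (C0 * exp (- Rabs (IZR n)) * exp c); [|right; ring].
  apply Rmult_le_compat_r; lra.
Qed.

Lemma gper_bound (s : C) (m : Z) (z : C) : 0 < Im s -> exists C0, 0 < C0 /\
  forall n, Cmod (gterm s m n z) <= C0 * exp (- 1) ^ Z.abs_nat n.
Proof.
  intros Hs. pose proof PI_RGT_0.
  destruct (gterm_bound s m (Cmod z) (Cmod_ge_0 z)) as [b [c H0]].
  destruct (gauss_bound_Z (PI * Im s) b c ltac:(nra)) as [C0 [HC H1]].
  exists C0. split; auto. intros n. eapply Rle_trans; [apply H0; lra | apply H1].
Qed.

Lemma gper_has_sum (s : C) (m : Z) (z : C) : 0 < Im s -> has_sum (fun n => gterm s m n z) (gper s m z).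
Proof.
  intros Hs. destruct (gper_bound s m z Hs) as [C0 [HC H]].
  destruct (Z_abs_sum _ C0 _ exp_opp_1_bounds H) as [S [h _]]. exact h.
Qed.

Lemma Cexp_eq_mul (w v u : C) : (w = v + u)%C -> Cexp w = (Cexp u * Cexp v)%C.
Proof. intros ->. rewrite Cexp_add. ring. Qed.

Lemma has_sum_succ (f : Z -> C) (s : C) : has_sum f s -> has_sum (fun n => f (n + 1)%Z) s.
Proof.
  apply (has_sum_reindex f s (fun n => n + 1)%Z (fun n => n - 1)%Z); intros; lia.
Qed.

Lemma gper_add_1 (s : C) (m : Z) (z : C) : 0 < Im s -> gper s m (z + 1)%C = gper s m z.
Proof.
  intros Hs. eapply has_sum_unique; [apply gper_has_sum; auto|].
  pose proof (has_sum_succ _ _ (gper_has_sum s m z Hs)) as H.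
  eapply has_sum_ext; [|exact H]. intros n. cbv beta. unfold gterm. symmetry.
  rewrite (Cexp_eq_mul (Ci * PI * s * (z + 1 + IZR n) * (z + 1 + IZR n) - 2 * PI * Ci * IZR m * (z + 1))%C
     (Ci * PI * s * (z + IZR (n + 1)) * (z + IZR (n + 1)) - 2 * PI * Ci * IZR m * z)%C
     (2 * PI * IZR (- m) * Ci)%C).
  - rewrite Cexp_2PI_Z. ring.
  - rewrite plus_IZR, RtoC_plus, opp_IZR, RtoC_opp. ring.
Qed.

(** With [s tau = -1] the cross term of the square is [- 2 pi i (z + n)]: its part in [z] raises the
    frequency by one, and its part in [n] is a trivial phase. *)
Lemma gper_add_tau (s tau : C) (m : Z) (z : C) : 0 < Im s -> (s * tau = - (1))%C ->
  gper s m (z + tau)%C = (Cexp (- (Ci * PI * IZR (1 + 2 * m) * tau)) * gper s (m + 1) z)%C.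
Proof.
  intros Hs Hst. eapply has_sum_unique; [apply gper_has_sum; auto|].
  eapply has_sum_ext; [|apply has_sum_scal, (gper_has_sum s (m + 1) z Hs)].
  intros n. cbv beta. unfold gterm.
  rewrite <- Cexp_add. symmetry.
  rewrite (Cexp_eq_mul (Ci * PI * s * (z + tau + IZR n) * (z + tau + IZR n) - 2 * PI * Ci * IZR m * (z + tau))%C
    (- (Ci * PI * IZR (1 + 2 * m) * tau) +
    (Ci * PI * s * (z + IZR n) * (z + IZR n) - 2 * PI * Ci * IZR (m + 1) * z))%C (2 * PI * IZR (- n) * Ci)%C).
  - rewrite Cexp_2PI_Z. ring.
  - rewrite !plus_IZR, mult_IZR, opp_IZR, RtoC_opp, !RtoC_plus, RtoC_mult.
    transitivity (Ci * PI * s * (z + IZR n) * (z + IZR n) + 2 * Ci * PI * (s * tau) * (z + IZR n) + Ci * PI * (s * tau) * tau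
       - 2 * PI * Ci * IZR m * (z + tau))%C; [ring|]. rewrite Hst. ring.
Qed.

Lemma gper_ce (s : C) (m : Z) (x : R) : 0 < Im s -> gper s m x = (ce (- IZR m * x) * gper s 0 x)%C.
Proof.
  intros Hs. eapply has_sum_unique; [apply gper_has_sum; auto|].
  eapply has_sum_ext; [|apply has_sum_scal, (gper_has_sum s 0 x Hs)].
  intros n. cbv beta. unfold gterm, ce. rewrite <- Cexp_add. f_equal.
  rewrite RtoC_mult, RtoC_opp. ring.
Qed.

(** With [d] the increment of the exponent, the 5 is 4 from the remainder of [Cexp d] plus 1 from
    the part of [d] quadratic in [h]. The final exponent grows linearly in [|n|], so the Gaussian
    factor still dominates. *)
Lemma gterm_diff (s : C) (m n : Z) (rho M : R) (z v : C) (h : R) :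
  Cmod z <= rho -> Cmod v <= M -> 1 <= M -> 0 <= h <= 1 ->
  Cmod (gterm s m n (z + v * h) - gterm s m n z -
     v * h * (2 * PI * Ci * (s * (z + IZR n) - IZR m)) * gterm s m n z)%C
  <= Cmod (gterm s m n z) * (h ^ 2 * (5 * exp (3 * (M * (2 * PI * (Cmod s * (rho + Rabs (IZR n)) + Rabs (IZR m))) + M ^ 2 * (PI * Cmod s))))).
Proof.
  intros Hz Hv HM Hh. pose proof PI_RGT_0 as Hpi.
  set (E' := (2 * PI * Ci * (s * (z + IZR n) - IZR m))%C).
  set (B := 2 * PI * (Cmod s * (rho + Rabs (IZR n)) + Rabs (IZR m))).
  set (D := M * B + M ^ 2 * (PI * Cmod s)).
  set (d := (v * h * E' + Ci * PI * s * v * v * h * h)%C).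
  pose proof (Cmod_ge_0 s). pose proof (Cmod_ge_0 v).
  assert (EE : gterm s m n (z + v * h)%C = (Cexp d * gterm s m n z)%C).
  { unfold gterm. rewrite <- Cexp_add. f_equal. unfold d, E'. ring. }
  rewrite EE.
  replace (_ - _)%C with ((Cexp d - 1 - d + Ci * PI * s * v * v * h * h) * gterm s m n z)%C by (unfold d; ring).
  rewrite Cmod_mult, Rmult_comm. apply Rmult_le_compat_l; [apply Cmod_ge_0|].
  assert (hE : Cmod E' <= B).
  { unfold E', B. rewrite !Cmod_mult, Cmod_Ci, !Cmod_R, (Rabs_pos_eq 2), (Rabs_pos_eq PI), Rmult_1_r by lra.
    apply Rmult_le_compat_l; [lra|]. eapply Rle_trans; [apply Cmod_sub_upper|].
    rewrite Cmod_R, Cmod_mult. apply Rplus_le_compat_r. apply Rmult_le_compat_l; auto.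
    eapply Rle_trans; [apply Cmod_triangle|]. rewrite Cmod_R. lra. }
  assert (hB : 0 <= B) by (pose proof (Cmod_ge_0 E'); lra).
  assert (hq : Cmod (Ci * PI * s * v * v * h * h)%C <= h ^ 2 * (M ^ 2 * (PI * Cmod s))).
  { rewrite !Cmod_mult, Cmod_Ci, !Cmod_R, (Rabs_pos_eq h), (Rabs_pos_eq PI) by lra.
    replace (1 * PI * Cmod s * Cmod v * Cmod v * h * h) with (h ^ 2 * (Cmod v ^ 2 * (PI * Cmod s))) by ring.
    apply Rmult_le_compat_l; [nra|]. apply Rmult_le_compat_r; [nra|]. apply pow_incr. lra. }
  assert (hS : 0 <= M ^ 2 * (PI * Cmod s)) by (apply Rmult_le_pos; [apply pow_le; lra | nra]).
  assert (hD : 0 <= D) by (unfold D; nra).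
  assert (hd : Cmod d <= h * D).
  { unfold d. eapply Rle_trans; [apply Cmod_triangle|].
    assert (Cmod (v * h * E')%C <= h * (M * B)).
    { rewrite !Cmod_mult, Cmod_R, (Rabs_pos_eq h) by lra.
      replace (Cmod v * h * Cmod E') with (h * (Cmod v * Cmod E')) by ring.
      apply Rmult_le_compat_l; [lra|]. apply Rmult_le_compat; try lra. apply Cmod_ge_0. }
    assert (h ^ 2 * (M ^ 2 * (PI * Cmod s)) <= h * (M ^ 2 * (PI * Cmod s))).
    { apply Rmult_le_compat_r; auto. simpl. nra. }
    unfold D. lra. }
  eapply Rle_trans; [apply Cmod_triangle|].
  pose proof (Cexp_sub_affine_bound d) as hx.
  pose proof (Cmod_ge_0 d) as hd0.
  assert (e1 : exp (Cmod d) <= exp D) by (apply exp_le_compat; nra).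
  assert (e2 : D <= exp D) by (pose proof (exp_ineq1_le D); lra).
  assert (e3 : exp (3 * D) = exp D * exp D * exp D) by (rewrite <- !exp_plus; f_equal; ring).
  assert (e4 : 1 <= exp D) by (pose proof (exp_ineq1_le D); lra).
  assert (f1 : Cmod d ^ 2 <= h ^ 2 * D ^ 2) by (rewrite <- Rpow_mult_distr; apply pow_incr; lra).
  assert (f2 : 4 * Cmod d ^ 2 * exp (Cmod d) <= 4 * (h ^ 2 * D ^ 2) * exp D).
  { apply Rmult_le_compat; try lra; [nra | left; apply exp_pos]. }
  assert (f3 : D ^ 2 * exp D <= exp (3 * D)).
  { rewrite e3. apply Rmult_le_compat_r; [lra|]. simpl. nra. }
  assert (f4 : M ^ 2 * (PI * Cmod s) <= exp (3 * D)).
  { apply Rle_trans with D; [unfold D; nra|]. rewrite e3. nra. }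
  fold B D.
  assert (0 <= h ^ 2) by nra.
  assert (4 * (h ^ 2 * D ^ 2) * exp D <= h ^ 2 * (4 * exp (3 * D))) by nra.
  assert (h ^ 2 * (M ^ 2 * (PI * Cmod s)) <= h ^ 2 * exp (3 * D)) by (apply Rmult_le_compat_l; auto).
  lra.
Qed.

(* For small real [h], the increments of [gper] along [mu h] and [h] are
   proportional up to [O(h^2)]: complex differentiability, without the derivative. *)
Lemma gper_diff (s : C) (m : Z) (rho : R) (mu : C) : 0 < Im s -> 0 <= rho ->
  exists K, 0 <= K /\ forall z h, Cmod z <= rho -> 0 <= h <= 1 ->
    Cmod (gper s m (z + mu * h) - gper s m z - mu * (gper s m (z + h) - gper s m z))%C <= K * h ^ 2.
Proof.
  intros Hs Hrho. pose proof PI_RGT_0 as Hpi.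
  destruct (gterm_bound s m rho Hrho) as [b [c Hb]].
  set (M := 1 + Cmod mu).
  assert (HM : 1 <= M) by (unfold M; pose proof (Cmod_ge_0 mu); lra).
  destruct (gauss_bound_Z (PI * Im s) (b + 3 * (M * (2 * PI * Cmod s)))
    (c + 3 * (M * (2 * PI * (Cmod s * rho + Rabs (IZR m))) + M ^ 2 * (PI * Cmod s)))) as [C0 [HC HC0]]; [nra|].
  set (r := exp (- 1)). pose proof exp_opp_1_bounds as Hr. fold r in Hr, HC0.
  exists (2 * (5 * M * C0) / (1 - r)). split.
  { apply Rdiv_le_0_compat; [nra | lra]. }
  intros z h Hz Hh.
  set (g := fun n => (gterm s m n (z + mu * h) - gterm s m n z - mu * (gterm s m n (z + h) - gterm s m n z))%C).
  assert (Hg : has_sum g (gper s m (z + mu * h) - gper s m z - mu * (gper s m (z + h) - gper s m z))%C).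
  { pose proof (gper_has_sum s m (z + mu * h)%C Hs) as h1. pose proof (gper_has_sum s m z Hs) as h2.
    pose proof (gper_has_sum s m (z + h)%C Hs) as h3.
    pose proof (has_sum_plus _ _ _ _ h1 (has_sum_plus _ _ _ _ (has_sum_scal (mu - 1)%C _ _ h2) (has_sum_scal (- mu)%C _ _ h3))) as h4.
    eapply has_sum_ext in h4.
    - replace (_ - _)%C with (gper s m (z + mu * h) + ((mu - 1) * gper s m z + - mu * gper s m (z + h)))%C by ring. exact h4.
    - intros n. simpl. unfold g. ring. }
  apply (has_sum_bound _ _ _ Hg). intros L HL.
  replace (2 * (5 * M * C0) / (1 - r) * h ^ 2) with (2 * (5 * M * C0 * h ^ 2) / (1 - r)) by (field; lra).
  apply Z_lsumR_bound; auto. intros n.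
  set (w := (2 * PI * Ci * (s * (z + IZR n) - IZR m))%C).
  pose proof (gterm_diff s m n rho M z mu h Hz ltac:(unfold M; lra) HM Hh) as d1.
  pose proof (gterm_diff s m n rho M z 1 h Hz ltac:(rewrite Cmod_1; lra) HM Hh) as d2.
  fold w in d1, d2.
  set (X := exp (3 * (M * (2 * PI * (Cmod s * (rho + Rabs (IZR n)) + Rabs (IZR m))) + M ^ 2 * (PI * Cmod s)))) in *.
  replace (z + 1 * h)%C with (z + h)%C in d2 by ring.
  (* The logarithmic derivative [w] of the term cancels between the directions [mu] and 1; only the
     two remainders are left. *)
  replace (g n) with ((gterm s m n (z + mu * h) - gterm s m n z - mu * h * w * gterm s m n z)
    - mu * (gterm s m n (z + h) - gterm s m n z - 1 * h * w * gterm s m n z))%C by (unfold g; ring).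
  eapply Rle_trans; [apply Cmod_sub_upper|]. rewrite Cmod_mult.
  assert (hX : Cmod (gterm s m n z) * X <= C0 * r ^ Z.abs_nat n).
  { eapply Rle_trans; [|apply HC0].
    eapply Rle_trans; [apply Rmult_le_compat_r; [left; apply exp_pos | apply Hb; auto]|].
    unfold X. rewrite <- exp_plus. apply exp_le_compat. right. ring. }
  pose proof (Cmod_ge_0 mu).
  apply Rle_trans with (M * (Cmod (gterm s m n z) * (h ^ 2 * (5 * X)))).
  - unfold M. nra.
  - replace (M * (Cmod (gterm s m n z) * (h ^ 2 * (5 * X)))) with (5 * M * h ^ 2 * (Cmod (gterm s m n z) * X)) by ring.
    replace (5 * M * C0 * h ^ 2 * r ^ Z.abs_nat n) with (5 * M * h ^ 2 * (C0 * r ^ Z.abs_nat n)) by ring.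
    apply Rmult_le_compat_l; nra.
Qed.

(** The [m]-th discrete Fourier coefficient of [gper s 0]; the character is already inside
    [gper s m], by [gper_ce]. *)
Definition dft (s : C) (N : nat) (m : Z) : C := avg N (fun j => gper s m (INR j / INR N)%R).

Lemma csum_cyclic (f : nat -> C) (N : nat) : f N = f O -> csum (fun j => f (S j)) N = csum f N.
Proof.
  intros H. pose proof (csum_shift f N) as E. cbn [csum] in E. rewrite H in E.
  replace (csum f N) with (csum f N + f O - f O)%C by ring. rewrite E. ring.
Qed.

(** A shift by the spacing permutes the samples cyclically, up to the period 1. *)
Lemma avg_gper_shift (s : C) (m : Z) (N : nat) (w : C) : (0 < N)%nat -> 0 < Im s ->
  avg N (fun j => gper s m ((INR j / INR N)%R + w + (/ INR N)%R)%C) = avg N (fun j => gper s m ((INR j / INR N)%R + w)%C).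
Proof.
  intros HN Hs. unfold avg. f_equal.
  assert (hN : INR N <> 0) by (apply not_0_INR; lia).
  rewrite <- (csum_cyclic (fun j => gper s m ((INR j / INR N)%R + w)%C)).
  - apply csum_ext. intros j _. f_equal. rewrite S_INR.
    replace ((INR j + 1) / INR N)%R with (INR j / INR N + / INR N)%R by (field; auto).
    rewrite RtoC_plus. ring.
  - replace (INR N / INR N)%R with 1 by (field; auto). simpl INR. replace (0 / INR N)%R with 0 by (field; auto).
    replace (1 + w)%C with (0 + w + 1)%C by ring. apply gper_add_1. auto.
Qed.

(** A discrete contour shift by [tau], in [N] steps of [tau / N]. In the mean over a period the
    horizontal increments cancel, so [gper_diff] leaves an error of order [1 / N^2] per step. *)
Lemma avg_gper_vertical (s tau : C) (m : Z) : 0 < Im s ->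
  exists K, 0 <= K /\ forall N, (0 < N)%nat ->
   Cmod (avg N (fun j => gper s m ((INR j / INR N)%R + tau)%C) - dft s N m)%C <= K / INR N.
Proof.
  intros Hs.
  destruct (gper_diff s m (1 + Cmod tau) tau Hs) as [K [HK H]]; [pose proof (Cmod_ge_0 tau); lra|].
  exists K. split; auto. intros N HN.
  assert (hN : 0 < INR N) by (apply lt_0_INR; auto).
  set (h := / INR N). assert (hh : 0 <= h <= 1).
  { unfold h. split; [left; apply Rinv_0_lt_compat; auto|].
    rewrite <- Rinv_1. apply Rinv_le_contravar; [lra|]. apply (le_INR 1). lia. }
  set (A := fun i : nat => avg N (fun j => gper s m ((INR j / INR N)%R + (INR i * h)%R * tau)%C)).
  assert (St : forall i, (i < N)%nat -> Cmod (A (S i) - A i)%C <= K * h ^ 2).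
  { intros i Hi.
    assert (E : (A (S i) - A i)%C = avg N (fun j =>
       gper s m (((INR j / INR N)%R + (INR i * h)%R * tau) + tau * h) - gper s m ((INR j / INR N)%R + (INR i * h)%R * tau)
       - tau * (gper s m (((INR j / INR N)%R + (INR i * h)%R * tau) + h) - gper s m ((INR j / INR N)%R + (INR i * h)%R * tau)))%C).
    { pose proof (avg_gper_shift s m N ((INR i * h)%R * tau)%C HN Hs) as Sh. fold h in Sh.
      assert (EA : A (S i) = avg N (fun j => gper s m (((INR j / INR N)%R + (INR i * h)%R * tau) + tau * h)%C)).
      { unfold A. apply avg_ext. intros j _. f_equal. rewrite S_INR.
        replace ((INR i + 1) * h)%R with (INR i * h + h)%R by ring. rewrite RtoC_plus. ring. }
      rewrite EA. unfold A.
      rewrite (avg_ext N (fun j =>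
       gper s m (((INR j / INR N)%R + (INR i * h)%R * tau) + tau * h) - gper s m ((INR j / INR N)%R + (INR i * h)%R * tau)
       - tau * (gper s m (((INR j / INR N)%R + (INR i * h)%R * tau) + h) - gper s m ((INR j / INR N)%R + (INR i * h)%R * tau)))%C
       (fun j => gper s m (((INR j / INR N)%R + (INR i * h)%R * tau) + tau * h) +
         ((tau - 1) * gper s m ((INR j / INR N)%R + (INR i * h)%R * tau) +
          (- tau) * gper s m (((INR j / INR N)%R + (INR i * h)%R * tau) + h)))%C) by (intros; ring).
      rewrite !avg_plus, !avg_scal, Sh. ring. }
    rewrite E. apply avg_bound; auto. intros j Hj. apply H; auto.
    eapply Rle_trans; [apply Cmod_triangle|]. rewrite Cmod_mult, !Cmod_R.
    assert (0 <= INR j / INR N <= 1).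
    { split; [apply Rdiv_le_0_compat; auto; apply pos_INR|]. apply Rle_div_l; auto.
      rewrite Rmult_1_l. left; apply lt_INR; auto. }
    assert (0 <= INR i * h <= 1).
    { split; [apply Rmult_le_pos; [apply pos_INR | lra]|]. unfold h. apply Rle_div_l; auto.
      rewrite Rmult_1_l. left; apply lt_INR; auto. }
    rewrite !Rabs_pos_eq by lra. pose proof (Cmod_ge_0 tau). nra. }
  assert (Tot : forall i, (i <= N)%nat -> Cmod (A i - A O)%C <= INR i * (K * h ^ 2)).
  { induction i; intros Hi.
    - replace (A O - A O)%C with (0 : C) by ring. rewrite Cmod_0. simpl; lra.
    - rewrite S_INR. replace (A (S i) - A O)%C with ((A (S i) - A i) + (A i - A O))%C by ring.
      eapply Rle_trans; [apply Cmod_triangle|]. specialize (St i ltac:(lia)). specialize (IHi ltac:(lia)). lra. }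
  specialize (Tot N (le_n _)).
  assert (EN : A N = avg N (fun j => gper s m ((INR j / INR N)%R + tau)%C)).
  { unfold A. apply avg_ext. intros j _. f_equal. replace (INR N * h)%R with 1 by (unfold h; field; lra). ring. }
  assert (E0 : A O = dft s N m).
  { unfold A, dft. apply avg_ext. intros j _. f_equal. simpl INR. rewrite Rmult_0_l. ring. }
  rewrite EN, E0 in Tot. eapply Rle_trans; [apply Tot|]. right. unfold h. field. lra.
Qed.

Lemma dft_step (s tau : C) (m : Z) : 0 < Im s -> (s * tau = - (1))%C ->
  exists K, 0 <= K /\ forall N, (0 < N)%nat ->
   Cmod (Cexp (- (Ci * PI * IZR (1 + 2 * m) * tau)) * dft s N (m + 1) - dft s N m)%C <= K / INR N.
Proof.
  intros Hs Hst. destruct (avg_gper_vertical s tau m Hs) as [K [HK H]].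
  exists K. split; auto. intros N HN. specialize (H N HN).
  unfold dft at 1. rewrite <- avg_scal.
  rewrite (avg_ext _ _ (fun j => gper s m ((INR j / INR N)%R + tau)%C)); auto.
  intros j _. symmetry. apply gper_add_tau; auto.
Qed.

(** The factor in [dft_step] is the inverse ratio of consecutive Gaussian values, so induction from
    0 in both directions applies. The constant depends on [m] and is made uniform over finite ranges
    by [finite_sup]. *)
Lemma dft_gauss (s tau : C) : 0 < Im s -> (s * tau = - (1))%C -> forall m : Z,
  exists K, 0 <= K /\ forall N, (0 < N)%nat ->
   Cmod (dft s N m - gauss tau (IZR m) * dft s N 0)%C <= K / INR N.
Proof.
  intros Hs Hst.
  assert (G : forall m, gauss tau (IZR (m + 1)) = (Cexp (Ci * PI * IZR (1 + 2 * m) * tau) * gauss tau (IZR m))%C).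
  { intros m. unfold gauss. rewrite <- Cexp_add. f_equal.
    rewrite !plus_IZR, mult_IZR. replace ((IZR m + 1) ^ 2)%R with ((1 + 2 * IZR m) + IZR m ^ 2) by ring.
    rewrite (RtoC_plus (1 + 2 * IZR m)). ring. }
  intros m. pattern m. apply Z.peano_ind; clear m.
  - exists 0. split; [lra|]. intros N HN. unfold gauss. simpl.
    replace (Ci * PI * (0 * (0 * 1))%R * tau)%C with (0 : C) by (rewrite !Rmult_0_l; ring).
    rewrite Cexp_0. replace (dft s N 0 - 1 * dft s N 0)%C with (0 : C) by ring. rewrite Cmod_0. lra.
  - intros n [K [HK H]]. unfold Z.succ. destruct (dft_step s tau n Hs Hst) as [K1 [HK1 H1]].
    set (e := Cexp (Ci * PI * IZR (1 + 2 * n) * tau)%C) in *.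
    exists (Cmod e * (K + K1)). split; [pose proof (Cmod_ge_0 e); nra|]. intros N HN.
    specialize (H N HN). specialize (H1 N HN). rewrite Cexp_opp in H1. rewrite G.
    specialize (G n). fold e in G, H1 |- *. assert (he : e <> 0) by apply Cexp_neq_0.
    replace (_ - _)%C with (e * ((/ e * dft s N (n + 1) - dft s N n) + (dft s N n - gauss tau (IZR n) * dft s N 0)))%C by (field; auto).
    rewrite Cmod_mult. unfold Rdiv in *. rewrite Rmult_assoc. apply Rmult_le_compat_l; [apply Cmod_ge_0|].
    eapply Rle_trans; [apply Cmod_triangle|]. lra.
  - intros n [K [HK H]]. unfold Z.pred. set (p := (n + -1)%Z) in *.
    replace n with (p + 1)%Z in H by (unfold p; ring).
    destruct (dft_step s tau p Hs Hst) as [K1 [HK1 H1]].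
    set (e := Cexp (Ci * PI * IZR (1 + 2 * p) * tau)%C) in *.
    exists (Cmod (/ e)%C * K + K1). split; [pose proof (Cmod_ge_0 (/ e)%C); nra|]. intros N HN.
    specialize (H N HN). specialize (H1 N HN). rewrite Cexp_opp in H1. rewrite G in H.
    fold e in H, H1. assert (he : e <> 0) by apply Cexp_neq_0.
    replace (_ - _)%C with (/ e * (dft s N (p + 1) - e * gauss tau (IZR p) * dft s N 0)
       - (/ e * dft s N (p + 1) - dft s N p))%C by (field; auto).
    eapply Rle_trans; [apply Cmod_sub_upper|]. rewrite Cmod_mult. pose proof (Cmod_ge_0 (/ e)%C).
    unfold Rdiv in *. nra.
Qed.

(** Finite Fourier inversion: with the sum over frequencies taken inside, orthogonality keeps only
    the sample [j = k]. Starting the frequencies at [-L] produces a phase, which is 1 at that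
    sample. *)
Lemma dft_inversion (s : C) (L k : nat) : 0 < Im s -> (k < 2 * L)%nat ->
  zsum (fun m => dft s (2 * L) m * ce (IZR m * (INR k / INR (2 * L))))%C L = gper s 0 (INR k / INR (2 * L))%R.
Proof.
  intros Hs Hk. set (N := (2 * L)%nat) in *.
  assert (HN : (0 < N)%nat) by lia. assert (hN : INR N <> 0) by (apply not_0_INR; lia).
  set (g := fun j => gper s 0 (INR j / INR N)%R).
  rewrite zsum_csum. fold N.
  rewrite (csum_ext _ (fun i => csum (fun j => / INR N *
     (g j * ce (- INR L * (INR k - INR j) / INR N) * ce (IZR (Z.of_nat k - Z.of_nat j) * (INR i / INR N))))%C N)).
  - rewrite csum_exchange.
    rewrite (csum_ext _ (fun j => g j * ce (- INR L * (INR k - INR j) / INR N) *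
      avg N (fun i => ce (IZR (Z.of_nat k - Z.of_nat j) * (INR i / INR N))))%C).
    + rewrite (csum_single _ _ k); auto.
      * rewrite Z.sub_diag, (avg_ext _ _ (fun _ => 1)).
        -- rewrite avg_const by auto. replace (- INR L * (INR k - INR k) / INR N) with 0 by (field; auto).
           rewrite ce_0. unfold g. ring.
        -- intros i _. rewrite Rmult_0_l. apply ce_0.
      * intros j Hj Hn. rewrite avg_roots by lia. ring.
    + intros j _. unfold avg, Cdiv. rewrite csum_scal, csum_scal. ring.
  - intros i _. unfold dft, avg, Cdiv.
    rewrite (csum_ext (fun j => gper s (Z.of_nat i - Z.of_nat L) (INR j / INR N)%R)
       (fun j => ce (- IZR (Z.of_nat i - Z.of_nat L) * (INR j / INR N)) * g j)%C)
      by (intros; apply gper_ce; auto).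
    set (S := csum _ N). set (e := ce (IZR _ * _)).
    transitivity (/ INR N * e * S)%C; [ring|]. unfold S, e. rewrite <- csum_scal.
    apply csum_ext. intros j _.
    rewrite !minus_IZR, <- !INR_IZR_INZ.
    replace (ce (- INR L * (INR k - INR j) / INR N) ) with (ce (- INR L * (INR k / INR N)) * ce (INR L * (INR j / INR N)))%C
      by (rewrite <- ce_add; f_equal; field; auto).
    replace (ce ((INR i - INR L) * (INR k / INR N))) with (ce (INR i * (INR k / INR N)) * ce (- INR L * (INR k / INR N)))%C
      by (rewrite <- ce_add; f_equal; field; auto).
    replace (ce (- (INR i - INR L) * (INR j / INR N))) with (ce (- INR i * (INR j / INR N)) * ce (INR L * (INR j / INR N)))%C
      by (rewrite <- ce_add; f_equal; field; auto).
    replace (ce ((INR k - INR j) * (INR i / INR N))) with (ce (INR i * (INR k / INR N)) * ce (- INR i * (INR j / INR N)))%C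
      by (rewrite <- ce_add; f_equal; field; auto).
    ring.
Qed.

Lemma sin_lower_bound (x : R) : 0 <= x <= PI / 2 -> x / 8 <= sin x.
Proof.
  intros Hx. pose proof PI_4.
  destruct (Rle_dec x (/ 2)) as [h|h].
  - pose proof (sin_sub_bound_sqr x) as K. apply Rabs_le_between in K. nra.
  - pose proof (sin_sub_bound_sqr (/ 2)) as K. apply Rabs_le_between in K.
    assert (sin (/ 2) <= sin x) by (apply sin_incr_1; lra). lra.
Qed.

Lemma ce_second_difference (x : R) : Rabs x <= / 2 -> x ^ 2 / 2 <= Cmod (ce x + ce (- x) - 2)%C.
Proof.
  intros Hx.
  assert (E : (ce x + ce (- x) - 2)%C = RtoC (- (4 * sin (PI * Rabs x) ^ 2))).
  { assert (E1 : forall x, Re (ce x) = cos (2 * (PI * x))).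
    { intros t. unfold ce, Cexp. simpl.
      repeat rewrite ?Rmult_0_r, ?Rmult_0_l, ?Rminus_0_r, ?Rplus_0_r, ?Rplus_0_l, ?Rmult_1_r.
      rewrite exp_0, Rmult_1_l. f_equal. ring. }
    assert (E2 : sin (PI * Rabs x) ^ 2 = sin (PI * x) ^ 2).
    { unfold Rabs. destruct (Rcase_abs x); [|reflexivity].
      rewrite <- Ropp_mult_distr_r, sin_neg. ring. }
    rewrite E2, ce_opp. apply Ceq.
    - transitivity (Re (ce x) + Re (ce x) - 2); [unfold Re; simpl; ring|].
      rewrite E1, cos_2a_sin. simpl. ring.
    - unfold Im. simpl. ring. }
  rewrite E, Cmod_R, Rabs_Ropp, Rabs_pos_eq by (pose proof (pow2_ge_0 (sin (PI * Rabs x))); lra).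
  pose proof (Rabs_pos x) as h0. pose proof PI2_3_2 as hp.
  pose proof (sin_lower_bound (PI * Rabs x) ltac:(split; nra)) as K.
  rewrite <- (pow2_abs x).
  assert ((3 / 8 * Rabs x) ^ 2 <= sin (PI * Rabs x) ^ 2) by (apply pow_incr; nra). nra.
Qed.

(** Taking second differences of the samples multiplies the [m]-th coefficient by
    [ce (m h) + ce (- m h) - 2], of modulus at least [(m h)^2 / 2], while the differences are
    [O(h^2)]. The range of [m] ensures [|m h| <= 1/2], and [B] depends on neither [L] nor [m]. *)
Lemma dft_decay (s : C) : 0 < Im s -> exists B, 0 <= B /\
  forall L m, (0 < L)%nat -> (Z.abs m <= Z.of_nat L)%Z -> Cmod (dft s (2 * L) m) * IZR m ^ 2 <= B.
Proof.
  intros Hs. destruct (gper_diff s 0 1 (- (1))%C Hs ltac:(lra)) as [K [HK H]].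
  exists (2 * K). split; [lra|]. intros L m HL Hm.
  set (N := (2 * L)%nat). assert (HN : (0 < N)%nat) by (unfold N; lia).
  assert (hN : 0 < INR N) by (apply lt_0_INR; auto).
  set (h := / INR N).
  assert (hh : 0 <= h <= 1).
  { unfold h. split; [left; apply Rinv_0_lt_compat; auto|].
    rewrite <- Rinv_1. apply Rinv_le_contravar; [lra|]. apply (le_INR 1). lia. }
  set (z := fun j => INR j / INR N).
  assert (E : (dft s N m * (ce (IZR m * h) + ce (- (IZR m * h)) - 2))%C =
    avg N (fun j => ce (- IZR m * z j) * (gper s 0 (z j + - (1) * h) - gper s 0 (z j) - - (1) * (gper s 0 (z j + h) - gper s 0 (z j))))%C).
  { assert (S1 : avg N (fun j => ce (- IZR m * z j) * gper s 0 (z j + h))%C = (ce (IZR m * h) * dft s N m)%C).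
    { unfold dft. rewrite <- avg_scal.
      transitivity (avg N (fun j => ce (IZR m * h) * gper s m ((INR j / INR N)%R + 0 + (/ INR N)%R))%C).
      - apply avg_ext. intros j _. fold (z j) h.
        replace (z j + 0 + h)%C with (RtoC (z j + h)) by (rewrite RtoC_plus; ring).
        rewrite (gper_ce s m) by auto. rewrite Cmult_assoc, <- ce_add, RtoC_plus. f_equal. f_equal. ring.
      - rewrite !avg_scal. f_equal. rewrite avg_gper_shift by auto. apply avg_ext. intros j _. f_equal. ring. }
    assert (S2 : avg N (fun j => ce (- IZR m * z j) * gper s 0 (z j + - (1) * h))%C = (ce (- (IZR m * h)) * dft s N m)%C).
    { unfold dft. rewrite <- avg_scal.
      transitivity (avg N (fun j => ce (- (IZR m * h)) * gper s m ((INR j / INR N)%R + (- h)%R))%C).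
      - apply avg_ext. intros j _. fold (z j).
        replace (z j + - (1) * h)%C with (RtoC (z j + - h)) by (rewrite RtoC_plus, RtoC_opp; ring).
        rewrite <- RtoC_plus. rewrite (gper_ce s m) by auto. rewrite Cmult_assoc, <- ce_add. f_equal. f_equal. ring.
      - rewrite !avg_scal. f_equal. rewrite <- avg_gper_shift by auto. apply avg_ext. intros j _. f_equal. fold h.
        rewrite RtoC_opp. ring. }
    assert (S0 : avg N (fun j => ce (- IZR m * z j) * gper s 0 (z j))%C = dft s N m).
    { apply avg_ext. intros j _. symmetry. apply gper_ce; auto. }
    rewrite (avg_ext _ _ (fun j => ce (- IZR m * z j) * gper s 0 (z j + - (1) * h) +
      (ce (- IZR m * z j) * gper s 0 (z j + h) + (- (2)) * (ce (- IZR m * z j) * gper s 0 (z j))))%C) by (intros; ring).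
    rewrite !avg_plus, avg_scal, S0, S1, S2. ring. }
  assert (B1 : Cmod (dft s N m * (ce (IZR m * h) + ce (- (IZR m * h)) - 2))%C <= K * h ^ 2).
  { rewrite E. apply avg_bound; auto. intros j Hj. rewrite Cmod_mult, Cmod_ce, Rmult_1_l.
    apply H; auto. rewrite Cmod_R. unfold z.
    assert (0 <= INR j / INR N <= 1).
    { split; [apply Rdiv_le_0_compat; auto; apply pos_INR|]. apply Rle_div_l; auto.
      rewrite Rmult_1_l. left; apply lt_INR; auto. }
    rewrite Rabs_pos_eq; lra. }
  rewrite Cmod_mult in B1.
  assert (B2 : Rabs (IZR m * h) <= / 2).
  { rewrite Rabs_mult, (Rabs_pos_eq h) by lra. rewrite <- abs_IZR. unfold h.
    apply Rle_div_l; auto. unfold N. rewrite mult_INR. simpl (INR 2).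
    apply IZR_le in Hm. rewrite <- INR_IZR_INZ in Hm. lra. }
  pose proof (ce_second_difference _ B2) as B3.
  fold N. pose proof (Cmod_ge_0 (dft s N m)).
  assert (h0 : 0 < h) by (unfold h; apply Rinv_0_lt_compat; auto).
  apply Rmult_le_reg_r with (h ^ 2); [apply pow_lt; auto|].
  rewrite Rpow_mult_distr in B3.
  assert (Cmod (dft s N m) * (IZR m ^ 2 * h ^ 2 / 2) <= K * h ^ 2).
  { eapply Rle_trans; [|apply B1]. apply Rmult_le_compat_l; auto. }
  lra.
Qed.

Lemma zsum_bound (f : Z -> C) (B : R) (L : nat) :
  (forall m, (Z.abs m <= Z.of_nat L)%Z -> Cmod (f m) <= B) -> Cmod (zsum f L) <= 2 * INR L * B.
Proof.
  intros H. unfold zsum. eapply Rle_trans; [apply Cmod_triangle|].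
  pose proof (csum_bound (fun n => f (Z.of_nat n)) B L ltac:(intros; apply H; lia)).
  pose proof (csum_bound (fun n => f (- Z.of_nat (S n))%Z) B L ltac:(intros; apply H; lia)). lra.
Qed.

Lemma zsum_minus (f g : Z -> C) (L : nat) : zsum (fun m => f m - g m)%C L = (zsum f L - zsum g L)%C.
Proof.
  rewrite (zsum_ext _ (fun m => f m + (- (1)) * g m)%C) by (intros; ring).
  unfold zsum. rewrite !csum_plus, !csum_scal. ring.
Qed.

Lemma finite_sup (f : Z -> R -> Prop) (M : nat) :
  (forall m K K', f m K -> K <= K' -> f m K') -> (forall m, exists K, 0 <= K /\ f m K) ->
  exists K, 0 <= K /\ forall m, (Z.abs m <= Z.of_nat M)%Z -> f m K.
Proof.
  intros Hmon H. induction M.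
  - destruct (H 0%Z) as [K [HK h]]. exists K. split; auto. intros m Hm. replace m with 0%Z by lia. auto.
  - destruct IHM as [K [HK h]]. destruct (H (Z.of_nat (S M))) as [K1 [HK1 h1]].
    destruct (H (- Z.of_nat (S M))%Z) as [K2 [HK2 h2]].
    exists (K + K1 + K2). split; [lra|]. intros m Hm.
    destruct (Z.eq_dec m (Z.of_nat (S M))) as [->|n1]; [apply (Hmon _ K1); auto; lra|].
    destruct (Z.eq_dec m (- Z.of_nat (S M))) as [->|n2]; [apply (Hmon _ K2); auto; lra|].
    apply (Hmon _ K); [apply h; lia | lra].
Qed.

Lemma Im_neg_inv (tau : C) : 0 < Im tau -> 0 < Im (- (1) / tau)%C.
Proof.
  intros Ht. destruct tau as [x y]. simpl in *.
  replace (_ + _) with (y / (x * x + y * y)) by (field; nra).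
  apply Rdiv_lt_0_compat; nra.
Qed.

Lemma gper_0_theta00 (s : C) : gper s 0 0 = theta00 s.
Proof.
  apply C_Series_Z_ext. intros n. unfold gterm. f_equal. simpl. rewrite Rmult_1_r, RtoC_mult. ring.
Qed.

Lemma gper_half_theta10 (s : C) : gper s 0 (/ 2)%R = theta10 s.
Proof.
  apply C_Series_Z_ext. intros n. unfold gterm. f_equal. simpl. rewrite Rmult_1_r, RtoC_mult, !RtoC_plus. ring.
Qed.

Lemma theta01_series (tau : C) : 0 < Im tau ->
  theta01 tau = C_Series_Z (fun m => gauss tau (IZR m) * ce (IZR m * / 2))%C.
Proof.
  intros Ht. unfold theta01, theta00. apply C_Series_Z_ext. intros n.
  fold (gauss (tau + 1) (IZR n)). rewrite gauss_add_1, Cmult_comm. f_equal.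
  destruct (Zeven_odd_dec (n * (n - 1))) as [h|h].
  - destruct (Zeven_ex _ h) as [k Hk].
    replace (IZR n ^ 2 / 2) with (IZR k + IZR n * / 2).
    + rewrite ce_add, ce_Z. ring.
    + assert (E : IZR n * (IZR n - 1) = 2 * IZR k) by (rewrite <- minus_IZR, <- !mult_IZR; f_equal; lia).
      simpl. lra.
  - exfalso. destruct (Zeven_odd_dec n) as [e|o].
    + apply (Zeven_not_Zodd (n * (n - 1))); auto. apply Zeven_mult_Zeven_l; auto.
    + apply (Zeven_not_Zodd (n * (n - 1))); auto. apply Zeven_mult_Zeven_r, Zodd_plus_Zodd; auto. exact I.
Qed.

(** Finite inversion at 0 and at 1/2 writes [theta00 s] and [theta10 s] as sums of the coefficients
    without and with the sign [(-1)^m]. The coefficients are nearly [dft s N 0] times Gaussian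
    values, so the sums are nearly [dft s N 0] times [theta00 tau] and [theta01 tau]. Eliminating
    the common factor avoids its evaluation, a Gaussian integral with a choice of square root. *)
Lemma theta_inversion (tau : C) : 0 < Im tau ->
  (theta00 (- (1) / tau) * theta01 tau = theta10 (- (1) / tau) * theta00 tau)%C.
Proof.
  intros Ht. set (s := (- (1) / tau)%C).
  assert (Hs : 0 < Im s) by (apply Im_neg_inv; auto).
  assert (Hst : (s * tau = - (1))%C).
  { unfold s. field. intros e. rewrite e in Ht. simpl in Ht. lra. }
  destruct (dft_decay s Hs) as [B [HB Hdec]].
  set (P := zsum (fun m => gauss tau (IZR m))).
  set (Q := zsum (fun m => gauss tau (IZR m) * ce (IZR m * / 2))%C).
  assert (Key : forall M, (2 <= M)%nat ->
    Cmod (theta00 s * Q M - theta10 s * P M)%C <= 2 * B / (INR M - 1) * (Cmod (P M) + Cmod (Q M))).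
  { intros M HM.
    (* [K] serves all [|m| <= M] but depends on [M]; the number of samples therefore grows first,
       with [M] fixed. *)
    destruct (finite_sup (fun m K => forall N, (0 < N)%nat -> Cmod (dft s N m - gauss tau (IZR m) * dft s N 0)%C <= K / INR N) M) as [K [HK0 HK]].
    { intros m K K' h hK N HN. eapply Rle_trans; [apply h; auto|].
      unfold Rdiv. apply Rmult_le_compat_r; auto. left. apply Rinv_0_lt_compat, lt_0_INR. auto. }
    { apply dft_gauss; auto. }
    assert (hPQ : 0 <= Cmod (P M) + Cmod (Q M)) by (pose proof (Cmod_ge_0 (P M)); pose proof (Cmod_ge_0 (Q M)); lra).
    apply le_epsilon. intros eps He.
    destruct (archimed_cor1 (eps / (INR M * K * (Cmod (P M) + Cmod (Q M)) + 1))) as [L0 [HL0 HL0']].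
    { apply Rdiv_lt_0_compat; [lra|]. pose proof (Rmult_le_pos _ _ (Rmult_le_pos _ _ (pos_INR M) HK0) hPQ). lra. }
    set (J := L0). set (L := (M + J)%nat). assert (HLp : (0 < L)%nat) by (unfold L; lia).
    assert (hL : 0 < INR L) by (apply lt_0_INR; auto).
    assert (h2L : INR (2 * L) = 2 * INR L) by (rewrite mult_INR; reflexivity).
    set (N := (2 * L)%nat) in *. assert (HN : (0 < N)%nat) by (unfold N; lia).
    assert (near : forall (w : Z -> C) (val : C), (forall m, Cmod (w m) <= 1) ->
       zsum (fun m => dft s N m * w m)%C L = val ->
       Cmod (val - dft s N 0 * zsum (fun m => gauss tau (IZR m) * w m)%C M)%C <= 2 * B / (INR M - 1) + INR M * K / INR L).
    { intros w val Hw <-.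
      assert (T1 : Cmod (zsum (fun m => dft s N m * w m)%C L - zsum (fun m => dft s N m * w m)%C M)%C <= 2 * B / (INR M - 1)).
      { unfold L. apply zsum_tail; auto. intros m Hm. rewrite Cmod_mult.
        pose proof (Hdec L m HLp Hm) as hd. fold N in hd. specialize (Hw m).
        pose proof (Cmod_ge_0 (dft s N m)). eapply Rle_trans; [|apply hd]. apply Rmult_le_compat_r; [apply pow2_ge_0|].
        rewrite <- (Rmult_1_r (Cmod (dft s N m))) at 2. apply Rmult_le_compat_l; auto. }
      assert (T2 : Cmod (zsum (fun m => dft s N m * w m)%C M - dft s N 0 * zsum (fun m => gauss tau (IZR m) * w m)%C M)%C <= INR M * K / INR L).
      { rewrite <- zsum_scal, <- zsum_minus.
        replace (INR M * K / INR L) with (2 * INR M * (K / INR N)) by (rewrite h2L; field; lra).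
        apply zsum_bound. intros m Hm.
        replace (_ - _)%C with ((dft s N m - gauss tau (IZR m) * dft s N 0) * w m)%C by ring.
        rewrite Cmod_mult. specialize (HK m Hm N HN). specialize (Hw m).
        pose proof (Cmod_ge_0 (dft s N m - gauss tau (IZR m) * dft s N 0)%C). nra. }
      replace (_ - _)%C with ((zsum (fun m => dft s N m * w m)%C L - zsum (fun m => dft s N m * w m)%C M)
        + (zsum (fun m => dft s N m * w m)%C M - dft s N 0 * zsum (fun m => gauss tau (IZR m) * w m)%C M))%C by ring.
      eapply Rle_trans; [apply Cmod_triangle|]. lra. }
    assert (N1 : Cmod (theta00 s - dft s N 0 * P M)%C <= 2 * B / (INR M - 1) + INR M * K / INR L).
    { unfold P. rewrite (zsum_ext _ (fun m => gauss tau (IZR m) * 1)%C) by (intros; ring).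
      apply (near (fun _ => 1)).
      - intros _. rewrite Cmod_1. lra.
      - rewrite <- gper_0_theta00.
        pose proof (dft_inversion s L 0 Hs ltac:(lia)) as I0. fold N in I0.
        replace (INR 0 / INR N) with 0 in I0 by (simpl; field; lra).
        rewrite <- I0. apply zsum_ext. intros m. rewrite Rmult_0_r, ce_0. reflexivity. }
    assert (N2 : Cmod (theta10 s - dft s N 0 * Q M)%C <= 2 * B / (INR M - 1) + INR M * K / INR L).
    { unfold Q. apply (near (fun m => ce (IZR m * / 2))).
      - intros m. rewrite Cmod_ce. lra.
      - rewrite <- gper_half_theta10.
        pose proof (dft_inversion s L L Hs ltac:(lia)) as I0. fold N in I0.
        replace (INR L / INR N) with (/ 2) in I0 by (rewrite h2L; field; lra). exact I0. }
    set (X := 2 * B / (INR M - 1)) in *. set (Y := INR M * K / INR L) in *.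
    (* In this combination [dft s N 0] drops out. *)
    replace (theta00 s * Q M - theta10 s * P M)%C with
      ((theta00 s - dft s N 0 * P M) * Q M - (theta10 s - dft s N 0 * Q M) * P M)%C by ring.
    eapply Rle_trans; [apply Cmod_sub_upper|]. rewrite !Cmod_mult.
    assert (hY : Y * (Cmod (P M) + Cmod (Q M)) <= eps).
    { apply Rlt_div_r in HL0; [|pose proof (Rmult_le_pos _ _ (Rmult_le_pos _ _ (pos_INR M) HK0) hPQ); lra].
      assert (hL0 : 0 < INR L0) by (apply lt_0_INR; auto).
      assert (/ INR L <= / INR L0) by (apply Rinv_le_contravar; auto; apply le_INR; unfold L, J; lia).
      unfold Y, Rdiv. set (W := INR M * K * (Cmod (P M) + Cmod (Q M))) in *.
      assert (hW : 0 <= W) by (unfold W; apply Rmult_le_pos; auto; apply Rmult_le_pos; auto; apply pos_INR).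
      replace (INR M * K * / INR L * (Cmod (P M) + Cmod (Q M))) with (W * / INR L) by (unfold W; ring).
      apply Rle_trans with (W * / INR L0); [apply Rmult_le_compat_l; auto | nra]. }
    pose proof (Cmod_ge_0 (P M)). pose proof (Cmod_ge_0 (Q M)).
    assert (Cmod (theta00 s - dft s N 0 * P M)%C * Cmod (Q M) <= (X + Y) * Cmod (Q M)) by (apply Rmult_le_compat_r; auto).
    assert (Cmod (theta10 s - dft s N 0 * Q M)%C * Cmod (P M) <= (X + Y) * Cmod (P M)) by (apply Rmult_le_compat_r; auto).
    lra. }
  destruct (gauss_shift_bound tau 0 Ht) as [C0 [HC HG]].
  assert (HG' : forall n, Cmod (gauss tau (IZR n)) <= C0 * exp (- 1) ^ Z.abs_nat n).
  { intros n. specialize (HG n). rewrite Rplus_0_r in HG. exact HG. }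
  assert (LP : forall eps, 0 < eps -> exists M0, forall M, (M0 <= M)%nat -> Cmod (theta00 tau - P M)%C <= eps).
  { apply (Z_series_lim _ C0 _ exp_opp_1_bounds HG'). }
  assert (LQ : forall eps, 0 < eps -> exists M0, forall M, (M0 <= M)%nat -> Cmod (theta01 tau - Q M)%C <= eps).
  { rewrite theta01_series by auto. apply (Z_series_lim _ C0 _ exp_opp_1_bounds).
    intros n. rewrite Cmod_mult, Cmod_ce, Rmult_1_r. auto. }
  apply Cmod_small_eq. intros eps He.
  set (a := theta00 s) in *. set (b := theta10 s) in *.
  set (A := Cmod a + Cmod b + Cmod (theta00 tau) + Cmod (theta01 tau) + 2).
  assert (HA : 2 <= A).
  { unfold A. pose proof (Cmod_ge_0 a). pose proof (Cmod_ge_0 b). pose proof (Cmod_ge_0 (theta00 tau)). pose proof (Cmod_ge_0 (theta01 tau)). lra. }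
  set (d := Rmin 1 (eps / (2 * A))).
  assert (Hd : 0 < d) by (unfold d; apply Rmin_case; [lra | apply Rdiv_lt_0_compat; lra]).
  assert (Hd1 : d <= 1) by apply Rmin_l.
  assert (Hd2 : d * A <= eps / 2).
  { assert (h : d <= eps / (2 * A)) by apply Rmin_r. apply Rle_div_r in h; [|lra]. lra. }
  destruct (LP d Hd) as [M1 HM1]. destruct (LQ d Hd) as [M2 HM2].
  destruct (archimed_cor1 (eps / 2 / (2 * B * A + 1))) as [M3 [HM3 HM3']].
  { apply Rdiv_lt_0_compat; [lra|]. nra. }
  set (M := (M1 + M2 + M3 + 2)%nat).
  specialize (HM1 M ltac:(unfold M; lia)). specialize (HM2 M ltac:(unfold M; lia)).
  specialize (Key M ltac:(unfold M; lia)).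
  assert (hP : Cmod (P M) <= Cmod (theta00 tau) + 1).
  { replace (P M) with (theta00 tau - (theta00 tau - P M))%C by ring.
    eapply Rle_trans; [apply Cmod_sub_upper|]. lra. }
  assert (hQ : Cmod (Q M) <= Cmod (theta01 tau) + 1).
  { replace (Q M) with (theta01 tau - (theta01 tau - Q M))%C by ring.
    eapply Rle_trans; [apply Cmod_sub_upper|]. lra. }
  assert (hm : 2 * B / (INR M - 1) * (Cmod (P M) + Cmod (Q M)) <= eps / 2).
  { assert (h3 : 0 < INR M3) by (apply lt_0_INR; auto).
    assert (h4 : INR M3 <= INR M - 1).
    { unfold M. rewrite !plus_INR. pose proof (pos_INR M1). pose proof (pos_INR M2). simpl (INR 2). lra. }
    assert (h5 : / (INR M - 1) <= / INR M3) by (apply Rinv_le_contravar; auto).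
    assert (h7 : 0 < / (INR M - 1)) by (apply Rinv_0_lt_compat; lra).
    apply Rlt_div_r in HM3; [|nra].
    apply Rle_trans with (2 * B * / (INR M - 1) * A).
    - unfold Rdiv. apply Rmult_le_compat_l; [nra|]. unfold A. pose proof (Cmod_ge_0 a). pose proof (Cmod_ge_0 b). lra.
    - apply Rle_trans with (2 * B * A * / INR M3); [|nra].
      replace (2 * B * / (INR M - 1) * A) with (2 * B * A * / (INR M - 1)) by ring.
      apply Rmult_le_compat_l; nra. }
  replace (a * theta01 tau - b * theta00 tau)%C with
    ((a * Q M - b * P M) + (a * (theta01 tau - Q M) - b * (theta00 tau - P M)))%C by ring.
  eapply Rle_trans; [apply Cmod_triangle|].
  pose proof (Cmod_sub_upper (a * (theta01 tau - Q M))%C (b * (theta00 tau - P M))%C) as h.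
  rewrite !Cmod_mult in h.
  pose proof (Cmod_ge_0 a). pose proof (Cmod_ge_0 b).
  assert (Cmod a * Cmod (theta01 tau - Q M)%C <= Cmod a * d) by (apply Rmult_le_compat_l; auto).
  assert (Cmod b * Cmod (theta00 tau - P M)%C <= Cmod b * d) by (apply Rmult_le_compat_l; auto).
  assert (d * (Cmod a + Cmod b) <= d * A).
  { apply Rmult_le_compat_l; [lra|]. unfold A. pose proof (Cmod_ge_0 (theta00 tau)). pose proof (Cmod_ge_0 (theta01 tau)). lra. }
  lra.
Qed.

Lemma lambda_inv (tau : C) : 0 < Im tau ->
  modular_lambda (- (1) / tau)%C = (1 - modular_lambda tau)%C.
Proof.
  intros Ht. rewrite one_minus_lambda by auto. unfold modular_lambda.
  pose proof (theta_inversion tau Ht) as E.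
  assert (h0 : theta00 (- (1) / tau)%C <> 0) by (apply theta00_neq_0, Im_neg_inv; auto).
  pose proof (theta00_neq_0 tau Ht) as h1.
  assert (E4 : (theta00 (- (1) / tau) ^ 4 * theta01 tau ^ 4 = theta10 (- (1) / tau) ^ 4 * theta00 tau ^ 4)%C).
  { rewrite <- !Cpow_mult_l, E. reflexivity. }
  transitivity ((theta10 (- (1) / tau) ^ 4 * theta00 tau ^ 4) / (theta00 (- (1) / tau) ^ 4 * theta00 tau ^ 4))%C.
  - field. auto.
  - rewrite <- E4. field. auto.
Qed.

(** * Functions on the modular curve of level 2 *)

Lemma H_neq_0 (tau : C) : 0 < Im tau -> tau <> 0.
Proof. intros H e. rewrite e in H. simpl in H. lra. Qed.

Lemma Cadd_zero (u v : C) : u = 0 -> (u + v)%C = 0 -> v = 0.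
Proof. intros -> <-. ring. Qed.

(** The side conditions left by [field] are the expression of [h] or its negative; the second branch
    is for the negative. *)
Ltac nonzero_from h :=
  let e := fresh in intros e; cbv beta in e; apply h;
  first [rewrite <- e; ring | apply (Cadd_zero _ _ e); ring].

Definition inv_neg (tau : C) : C := (- (1) / tau)%C.

Lemma Im_inv_neg (tau : C) : 0 < Im tau ->
  Im (inv_neg tau) = Im tau / (Re tau ^ 2 + Im tau ^ 2).
Proof.
  intros H. destruct tau as [x y]. unfold inv_neg. simpl in *. field. nra.
Qed.

Lemma inv_neg_invol (tau : C) : 0 < Im tau -> inv_neg (inv_neg tau) = tau.
Proof. intros H. unfold inv_neg. pose proof (H_neq_0 _ H). field. auto. Qed.

Lemma qhol_periodic (F : C -> C) (c : C) (tau : C) : qhol F c -> 0 < Im tau -> F (tau + 1 + 1)%C = F tau.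
Proof.
  intros HF Ht. apply Cmod_small_eq. intros eps He.
  destruct (HF (Im tau) Ht (eps / 2) ltac:(lra)) as [p Hp].
  pose proof (Hp tau ltac:(lra)) as h1. pose proof (Hp (tau + 1 + 1)%C ltac:(rewrite !Im_add_1; lra)) as h2.
  rewrite !nome_add_1 in h2. replace (- - nome tau)%C with (nome tau) in h2 by ring.
  replace (F (tau + 1 + 1) - F tau)%C with
    ((F (tau + 1 + 1) - (c + nome tau * peval p (nome tau))) - (F tau - (c + nome tau * peval p (nome tau))))%C by ring.
  eapply Rle_trans; [apply Cmod_sub_upper|]. lra.
Qed.

(** In the coordinate [- 1 / w] the map is translation by [-2]. *)
Lemma level2_inv (F : C -> C) (h : C) (w : C) : qhol (fun t => F (inv_neg t)) h -> 0 < Im w ->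
  F (w / (2 * w + 1))%C = F w.
Proof.
  intros HU Hw. pose proof (H_neq_0 w Hw) as hw.
  assert (hv : 0 < Im (inv_neg w - 2)%C).
  { pose proof (Im_neg_inv w Hw) as K. unfold inv_neg, Im in *. simpl in *. lra. }
  assert (h1 : (2 * w + 1)%C <> 0).
  { apply H_neq_0. destruct w; simpl in *; lra. }
  pose proof (qhol_periodic _ _ _ HU hv) as E. simpl in E.
  replace (inv_neg w - 2 + 1 + 1)%C with (inv_neg w) in E by ring.
  rewrite inv_neg_invol in E by auto. rewrite E. f_equal. unfold inv_neg.
  field. repeat split; auto; nonzero_from h1.
Qed.

(* The values of [F] on the images of [tau] under coset representatives of the
   principal congruence subgroup of level 2 in the modular group. *)
Definition six (F : C -> C) (tau v : C) : Prop :=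
  v = F tau \/ v = F (tau + 1)%C \/ v = F (inv_neg tau) \/ v = F (inv_neg (tau + 1))%C \/
  v = F (inv_neg tau + 1)%C \/ v = F (inv_neg (tau + 1) + 1)%C.

Lemma six_add_2 (F : C -> C) (c h : C) (tau : C) : qhol F c -> qhol (fun t => F (inv_neg t)) h -> 0 < Im tau ->
  F (tau + 1 + 1)%C = F tau /\ F (inv_neg (tau + 1 + 1)) = F (inv_neg tau) /\
  F (inv_neg (tau + 1 + 1) + 1)%C = F (inv_neg tau + 1)%C.
Proof.
  intros HF HU Ht. split; [|split].
  - eapply qhol_periodic; eauto.
  - apply (qhol_periodic _ _ _ HU Ht).
  (* For [w = - 1 / tau - 1] the point [w / (2 w + 1)] is [1 - 1 / (tau + 2)]. *)
  - assert (hv : 0 < Im (inv_neg tau - 1)%C).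
    { pose proof (Im_neg_inv tau Ht) as K. unfold inv_neg, Im in *. simpl in *. lra. }
    pose proof (qhol_periodic _ _ _ HF hv) as E.
    replace (inv_neg tau - 1 + 1 + 1)%C with (inv_neg tau + 1)%C in E by ring.
    rewrite E, <- (level2_inv F h (inv_neg tau - 1)%C HU hv). f_equal.
    unfold inv_neg. pose proof (H_neq_0 tau Ht) as h0.
    assert (h2 : (tau + 2)%C <> 0) by (apply H_neq_0; destruct tau; simpl in *; lra).
    field. repeat split; auto; nonzero_from h2.
Qed.

Lemma six_add_1 (F : C -> C) (c h : C) (tau v : C) : qhol F c -> qhol (fun t => F (inv_neg t)) h -> 0 < Im tau ->
  (six F tau v <-> six F (tau + 1)%C v).
Proof.
  intros HF HU Ht. destruct (six_add_2 F c h tau HF HU Ht) as [E1 [E2 E3]].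
  unfold six. rewrite E1, E2, E3. tauto.
Qed.

(** The inversion acts as three transpositions. Two are immediate; the one exchanging the values at
    [- 1 / (tau + 1)] and [1 - 1 / (tau + 1)] uses the periodicity of [F] in the coordinate
    [- 1 / tau]. *)
Lemma six_inv (F : C -> C) (c h : C) (tau v : C) : qhol F c -> qhol (fun t => F (inv_neg t)) h -> 0 < Im tau ->
  six F tau v -> six F (inv_neg tau) v.
Proof.
  intros HF HU Ht. pose proof (H_neq_0 tau Ht) as h0.
  assert (h1 : (tau + 1)%C <> 0) by (apply H_neq_0; rewrite Im_add_1; auto).
  assert (hm : 0 < Im (tau - 1)%C) by (destruct tau; simpl in *; lra).
  pose proof (H_neq_0 _ hm) as h2.
  unfold six. rewrite !inv_neg_invol by auto.
  assert (E6 : F (inv_neg (inv_neg tau + 1) + 1)%C = F (inv_neg (tau + 1))).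
  { pose proof (qhol_periodic _ _ _ HU hm) as E. simpl in E.
    replace (tau - 1 + 1 + 1)%C with (tau + 1)%C in E by ring. rewrite E. f_equal.
    unfold inv_neg. field. repeat split; auto; nonzero_from h2. }
  assert (E4 : F (inv_neg (inv_neg tau + 1)) = F (inv_neg (tau + 1) + 1)%C).
  { assert (hw : 0 < Im (inv_neg (inv_neg tau + 1))).
    { apply Im_neg_inv. rewrite Im_add_1. apply Im_neg_inv. auto. }
    rewrite <- (level2_inv F h _ HU hw). f_equal.
    unfold inv_neg. field. repeat split; auto; first [nonzero_from h2 | nonzero_from h1]. }
  rewrite E6, E4. tauto.
Qed.

(** A coarse reduction. In the strip [|Re| <= 1/2] a point of height below 1/2 has [|tau|^2 <= 1/2],
    so the inversion at least doubles its height; finitely many rounds suffice. *)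
Lemma modular_reduction (P : C -> Prop) :
  (forall tau, 0 < Im tau -> (P tau <-> P (tau + 1)%C)) ->
  (forall tau, 0 < Im tau -> P tau -> P (inv_neg tau)) ->
  forall tau, 0 < Im tau -> P tau ->
  exists sigma, P sigma /\ Rabs (Re sigma) <= / 2 /\ / 2 <= Im sigma.
Proof.
  intros HT HS.
  assert (Tn : forall n : nat, forall tau, 0 < Im tau -> P tau -> P (tau + INR n)%C /\ P (tau - INR n)%C).
  { induction n; intros tau Ht Hp.
    - simpl INR. replace (tau + 0)%C with tau by ring. replace (tau - 0)%C with tau by ring. auto.
    - destruct (IHn tau Ht Hp) as [h1 h2]. rewrite S_INR, RtoC_plus. split.
      + apply HT in h1; [|destruct tau; simpl in *; lra].
        replace (tau + (INR n + 1))%C with (tau + INR n + 1)%C by ring. auto.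
      + apply (HT (tau - (INR n + 1))%C); [destruct tau; simpl in *; lra|].
        replace (tau - (INR n + 1) + 1)%C with (tau - INR n)%C by ring. auto. }
  assert (Tz : forall tau, 0 < Im tau -> P tau -> exists s, P s /\ Rabs (Re s) <= / 2 /\ Im s = Im tau).
  { intros tau Ht Hp.
    assert (Hz : forall n : Z, P (tau + IZR n)%C).
    { intros n. destruct (Z_le_gt_dec 0 n).
      - replace (IZR n) with (INR (Z.to_nat n)) by (rewrite INR_IZR_INZ; f_equal; lia). apply Tn; auto.
      - replace (RtoC (IZR n)) with (- INR (Z.to_nat (- n)))%C.
        + apply Tn; auto.
        + rewrite <- RtoC_opp, INR_IZR_INZ, <- opp_IZR. do 2 f_equal. lia. }
    exists (tau + IZR (- (up (Re tau - / 2)))%Z)%C. split; [apply Hz|].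
    destruct (archimed (Re tau - / 2)) as [a1 a2].
    destruct tau as [x y]. simpl in *. rewrite opp_IZR. split; [apply Rabs_le; lra | ring]. }
  assert (K : forall n tau, 0 < Im tau -> P tau -> / 2 <= 2 ^ n * Im tau ->
    exists sigma, P sigma /\ Rabs (Re sigma) <= / 2 /\ / 2 <= Im sigma).
  { induction n; intros tau Ht Hp Hn.
    - destruct (Tz tau Ht Hp) as [s [h1 [h2 h3]]]. exists s. simpl in Hn. repeat split; auto; lra.
    - destruct (Tz tau Ht Hp) as [s [h1 [h2 h3]]].
      destruct (Rle_dec (/ 2) (Im s)) as [h|h]; [exists s; auto|].
      assert (hs : 0 < Im s) by lra.
      apply (IHn (inv_neg s)).
      + apply Im_neg_inv; auto.
      + apply HS; auto.
      + rewrite Im_inv_neg by auto.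
        assert (Re s ^ 2 <= (/ 2) ^ 2) by (rewrite <- (pow2_abs (Re s)); apply pow_incr; split; [apply Rabs_pos | auto]).
        assert (2 * Im s <= Im s / (Re s ^ 2 + Im s ^ 2)).
        { pose proof (pow2_ge_0 (Re s)). assert (0 < Im s ^ 2) by (apply pow_lt; auto).
          apply (Rle_div_r (2 * Im s)); [lra|]. nra. }
        simpl in Hn. rewrite <- h3 in Hn. pose proof (pow_lt 2 n ltac:(lra)).
        eapply Rle_trans; [apply Hn|]. rewrite (Rmult_comm 2), Rmult_assoc. apply Rmult_le_compat_l; lra. }
  intros tau Ht Hp.
  destruct (Pow_x_infinity 2 ltac:(rewrite Rabs_pos_eq; lra) (/ 2 / Im tau)) as [n Hn].
  apply (K n tau); auto. specialize (Hn n (le_n _)). rewrite Rabs_pos_eq in Hn by (apply pow_le; lra).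
  apply Rge_le in Hn. apply Rle_div_l in Hn; auto.
Qed.

(** Of the six values at a reduced point only the last two can approach the cusp 1. They are taken
    at [1 - 1 / t] with [|Re t| <= 3/2]; if [t] has height between 1/2 and [Y], that point has
    height at least [(1/2) / (4 + Y^2)] and falls under the bound at [i oo]. *)
Lemma modular_bound (F : C -> C) (c h : C) (Y b : R) : / 2 <= Y ->
  qhol F c -> qhol (fun t => F (inv_neg t)) h ->
  (forall tau, Rabs (Re tau) <= 2 -> Y <= Im tau -> Cmod (F (inv_neg tau + 1)%C) <= b) ->
  (forall tau, / 2 / (4 + Y ^ 2) <= Im tau -> Cmod (F tau) <= b) ->
  (forall tau, / 2 / (4 + Y ^ 2) <= Im tau -> Cmod (F (inv_neg tau)) <= b) ->
  forall tau, 0 < Im tau -> Cmod (F tau) <= b.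
Proof.
  intros HY HF HU Hc H1 H2 tau Ht.
  destruct (modular_reduction (fun t => six F t (F tau))) with (tau := tau) as [s [Hs [hr hi]]]; auto.
  - intros t Ht'. eapply six_add_1; eauto.
  - intros t Ht'. eapply six_inv; eauto.
  - left. auto.
  - assert (hd : / 2 / (4 + Y ^ 2) <= / 2) by (apply Rle_div_l; nra).
    assert (Hq : forall t, Rabs (Re t) <= 3 / 2 -> / 2 <= Im t -> Cmod (F (inv_neg t + 1)%C) <= b).
    { intros t hr' hi'. destruct (Rle_dec Y (Im t)) as [hY|hY]; [apply Hc; lra|].
      apply H1. rewrite Im_add_1, Im_inv_neg by lra.
      assert (Re t ^ 2 <= (3 / 2) ^ 2) by (rewrite <- (pow2_abs (Re t)); apply pow_incr; split; [apply Rabs_pos | auto]).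
      assert (Im t ^ 2 <= Y ^ 2) by (apply pow_incr; lra).
      unfold Rdiv. apply Rmult_le_compat; try lra.
      - left. apply Rinv_0_lt_compat. nra.
      - apply Rinv_le_contravar; [pose proof (pow2_ge_0 (Re t)); nra | lra]. }
    assert (hr1 : Rabs (Re (s + 1)%C) <= 3 / 2).
    { destruct s as [x y]. simpl in *. eapply Rle_trans; [apply Rabs_triang|]. rewrite Rabs_R1. lra. }
    assert (hi1 : / 2 <= Im (s + 1)%C) by (rewrite Im_add_1; auto).
    destruct Hs as [->|[->|[->|[->|[->| ->]]]]].
    + apply H1; lra.
    + apply H1; lra.
    + apply H2; lra.
    + apply H2; lra.
    + apply Hq; lra.
    + apply Hq; lra.
Qed.

(** * The maximum principle, from Harnack's inequality *)

Lemma unit_align (z : C) : exists a, Cmod a = 1 /\ (a * z = RtoC (Cmod z))%C.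
Proof.
  destruct (Ceq_dec z 0) as [->|h].
  - exists 1. rewrite Cmod_1, Cmod_0. split; [auto | ring].
  - exists (Cconj z / Cmod z)%C. pose proof (proj1 (Cmod_gt_0 z) h) as h1.
    assert (h2 : RtoC (Cmod z) <> 0) by (intros e; apply RtoC_inj in e; lra).
    split.
    + rewrite Cmod_div, Cmod_conj, Cmod_R, Rabs_pos_eq by (auto; lra). field. lra.
    + transitivity ((z * Cconj z) / Cmod z)%C; [field; auto|].
      rewrite <- Cmod2_conj. rewrite RtoC_pow. field. auto.
Qed.

Lemma Re_RtoC (x : R) : Re (RtoC x) = x.
Proof. reflexivity. Qed.

Lemma Re_minus_scal (M : R) (a z : C) : Re (M + - a * z)%C = M - Re (a * z)%C.
Proof. unfold Re; simpl; ring. Qed.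

(** Harnack's inequality for [M - a F], where the unimodular [a] turns [F tau] into its modulus. *)
Lemma qhol_modulus_bound (y : R) : 0 < y -> exists k, 0 < k <= 1 /\
  forall (F : C -> C) (c : C) (M : R), qhol F c -> (forall tau, 0 < Im tau -> Cmod (F tau) <= M) ->
  forall tau, y <= Im tau -> Cmod (F tau) <= M - k * (M - Cmod c).
Proof.
  intros Hy. destruct (qhol_harnack y Hy) as [k [Hk H]]. exists k. split; auto.
  intros F c M HF HM tau Ht. destruct (unit_align (F tau)) as [a [ha haz]].
  destruct (H (fun t => M + - a * F t)%C (M + - a * c)%C) with (tau := tau) as [K _]; auto.
  - apply qhol_plus; [apply qhol_const|]. apply (qhol_mult (fun _ => - a)%C); auto. apply qhol_const.
  - intros t Ht'. rewrite Re_minus_scal. pose proof (Re_le_Cmod_pos (a * F t)%C) as h.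
    rewrite Cmod_mult, ha in h. specialize (HM t Ht'). lra.
  - rewrite !Re_minus_scal, haz in K. pose proof (Re_le_Cmod_pos (a * c)%C) as h.
    rewrite Cmod_mult, ha in h. rewrite !Re_RtoC in K. nra.
Qed.

(** Here [a] aligns the value at the cusp: [M - Re (a c)] is at most 0, and the other half of
    Harnack's inequality carries this to [M - Re (a F)]. *)
Lemma qhol_modulus_rigid (F : C -> C) (c : C) (M : R) : qhol F c ->
  (forall tau, 0 < Im tau -> Cmod (F tau) <= M) -> M <= Cmod c ->
  forall tau, 0 < Im tau -> M <= Cmod (F tau).
Proof.
  intros HF HM Hc tau Ht. destruct (qhol_harnack (Im tau) Ht) as [k [Hk H]].
  destruct (unit_align c) as [a [ha haz]].
  destruct (H (fun t => M + - a * F t)%C (M + - a * c)%C) with (tau := tau) as [_ K]; try lra.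
  - apply qhol_plus; [apply qhol_const|]. apply (qhol_mult (fun _ => - a)%C); auto. apply qhol_const.
  - intros t Ht'. rewrite Re_minus_scal. pose proof (Re_le_Cmod_pos (a * F t)%C) as h.
    rewrite Cmod_mult, ha in h. specialize (HM t Ht'). lra.
  - rewrite !Re_minus_scal, haz in K. pose proof (Re_le_Cmod_pos (a * F tau)%C) as h.
    rewrite Cmod_mult, ha in h. rewrite !Re_RtoC in K. nra.
Qed.

(* Let [M] be the supremum of [|F|]. Off a neighbourhood of the cusp 1, where
   [F] is small, Harnack's inequality at the other two cusps forces [|F|] to
   reach [M] at one of them, hence to be constant. *)
Lemma level2_vanishing (F : C -> C) (c h : C) :
  qhol F c -> qhol (fun t => F (inv_neg t)) h ->
  (forall eps, 0 < eps -> exists Y, 0 < Y /\ forall tau, Rabs (Re tau) <= 2 -> Y <= Im tau ->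
     Cmod (F (inv_neg tau + 1)%C) <= eps) ->
  forall tau, 0 < Im tau -> F tau = 0.
Proof.
  intros HF HU Hc.
  assert (hpos : forall Y, 0 < / 2 / (4 + Y ^ 2)).
  { intros Y. apply Rdiv_lt_0_compat; [lra | pose proof (pow2_ge_0 Y); lra]. }
  assert (Hbd : exists B, 0 <= B /\ forall tau, 0 < Im tau -> Cmod (F tau) <= B).
  { destruct (Hc 1 ltac:(lra)) as [Y0 [HY0 HY1]]. set (Y := Rmax Y0 (/ 2)).
    assert (Y0 <= Y) by apply Rmax_l. assert (/ 2 <= Y) by apply Rmax_r.
    destruct (qholy_bounded _ F c (hpos Y) (HF _ (hpos Y))) as [B1 [hB1 H1]].
    destruct (qholy_bounded _ _ h (hpos Y) (HU _ (hpos Y))) as [B2 [hB2 H2]].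
    exists (1 + B1 + B2). split; [lra|]. intros tau Ht.
    apply (modular_bound F c h Y); auto.
    - intros t h1 h2. specialize (HY1 t h1 ltac:(lra)). lra.
    - intros t h1. specialize (H1 t h1). lra.
    - intros t h1. specialize (H2 t h1). lra. }
  destruct Hbd as [B [HB0 HB]].
  destruct (completeness (fun r => exists tau, 0 < Im tau /\ r = Cmod (F tau))) as [M [HM1 HM2]].
  { exists B. intros r [t [Ht ->]]. auto. }
  { exists (Cmod (F Ci)), Ci. split; [simpl; lra | reflexivity]. }
  assert (HM : forall tau, 0 < Im tau -> Cmod (F tau) <= M).
  { intros t Ht. apply HM1. exists t. auto. }
  destruct (Rle_dec M 0) as [hM|hM].
  { intros tau Ht. apply Cmod_eq_0. specialize (HM tau Ht). pose proof (Cmod_ge_0 (F tau)). lra. }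
  exfalso. apply Rnot_le_lt in hM.
  destruct (Hc (M / 2) ltac:(lra)) as [Y0 [HY0 HY1]]. set (Y := Rmax Y0 (/ 2)).
  assert (HYa : Y0 <= Y) by apply Rmax_l. assert (HYb : / 2 <= Y) by apply Rmax_r.
  assert (HMU : forall tau, 0 < Im tau -> Cmod (F (inv_neg tau)) <= M).
  { intros t Ht. apply HM, Im_neg_inv; auto. }
  set (t1 := (0, Y) : C).
  assert (ht1 : 0 < Im (inv_neg t1)) by (apply Im_neg_inv; simpl; lra).
  assert (ht2 : 0 < Im (inv_neg t1 + 1)%C) by (rewrite Im_add_1; auto).
  assert (hs : Cmod (F (inv_neg t1 + 1)%C) <= M / 2).
  { apply HY1; simpl; [rewrite Rabs_R0; lra | lra]. }
  destruct (qhol_modulus_bound _ (hpos Y)) as [k [Hk K]].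
  (* If both cusp values had modulus below [M], then [b < M] would bound [|F|], against the choice
     of [M]. *)
  set (b := Rmax (M / 2) (Rmax (M - k * (M - Cmod c)) (M - k * (M - Cmod h)))).
  assert (b1 : M / 2 <= b) by apply Rmax_l.
  assert (b2 : M - k * (M - Cmod c) <= b) by (eapply Rle_trans; [apply Rmax_l | apply Rmax_r]).
  assert (b3 : M - k * (M - Cmod h) <= b) by (eapply Rle_trans; [apply Rmax_r | apply Rmax_r]).
  assert (Mb : M <= b).
  { apply HM2. intros r [t [Ht ->]]. apply (modular_bound F c h Y); auto.
    - intros s h1 h2. specialize (HY1 s h1 ltac:(lra)). lra.
    - intros s h1. specialize (K F c M HF HM s h1). lra.
    - intros s h1. specialize (K _ h M HU HMU s h1). simpl in K. lra. }
  assert (D : M <= Cmod c \/ M <= Cmod h).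
  { destruct (Rle_dec M (Cmod c)); auto. destruct (Rle_dec M (Cmod h)); auto.
    exfalso. assert (b < M); [|lra]. unfold b. repeat apply Rmax_lub_lt; nra. }
  (* Either way [|F|] would be at least [M] at [1 - 1 / t1], near the cusp 1, where it is at most
     [M / 2]. *)
  destruct D as [D|D].
  - pose proof (qhol_modulus_rigid F c M HF HM D _ ht2). lra.
  - pose proof (qhol_modulus_rigid _ h M HU HMU D (inv_neg (inv_neg t1 + 1)) (Im_neg_inv _ ht2)) as E.
    simpl in E. rewrite inv_neg_invol in E by auto. lra.
Qed.

(** The value is [- (1 - lambda) / lambda] at [tau]; high up [|1 - lambda| >= 1/2] and
    [|q / lambda| >= 1/32], whence the 64. *)
Lemma lambda_cusp_1 : exists Y, 0 < Y /\ forall tau, Y <= Im tau ->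
  exp (PI * Im tau) / 64 <= Cmod (modular_lambda (inv_neg tau + 1)%C).
Proof.
  destruct (qholy_lim 1 _ _ (nome_div_lambda_qhol 1 ltac:(lra)) (/ 32) ltac:(lra)) as [Y1 [HY1 H1]].
  destruct (qholy_lim 1 _ _ (lambda_qhol 1 ltac:(lra)) (/ 2) ltac:(lra)) as [Y2 [HY2 H2]].
  exists (Y1 + Y2). split; [lra|]. intros tau Ht.
  specialize (H1 tau ltac:(lra)). specialize (H2 tau ltac:(lra)).
  assert (hT : 0 < Im tau) by lra.
  rewrite lambda_add_1 by (apply Im_neg_inv; auto). unfold inv_neg. rewrite lambda_inv by auto.
  replace (1 - (1 - modular_lambda tau))%C with (modular_lambda tau) by ring.
  pose proof (lambda_neq_0 tau hT) as h0. set (l := modular_lambda tau) in *.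
  rewrite Cmod_opp, Cmod_div by auto.
  assert (hl : 0 < Cmod l) by (apply Cmod_gt_0; auto).
  assert (h3 : / 2 <= Cmod (1 - l)%C).
  { pose proof (Cmod_sub_lower 1 l). rewrite Cmod_1 in H. replace (l - 0)%C with l in H2 by ring. lra. }
  assert (h4 : / 32 <= Cmod (nome tau) / Cmod l).
  { rewrite <- Cmod_div by auto. pose proof (Cmod_sub_lower (/ 16)%C (nome tau / l)%C) as K.
    rewrite Cmod_sub_sym in K. rewrite <- (RtoC_inv 16) in K by lra. rewrite Cmod_R, Rabs_pos_eq in K by lra.
    rewrite <- (RtoC_inv 16) in H1 by lra. lra. }
  apply Rle_div_r in h4; auto. rewrite Cmod_nome, exp_Ropp in h4.
  apply (Rle_div_r (exp (PI * Im tau) / 64)); auto.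
  pose proof (exp_pos (PI * Im tau)) as he. set (e := exp (PI * Im tau)) in *.
  assert (e * (/ 32 * Cmod l) <= 1).
  { apply Rle_trans with (e * / e); [apply Rmult_le_compat_l; lra | rewrite Rinv_r; lra]. }
  lra.
Qed.

(** A little o at the cusp 1, in the strip where [modular_bound] asks for control. *)
Definition cusp_1_growth (k : nat) (F : C -> C) : Prop :=
  forall eps, 0 < eps -> exists Y, 0 < Y /\ forall tau, Rabs (Re tau) <= 2 -> Y <= Im tau ->
    Cmod (F (inv_neg tau + 1)%C) <= eps * exp (PI * INR k * Im tau).

(** For [k = 0] the growth condition is vanishing at the cusp 1, and the sum is empty. The clause on
    [p O] later gives [P(0) = 0] for a series without constant term. *)
Lemma level2_polynomial (k : nat) (F : C -> C) (c h : C) :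
  qhol F c -> qhol (fun t => F (inv_neg t)) h -> cusp_1_growth k F ->
  exists p : nat -> C, ((0 < k)%nat -> p O = c) /\
    forall tau, 0 < Im tau -> F tau = csum (fun j => p j * modular_lambda tau ^ j)%C k.
Proof.
  revert F c h. induction k; intros F c h HF HU Hg.
  - exists (fun _ => c). split; [lia|]. simpl. apply (level2_vanishing F c h); auto.
    intros eps He. destruct (Hg eps He) as [Y [HY H]]. exists Y. split; auto.
    intros tau h1 h2. specialize (H tau h1 h2). simpl in H.
    rewrite Rmult_0_r, Rmult_0_l, exp_0 in H. lra.
  - destruct (qhol_div_lambda F c HF) as [d Hd].
    set (G := fun t => ((F t - c) / modular_lambda t)%C).
    destruct (IHk G d ((h - c) * 1)%C) as [p [_ Hp]]; auto.
    (* At the cusp 0 the divisor lambda becomes [1 - lambda], whose reciprocal has the value 1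
       there. *)
    + eapply qhol_ext; [|apply (qhol_mult _ _ _ _ (qhol_plus _ _ _ _ HU (qhol_const (- c)%C)) recip_one_minus_lambda_qhol)].
      intros tau Ht. unfold G. unfold inv_neg at 3. rewrite lambda_inv by auto. reflexivity.
    + intros eps He.
      (* 128 is twice the 64 of [lambda_cusp_1]: one half for [F], the other for the constant
         [c]. *)
      destruct (Hg (eps / 128) ltac:(lra)) as [Y1 [HY1 H1]]. destruct lambda_cusp_1 as [Y2 [HY2 H2]].
      exists (Y1 + Y2 + 128 * Cmod c / eps).
      assert (hY3 : 0 <= 128 * Cmod c / eps).
      { apply Rdiv_le_0_compat; auto. pose proof (Cmod_ge_0 c). lra. }
      split; [lra|]. intros tau hr hi.
      specialize (H1 tau hr ltac:(lra)). specialize (H2 tau ltac:(lra)). unfold G.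
      assert (hz : 0 < Im (inv_neg tau + 1)%C) by (rewrite Im_add_1; apply Im_neg_inv; lra).
      pose proof (lambda_neq_0 _ hz) as h0.
      rewrite Cmod_div by auto. apply Rle_div_l; [apply Cmod_gt_0; auto|].
      set (l := Cmod (modular_lambda (inv_neg tau + 1))) in *.
      eapply Rle_trans; [apply Cmod_sub_upper|].
      assert (hc : 128 * Cmod c <= eps * exp (PI * Im tau)).
      { assert (h3 : 128 * Cmod c / eps <= Im tau) by lra. apply Rle_div_l in h3; auto.
        assert (Im tau <= exp (PI * Im tau)).
        { pose proof (exp_ineq1_le (PI * Im tau)). pose proof PI2_1. nra. }
        nra. }
      assert (E : exp (PI * INR (S k) * Im tau) = exp (PI * INR k * Im tau) * exp (PI * Im tau)).
      { rewrite S_INR, <- exp_plus. f_equal. ring. }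
      rewrite E in H1.
      assert (e1 : 1 <= exp (PI * INR k * Im tau)).
      { rewrite <- exp_0. apply exp_le_compat. pose proof PI_RGT_0. pose proof (pos_INR k).
        apply Rmult_le_pos; [nra | lra]. }
      set (X := exp (PI * INR k * Im tau)) in *. set (e := exp (PI * Im tau)) in *.
      assert (he : 0 < e) by apply exp_pos.
      assert (eps * X * (e / 64) <= eps * X * l) by (apply Rmult_le_compat_l; nra).
      assert (eps * e * 1 <= eps * e * X) by (apply Rmult_le_compat_l; nra).
      lra.
    + exists (fun j => match j with O => c | S j => p j end). split; auto.
      intros tau Ht. rewrite csum_shift.
      rewrite (csum_ext _ (fun j => modular_lambda tau * (p j * modular_lambda tau ^ j))%C) by (intros; simpl; ring).
      rewrite csum_scal, <- Hp by auto. unfold G. simpl. pose proof (lambda_neq_0 tau Ht). field. auto.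
Qed.

(** * Growth at the cusp 1 *)

Fixpoint rsum (f : nat -> R) (n : nat) : R :=
  match n with O => 0 | S n => rsum f n + f n end.

Lemma rsum_le (f g : nat -> R) (n : nat) : (forall i, (i < n)%nat -> f i <= g i) -> rsum f n <= rsum g n.
Proof.
  induction n; intros H; simpl; [lra|].
  pose proof (IHn ltac:(intros; apply H; lia)). pose proof (H n ltac:(lia)). lra.
Qed.

Lemma rsum_plus (f g : nat -> R) (n : nat) : rsum (fun i => f i + g i) n = rsum f n + rsum g n.
Proof. induction n; simpl; [ring | rewrite IHn; ring]. Qed.

Lemma rsum_scal (c : R) (f : nat -> R) (n : nat) : rsum (fun i => c * f i) n = c * rsum f n.
Proof. induction n; simpl; [ring | rewrite IHn; ring]. Qed.

Lemma Cmod_csum_le (u : nat -> C) (n : nat) : Cmod (csum u n) <= rsum (fun i => Cmod (u i)) n.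
Proof.
  induction n; simpl; [rewrite Cmod_0; lra|].
  eapply Rle_trans; [apply Cmod_triangle|]. lra.
Qed.

Lemma C_is_series_bound (u : nat -> C) (s : C) (B : R) : C_is_series u s ->
  (forall n, rsum (fun i => Cmod (u i)) n <= B) -> Cmod s <= B.
Proof.
  intros H HB. apply le_epsilon. intros eps He.
  destruct (proj1 (C_is_series_spec _ _) H eps He) as [N HN]. specialize (HN N (le_n _)).
  pose proof (Cmod_csum_le u N). specialize (HB N).
  replace s with (csum u N - (csum u N - s))%C by ring.
  eapply Rle_trans; [apply Cmod_sub_upper|]. lra.
Qed.

Lemma rsum_inv_sqr (n : nat) : rsum (fun i => / (INR (S i)) ^ 2) n <= 2.
Proof.
  assert (H : forall n, rsum (fun i => / (INR (S i)) ^ 2) (S n) <= 2 - / INR (S n)).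
  { clear n. induction n.
    - simpl. lra.
    - change (rsum (fun i => / INR (S i) ^ 2) (S (S n))) with (rsum (fun i => / INR (S i) ^ 2) (S n) + / INR (S (S n)) ^ 2).
      assert (hx : 0 < INR (S n)) by (apply lt_0_INR; lia).
      rewrite (S_INR (S n)). set (x := INR (S n)) in *.
      assert (/ (x + 1) ^ 2 <= / x - / (x + 1)); [|lra].
      replace (/ x - / (x + 1)) with (/ (x * (x + 1))) by (field; lra).
      apply Rinv_le_contravar; nra. }
  destruct n; [simpl; lra|]. specialize (H n).
  assert (0 < / INR (S n)) by (apply Rinv_0_lt_compat, lt_0_INR; lia). lra.
Qed.

Lemma exp_lower_4 (v : R) : 0 <= v -> v ^ 4 <= 256 * exp v.
Proof.
  intros Hv. pose proof (exp_ineq1_le (v / 4)) as h.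
  assert (E : exp v = exp (v / 4) ^ 4).
  { simpl. rewrite Rmult_1_r, <- !exp_plus. f_equal. field. }
  rewrite E. replace (256 * exp (v / 4) ^ 4) with ((4 * exp (v / 4)) ^ 4) by ring.
  apply pow_incr. lra.
Qed.

(** Since the interval has length at most 1, the intermediate point satisfies
    [1 + c^2 <= 3 (1 + b^2)]. Telescoping increments of [atan] play the part of the integral of
    [1 / (1 + x^2)]. *)
Lemma atan_increment (a b : R) : a <= b -> b - a <= 1 -> (b - a) / (3 * (1 + b ^ 2)) <= atan b - atan a.
Proof.
  intros Hab H1. destruct Hab as [Hab| ->]; [|unfold Rdiv; lra].
  destruct (MVT_gen atan a b (fun x => / (1 + x ^ 2))) as [c [Hc E]].
  - intros x _. apply is_derive_Reals. apply derivable_pt_lim_atan.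
  - intros x _. apply derivable_continuous_pt, derivable_pt_atan.
  - rewrite Rmin_left, Rmax_right in Hc by lra. rewrite E. unfold Rdiv.
    rewrite (Rmult_comm (/ _)). apply Rmult_le_compat_l; [lra|].
    pose proof (pow2_ge_0 b). pose proof (pow2_ge_0 c).
    apply Rinv_le_contravar; [lra|].
    assert (c ^ 2 <= 2 * b ^ 2 + 2 * (c - b) ^ 2) by (pose proof (pow2_ge_0 (2 * b - c)); lra).
    assert ((c - b) ^ 2 <= 1) by (simpl; nra). lra.
Qed.

Lemma sqrt_step (n : nat) : / (2 * sqrt (INR (S n))) <= sqrt (INR (S n)) - sqrt (INR n) <= 1.
Proof.
  rewrite S_INR. set (x := INR n). assert (hx : 0 <= x) by apply pos_INR.
  set (v := sqrt (x + 1)). set (u := sqrt x).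
  assert (hv : v * v = x + 1) by (apply sqrt_sqrt; lra). assert (hu : u * u = x) by (apply sqrt_sqrt; lra).
  assert (0 <= u) by apply sqrt_pos. assert (0 <= v) by apply sqrt_pos.
  assert (1 <= v) by nra. split; [|nra].
  assert (h : / (2 * v) * (2 * v) = 1) by (apply Rinv_l; lra).
  apply Rmult_le_reg_r with (2 * v); [lra|]. rewrite h. nra.
Qed.

(* With [v = sqrt n] and [m = sqrt k / t], the exponent is
   [pi k / t - pi t (v - m)^2]. Terms with [v < m / 2] are dominated by [1 / n^2];
   the others by increments of [atan (sqrt t (v - m))]. *)
Lemma growth_term (k t : R) (i : nat) : 1 <= k -> 0 < t <= 1 ->
  Rpower (INR (S i)) (- (3 / 4)) * exp (2 * PI * sqrt (k * INR (S i))) * exp (- (PI * t * INR (S i)))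
  <= exp (PI * k / t) * (256 * / INR (S i) ^ 2 +
      12 * (atan (sqrt t * (sqrt (INR (S i)) - sqrt k / t)) - atan (sqrt t * (sqrt (INR i) - sqrt k / t)))).
Proof.
  intros Hk Ht. set (x := INR (S i)). set (v := sqrt x). set (m := sqrt k / t). set (s := sqrt t).
  assert (hx : 1 <= x) by (apply (le_INR 1); lia).
  assert (hv2 : v * v = x) by (apply sqrt_sqrt; lra).
  assert (hv0 : 0 <= v) by apply sqrt_pos. assert (hv : 1 <= v) by nra.
  assert (hs2 : s * s = t) by (apply sqrt_sqrt; lra).
  assert (hs0 : 0 <= s) by apply sqrt_pos. assert (hk2 : sqrt k * sqrt k = k) by (apply sqrt_sqrt; lra).
  assert (hk0 : 0 <= sqrt k) by apply sqrt_pos. assert (hk1 : 1 <= sqrt k) by nra.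
  assert (hpi : 2 <= PI) by (pose proof PI2_1; lra).
  assert (hm : m * t = sqrt k) by (unfold m; field; lra).
  assert (E : Rpower x (- (3 / 4)) * exp (2 * PI * sqrt (k * x)) * exp (- (PI * t * x))
     = exp (PI * k / t) * (Rpower x (- (3 / 4)) * exp (- (PI * t * (v - m) ^ 2)))).
  { rewrite Rmult_assoc, <- exp_plus.
    replace (2 * PI * sqrt (k * x) + - (PI * t * x)) with (PI * k / t + - (PI * t * (v - m) ^ 2)).
    - rewrite exp_plus. ring.
    - rewrite sqrt_mult by lra. fold v. rewrite <- hv2.
      replace (PI * k / t) with (PI * t * (m * m)) by (transitivity (PI * (sqrt k * sqrt k) / t); [unfold m; field; lra | rewrite hk2; reflexivity]).
      rewrite <- hm. ring. }
  rewrite E. apply Rmult_le_compat_l; [left; apply exp_pos|].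
  set (u := sqrt (INR i)).
  assert (hst := sqrt_step i). fold x v u in hst.
  assert (hsm : s * (v - m) - s * (u - m) = s * (v - u)) by ring.
  assert (hinc := atan_increment (s * (u - m)) (s * (v - m))).
  rewrite hsm in hinc.
  assert (hu' : 0 <= v - u) by (assert (0 < / (2 * v)) by (apply Rinv_0_lt_compat; lra); lra).
  specialize (hinc ltac:(nra) ltac:(nra)).
  set (T := atan (s * (v - m)) - atan (s * (u - m))) in *.
  (* The weight splits into [1 / v], comparable to a step of the square root, and [1 / sqrt v],
     which near the peak is of the order of [sqrt t]. *)
  assert (hRp : Rpower x (- (3 / 4)) = / (v * sqrt v)).
  { assert (hv' : sqrt v = Rpower x (/ 4)).
    { rewrite <- Rpower_sqrt by lra. unfold v. rewrite <- Rpower_sqrt by lra. rewrite Rpower_mult. f_equal. field. }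
    rewrite hv'. unfold v. rewrite <- (Rpower_sqrt x) by lra. rewrite <- Rpower_plus.
    rewrite Rpower_Ropp. do 2 f_equal. field. }
  rewrite hRp.
  assert (hw2 : sqrt v * sqrt v = v) by (apply sqrt_sqrt; lra).
  assert (hw0 : 0 <= sqrt v) by apply sqrt_pos. set (w := sqrt v) in *. assert (hw : 1 <= w) by nra.
  assert (hT0 : 0 <= T).
  { eapply Rle_trans; [|apply hinc]. apply Rdiv_le_0_compat; [nra|]. pose proof (pow2_ge_0 (s * (v - m))). lra. }
  assert (hi2 : 0 < / x ^ 2) by (apply Rinv_0_lt_compat; nra).
  assert (hvw : / (v * w) <= 1) by (rewrite <- Rinv_1; apply Rinv_le_contravar; nra).
  destruct (Rlt_dec v (m / 2)) as [hc|hc].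
  - assert (A : exp (- (PI * t * (v - m) ^ 2)) <= 256 * / x ^ 2).
    (* Here [(v - m)^2 >= m^2 / 4] and [t m = sqrt k >= 1], so the Gaussian is at most [exp (- v)],
       hence at most [256 / v^4]. *)
    { assert (B : v <= PI * t * (v - m) ^ 2).
      { assert (PI * t * (m / 2) ^ 2 <= PI * t * (v - m) ^ 2) by (apply Rmult_le_compat_l; nra).
        assert (PI * t * (m / 2) ^ 2 = PI * (sqrt k * m) / 4) by (rewrite <- hm; field).
        assert (m <= sqrt k * m) by nra. nra. }
      apply Rle_trans with (exp (- v)); [apply exp_le_compat; lra|].
      pose proof (exp_lower_4 v hv0) as K. rewrite exp_Ropp.
      replace (x ^ 2) with (v ^ 4) by (rewrite <- hv2; ring).
      assert (hv4 : 0 < v ^ 4) by (apply pow_lt; lra). pose proof (exp_pos v).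
      apply Rmult_le_reg_r with (exp v); auto. rewrite Rinv_l by lra.
      apply Rmult_le_reg_r with (v ^ 4); auto.
      replace (256 * / v ^ 4 * exp v * v ^ 4) with (256 * exp v) by (field; lra). lra. }
    assert (0 < / (v * w)) by (apply Rinv_0_lt_compat; nra). nra.
  - apply Rnot_lt_le in hc.
    assert (A : exp (- (PI * t * (v - m) ^ 2)) <= / (1 + (s * (v - m)) ^ 2)).
    { rewrite exp_Ropp. apply Rinv_le_contravar; [pose proof (pow2_ge_0 (s * (v - m))); lra|].
      pose proof (exp_ineq1_le (PI * t * (v - m) ^ 2)).
      replace ((s * (v - m)) ^ 2) with (t * (v - m) ^ 2) by (rewrite <- hs2; ring).
      pose proof (pow2_ge_0 (v - m)). assert (0 <= t * (v - m) ^ 2) by nra. nra. }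
    (* From [v >= m / 2] and [m t >= 1] follows [(s w)^2 = t v >= 1/2]. *)
    assert (D : / w <= 2 * s).
    { assert (1 <= 2 * (s * w)). { assert (0 <= s * w) by nra. nra. }
      apply Rmult_le_reg_r with w; [lra|]. rewrite Rinv_l by lra. lra. }
    set (q := 1 + (s * (v - m)) ^ 2) in *.
    assert (hq : 1 <= q) by (unfold q; pose proof (pow2_ge_0 (s * (v - m))); lra).
    assert (hq' : 0 < / q) by (apply Rinv_0_lt_compat; lra).
    assert (F : / v * s * / q <= 6 * T).
    { assert (s * (v - u) / (3 * q) = s * / q * (v - u) * / 3) by (field; lra).
      assert (/ (2 * v) = / v * / 2) by (field; lra).
      assert (s * / q * (/ v * / 2) <= s * / q * (v - u)) by (apply Rmult_le_compat_l; nra). nra. }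
    assert (hv' : 0 < / v) by (apply Rinv_0_lt_compat; lra).
    rewrite Rinv_mult.
    assert (G : / v * / w * exp (- (PI * t * (v - m) ^ 2)) <= / v * (2 * s) * / q).
    { apply Rmult_le_compat; auto.
      - left. apply Rmult_lt_0_compat; auto. apply Rinv_0_lt_compat; lra.
      - left; apply exp_pos.
      - apply Rmult_le_compat_l; lra. }
    nra.
Qed.

(** The inverse squares contribute at most [256 * 2] and the telescoping [atan] at most [12 pi],
    both independently of [t]. *)
Lemma growth_sum (k t : R) (N : nat) : 1 <= k -> 0 < t <= 1 ->
  rsum (fun i => Rpower (INR (S i)) (- (3 / 4)) * exp (2 * PI * sqrt (k * INR (S i))) * exp (- (PI * t * INR (S i)))) N
  <= 600 * exp (PI * k / t).
Proof.
  intros Hk Ht. set (T := fun i => atan (sqrt t * (sqrt (INR i) - sqrt k / t))).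
  eapply Rle_trans; [apply rsum_le; intros i _; apply growth_term; auto|].
  rewrite rsum_scal, rsum_plus, !rsum_scal.
  assert (Tel : rsum (fun i => T (S i) - T i) N = T N - T O).
  { induction N; [simpl; ring|]. change (rsum (fun i => T (S i) - T i) (S N)) with (rsum (fun i => T (S i) - T i) N + (T (S N) - T N)).
    rewrite IHN. ring. }
  unfold T in Tel. rewrite Tel. pose proof (rsum_inv_sqr N).
  pose proof (atan_bound (sqrt t * (sqrt (INR N) - sqrt k / t))). pose proof (atan_bound (sqrt t * (sqrt (INR 0) - sqrt k / t))).
  pose proof PI_4. pose proof (exp_pos (PI * k / t)).
  rewrite (Rmult_comm 600). apply Rmult_le_compat_l; lra.
Qed.

Lemma rsum_nonneg (f : nat -> R) (n : nat) : (forall i, 0 <= f i) -> 0 <= rsum f n.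
Proof. intros H. induction n; simpl; [lra | specialize (H n); lra]. Qed.

Lemma rsum_split_bound (f g : nat -> R) (N : nat) : (forall i, 0 <= f i) -> (forall i, 0 <= g i) ->
  (forall i, (N <= i)%nat -> f i <= g i) -> forall n, rsum f n <= rsum f N + rsum g n.
Proof.
  intros Hf Hg H n. destruct (Nat.le_gt_cases n N) as [h|h].
  - pose proof (rsum_nonneg g n Hg). assert (rsum f n <= rsum f N); [|lra].
    clear H; induction h; [lra|]. simpl. specialize (Hf m). lra.
  - induction h; simpl.
    + specialize (H N (le_n _)). pose proof (rsum_nonneg g N Hg). lra.
    + specialize (H m ltac:(lia)). lra.
Qed.

(** The early terms sum to at most [D], and [D <= eps / (2 t)] is absorbed by
    [1 / t <= exp (pi k / t)]. The 1200 in the proof is twice the 600 of [growth_sum]. *)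
Lemma series_growth (a : nat -> C) (k : R) : 1 <= k ->
  (forall eps, 0 < eps -> exists N, forall n, (N <= n)%nat ->
     Cmod (a n) <= eps * (Rpower (INR n) (- (3 / 4)) * exp (2 * PI * sqrt (k * INR n)))) ->
  forall eps, 0 < eps -> exists t0, 0 < t0 <= 1 /\ forall t, 0 < t <= t0 -> forall n,
    rsum (fun i => Cmod (a (S i)) * exp (- (PI * t * INR (S i)))) n <= eps * exp (PI * k / t).
Proof.
  intros Hk Ha eps He. pose proof PI2_1 as hpi.
  destruct (Ha (eps / 1200) ltac:(lra)) as [N HN].
  set (D := rsum (fun i => Cmod (a (S i))) N).
  assert (HD : 0 <= D) by (apply rsum_nonneg; intros; apply Cmod_ge_0).
  exists (Rmin 1 (eps / (2 * (D + 1)))).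
  assert (Ht0 : 0 < eps / (2 * (D + 1))) by (apply Rdiv_lt_0_compat; lra).
  split; [split; [apply Rmin_case; lra | apply Rmin_l]|].
  intros t [Ht Ht1] n.
  assert (Ht2 : t <= 1) by (eapply Rle_trans; [exact Ht1 | apply Rmin_l]).
  assert (Ht3 : t <= eps / (2 * (D + 1))) by (eapply Rle_trans; [exact Ht1 | apply Rmin_r]).
  set (g := fun i => Rpower (INR (S i)) (- (3 / 4)) * exp (2 * PI * sqrt (k * INR (S i))) * exp (- (PI * t * INR (S i)))).
  assert (hg : forall i, 0 < g i).
  { intros i. unfold g, Rpower. pose proof (exp_pos (- (3 / 4) * ln (INR (S i)))). pose proof (exp_pos (2 * PI * sqrt (k * INR (S i)))).
    pose proof (exp_pos (- (PI * t * INR (S i)))). repeat apply Rmult_lt_0_compat; auto. }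
  eapply Rle_trans; [apply (rsum_split_bound _ (fun i => eps / 1200 * g i) N)|].
  - intros i. apply Rmult_le_pos; [apply Cmod_ge_0 | left; apply exp_pos].
  - intros i. specialize (hg i). nra.
  - intros i Hi. specialize (HN (S i) ltac:(lia)). unfold g.
    rewrite <- !Rmult_assoc. rewrite <- Rmult_assoc in HN. apply Rmult_le_compat_r; [left; apply exp_pos | exact HN].
  - rewrite rsum_scal. pose proof (growth_sum k t n Hk (conj Ht Ht2)) as K. fold g in K.
    assert (D1 : rsum (fun i => Cmod (a (S i)) * exp (- (PI * t * INR (S i)))) N <= D).
    { apply rsum_le. intros i _. rewrite <- (Rmult_1_r (Cmod (a (S i)))) at 2.
      apply Rmult_le_compat_l; [apply Cmod_ge_0|]. rewrite <- exp_0. apply exp_le_compat.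
      pose proof (pos_INR (S i)). assert (0 <= PI * t) by nra. nra. }
    assert (D2 : D <= eps / 2 * exp (PI * k / t)).
    { apply Rle_div_r in Ht3; [|lra].
      pose proof (exp_ineq1_le (PI * k / t)).
      assert (/ t <= exp (PI * k / t)).
      { assert (/ t <= PI * k / t).
        { unfold Rdiv. rewrite <- (Rmult_1_l (/ t)) at 1. apply Rmult_le_compat_r; [left; apply Rinv_0_lt_compat; auto | nra]. }
        lra. }
      apply Rle_trans with (eps / 2 * / t); [|apply Rmult_le_compat_l; lra].
      apply Rmult_le_reg_r with t; auto. rewrite Rmult_assoc, Rinv_l by lra. nra. }
    nra.
Qed.

(** * One-sided series, and separation of the two sides *)

(** The bound is for all [n], not only eventually, so that one geometric majorant covers the whole
    series. *)
Definition subexp (u : nat -> C) : Prop :=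
  forall eps, 0 < eps -> exists M, 0 <= M /\ forall n, Cmod (u n) <= M * exp (eps * INR n).

Lemma subexp_of_eventually (u : nat -> C) :
  (forall eps, 0 < eps -> exists M N, forall n, (N <= n)%nat -> Cmod (u n) <= M * exp (eps * INR n)) ->
  subexp u.
Proof.
  intros H eps He. destruct (H eps He) as [M [N HN]].
  pose proof (rsum_nonneg (fun i => Cmod (u i)) N ltac:(intros; apply Cmod_ge_0)) as h0.
  pose proof (Rabs_pos M) as hM. pose proof (RRle_abs M) as hM'.
  exists (Rabs M + rsum (fun i => Cmod (u i)) N). split; [lra|]. intros n.
  assert (e1 : 1 <= exp (eps * INR n)).
  { rewrite <- exp_0. apply exp_le_compat. pose proof (pos_INR n). nra. }
  destruct (Nat.lt_ge_cases n N) as [h|h].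
  - assert (Cmod (u n) <= rsum (fun i => Cmod (u i)) N).
    { clear - h. induction N; [lia|]. simpl. destruct (Nat.eq_dec n N) as [->|hn].
      - pose proof (rsum_nonneg (fun i => Cmod (u i)) N ltac:(intros; apply Cmod_ge_0)). lra.
      - specialize (IHN ltac:(lia)). pose proof (Cmod_ge_0 (u N)). lra. }
    nra.
  - specialize (HN n h). nra.
Qed.

Definition qterm (u : nat -> C) (tau : C) (n : nat) : C := (u (S n) * Cexp (Ci * PI * INR (S n) * tau))%C.

Definition qseries (u : nat -> C) (tau : C) : C := C_Series (qterm u tau).

Lemma exp_INR_pow (x : R) (n : nat) : exp (x * INR n) = exp x ^ n.
Proof.
  induction n; [simpl; rewrite Rmult_0_r; apply exp_0|].
  rewrite S_INR. simpl. rewrite <- IHn, <- exp_plus. f_equal. ring.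
Qed.

Lemma exp_neg_lt_1 (x : R) : 0 < x -> 0 <= exp (- x) < 1.
Proof. intros H. split; [left; apply exp_pos|]. rewrite <- exp_0. apply exp_increasing. lra. Qed.

Lemma Cmod_qterm (u : nat -> C) (tau : C) (n : nat) :
  Cmod (qterm u tau n) = Cmod (u (S n)) * exp (- (PI * Im tau * INR (S n))).
Proof.
  unfold qterm. rewrite Cmod_mult, Cmod_Cexp. do 2 f_equal. destruct tau; simpl; ring.
Qed.

(** The spare weight in [w] absorbs the factors [n] and [n^2] that differentiation brings in. *)
Lemma qterm_weighted_bound (u : nat -> C) (y w : R) : subexp u -> 0 < w < y ->
  exists C0, 0 <= C0 /\ forall n,
    Cmod (u (S n)) * exp (- (PI * y * INR (S n))) * exp (PI * w * INR (S n)) <= C0 * exp (- (PI * ((y - w) / 2))) ^ n.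
Proof.
  intros Hu Hw. pose proof PI_RGT_0 as hpi. set (e := PI * ((y - w) / 2)).
  assert (He : 0 < e) by (unfold e; nra).
  destruct (Hu e He) as [M [HM H]]. exists M. split; auto. intros n. specialize (H (S n)).
  rewrite Rmult_assoc, <- exp_plus.
  apply Rle_trans with (M * exp (e * INR (S n)) * exp (- (PI * y * INR (S n)) + PI * w * INR (S n))).
  - apply Rmult_le_compat_r; [left; apply exp_pos | auto].
  - rewrite Rmult_assoc, <- exp_plus, <- exp_INR_pow. apply Rmult_le_compat_l; auto. apply exp_le_compat.
    replace (e * INR (S n) + (- (PI * y * INR (S n)) + PI * w * INR (S n))) with (- e * INR (S n)) by (unfold e; field).
    rewrite S_INR. lra.
Qed.

Lemma qterm_bound (u : nat -> C) (y : R) : subexp u -> 0 < y ->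
  exists C0 r, 0 <= r < 1 /\ forall n, Cmod (u (S n)) * exp (- (PI * y * INR (S n))) <= C0 * r ^ n.
Proof.
  intros Hu Hy. pose proof PI_RGT_0 as hpi.
  destruct (qterm_weighted_bound u y (y / 2) Hu ltac:(lra)) as [C0 [HC H]].
  exists C0, (exp (- (PI * ((y - y / 2) / 2)))). split; [apply exp_neg_lt_1; nra|].
  intros n. eapply Rle_trans; [|apply H].
  rewrite <- (Rmult_1_r (_ * _)) at 1. apply Rmult_le_compat_l.
  - apply Rmult_le_pos; [apply Cmod_ge_0 | left; apply exp_pos].
  - rewrite <- exp_0 at 1. apply exp_le_compat. pose proof (pos_INR (S n)).
    apply Rmult_le_pos; [nra | auto].
Qed.

Lemma qseries_is_series (u : nat -> C) (tau : C) : subexp u -> 0 < Im tau ->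
  C_is_series (qterm u tau) (qseries u tau).
Proof.
  intros Hu Ht. destruct (qterm_bound u (Im tau) Hu Ht) as [C0 [r [Hr H]]].
  destruct (geom_has_sum (qterm u tau) C0 r Hr) as [s [_ Hs]].
  { intros n. rewrite Cmod_qterm. apply H. }
  pose proof (geom_is_series _ _ _ _ Hr Hs) as h. unfold qseries. rewrite (C_Series_eq _ _ h). exact h.
Qed.

Lemma qseries_qhol (u : nat -> C) : subexp u -> qhol (qseries u) 0.
Proof.
  intros Hu. replace (RtoC 0) with (u 1%nat * 0 ^ 1)%C by (simpl; ring).
  apply (qhol_lacunary (fun n => u (S n)) S).
  - intros; lia.
  - intros y Hy. apply qterm_bound; auto.
  - intros tau Ht. pose proof (qseries_is_series u tau Hu Ht) as H.
    apply C_is_series_spec. intros eps He. destruct (proj1 (C_is_series_spec _ _) H eps He) as [N HN].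
    exists N. intros n Hn. rewrite (csum_ext _ (qterm u tau)); [apply HN; auto|].
    intros i _. unfold qterm. rewrite nome_pow. reflexivity.
Qed.

Lemma C_is_series_plus (u v : nat -> C) (s t : C) : C_is_series u s -> C_is_series v t ->
  C_is_series (fun n => u n + v n)%C (s + t)%C.
Proof. intros Hu Hv. exact (is_series_plus u v s t Hu Hv). Qed.

Lemma C_is_series_scal (c : C) (u : nat -> C) (s : C) : C_is_series u s ->
  C_is_series (fun n => c * u n)%C (c * s)%C.
Proof. intros Hu. exact (is_series_scal c u s Hu). Qed.

Lemma C_is_series_ext (u v : nat -> C) (s : C) : (forall n, u n = v n) -> C_is_series u s -> C_is_series v s.
Proof. intros E Hu. exact (is_series_ext u v s E Hu). Qed.

(** * Complex differentiability *)

Definition cdiff (F : C -> C) (z d : C) : Prop :=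
  forall eps, 0 < eps -> exists delta, 0 < delta /\
    forall h, Cmod h <= delta -> Cmod (F (z + h) - F z - h * d)%C <= eps * Cmod h.

Lemma exp_ge_sqr (u : R) : 0 <= u -> u ^ 2 <= 4 * exp u.
Proof.
  intros Hu. pose proof (exp_ineq1_le (u / 2)) as h.
  assert (E : exp u = exp (u / 2) ^ 2).
  { simpl. rewrite Rmult_1_r, <- exp_plus. f_equal. field. }
  rewrite E. replace (4 * exp (u / 2) ^ 2) with ((2 * exp (u / 2)) ^ 2) by ring. apply pow_incr. lra.
Qed.

Lemma geom_C_is_series_bound (u : nat -> C) (s : C) (C0 r : R) : 0 <= r < 1 ->
  (forall n, Cmod (u n) <= C0 * r ^ n) -> C_is_series u s -> Cmod s <= C0 / (1 - r).
Proof.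
  intros Hr Hu Hs. destruct (geom_has_sum u C0 r Hr Hu) as [s' [_ Hs']].
  rewrite (C_is_series_unique _ _ _ Hs (geom_is_series _ _ _ _ Hr Hs')).
  specialize (Hs' O). simpl in Hs'. replace (s' - 0)%C with s' in Hs' by ring. unfold Rdiv in *.
  rewrite Rmult_1_l in Hs'. exact Hs'.
Qed.

(** Termwise differentiation: the remainder of a term is at most [4 (pi n |h|)^2 exp (pi n |h|)]
    times its modulus. *)
Lemma qseries_cdiff (u : nat -> C) (tau : C) : subexp u -> 0 < Im tau ->
  exists d, cdiff (qseries u) tau d.
Proof.
  intros Hu Ht. pose proof PI_RGT_0 as hpi. set (y := Im tau) in *.
  (* The weight [exp (pi y n / 2)] is spent in two halves: one on [n^2], by [Hx], the other on
     [exp (pi n |h|)] with [|h| <= y / 4]. *)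
  destruct (qterm_weighted_bound u y (y / 2) Hu ltac:(lra)) as [C0 [HC H]].
  set (r := exp (- (PI * ((y - y / 2) / 2)))) in H.
  assert (Hr : 0 <= r < 1) by (apply exp_neg_lt_1; nra).
  assert (Hx : forall n, (PI * INR (S n)) ^ 2 <= 64 / y ^ 2 * exp (PI * (y / 4) * INR (S n))).
  { intros n. assert (hn : 1 <= INR (S n)) by (apply (le_INR 1); lia).
    pose proof (exp_ge_sqr (PI * (y / 4) * INR (S n)) ltac:(apply Rmult_le_pos; nra)) as K.
    replace ((PI * INR (S n)) ^ 2) with (16 / y ^ 2 * (PI * (y / 4) * INR (S n)) ^ 2) by (field; lra).
    replace (64 / y ^ 2 * exp (PI * (y / 4) * INR (S n))) with (16 / y ^ 2 * (4 * exp (PI * (y / 4) * INR (S n)))) by (field; lra).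
    apply Rmult_le_compat_l; auto. apply Rdiv_le_0_compat; [lra | apply pow_lt; auto]. }
  assert (Hsplit : forall n, exp (PI * (y / 2) * INR (S n)) = exp (PI * (y / 4) * INR (S n)) * exp (PI * (y / 4) * INR (S n))).
  { intros n. rewrite <- exp_plus. f_equal. field. }
  set (v := fun n => (Ci * PI * INR (S n) * qterm u tau n)%C).
  assert (Hv : forall n, Cmod (v n) <= (64 / y ^ 2 * C0) * r ^ n).
  { intros n. unfold v. rewrite !Cmod_mult, Cmod_Ci, !Cmod_R, Cmod_qterm. fold y.
    assert (hn : 1 <= INR (S n)) by (apply (le_INR 1); lia).
    rewrite !Rabs_pos_eq by lra.
    specialize (H n). specialize (Hx n).
    assert (h1 : PI * INR (S n) <= 64 / y ^ 2 * exp (PI * (y / 2) * INR (S n))).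
    { rewrite Hsplit. assert (1 <= exp (PI * (y / 4) * INR (S n))).
      { rewrite <- exp_0. apply exp_le_compat. apply Rmult_le_pos; nra. }
      assert (1 <= PI) by (pose proof PI2_1; lra).
      assert (1 <= PI * INR (S n)) by nra.
      assert (0 <= 64 / y ^ 2) by (apply Rdiv_le_0_compat; [lra | apply pow_lt; auto]).
      rewrite <- Rmult_assoc. nra. }
    set (q := Cmod (u (S n)) * exp (- (PI * y * INR (S n)))) in *.
    assert (0 <= q) by (apply Rmult_le_pos; [apply Cmod_ge_0 | left; apply exp_pos]).
    assert (0 <= 64 / y ^ 2) by (apply Rdiv_le_0_compat; [lra | apply pow_lt; auto]).
    apply Rle_trans with (64 / y ^ 2 * exp (PI * (y / 2) * INR (S n)) * q).
    - rewrite Rmult_1_l. apply Rmult_le_compat_r; auto.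
    - replace (64 / y ^ 2 * exp (PI * (y / 2) * INR (S n)) * q) with (64 / y ^ 2 * (q * exp (PI * (y / 2) * INR (S n)))) by ring.
      rewrite (Rmult_assoc _ C0). apply Rmult_le_compat_l; auto. }
  destruct (geom_has_sum v _ r Hr Hv) as [d [_ Hd]].
  pose proof (geom_is_series _ _ _ _ Hr Hd) as Hds. exists d.
  set (K := 4 * (64 / y ^ 2) * C0 / (1 - r)).
  assert (h64 : 0 <= 64 / y ^ 2) by (apply Rdiv_le_0_compat; [lra | apply pow_lt; auto]).
  assert (HK : 0 <= K).
  { unfold K. apply Rdiv_le_0_compat; [|lra]. apply Rmult_le_pos; nra. }
  intros eps He. exists (Rmin (y / 4) (eps / (K + 1))).
  split; [apply Rmin_case; [lra | apply Rdiv_lt_0_compat; lra]|].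
  intros h Hh.
  assert (Hh1 : Cmod h <= y / 4) by (eapply Rle_trans; [exact Hh | apply Rmin_l]).
  assert (Hh2 : Cmod h <= eps / (K + 1)) by (eapply Rle_trans; [exact Hh | apply Rmin_r]).
  assert (Hth : 0 < Im (tau + h)%C).
  { pose proof (Im_le_Cmod h) as K1. assert (K2 := Rle_trans _ _ _ K1 Hh1). apply Rabs_le_between in K2.
    unfold y, Im in *. simpl. lra. }
  assert (Hsum : C_is_series (fun n => (u (S n) * Cexp (Ci * PI * INR (S n) * tau)) *
      (Cexp (Ci * PI * INR (S n) * h) - 1 - Ci * PI * INR (S n) * h))%C (qseries u (tau + h) - qseries u tau - h * d)%C).
  { pose proof (C_is_series_plus _ _ _ _ (qseries_is_series u (tau + h)%C Hu Hth)
      (C_is_series_plus _ _ _ _ (C_is_series_scal (- (1))%C _ _ (qseries_is_series u tau Hu Ht)) (C_is_series_scal (- h)%C _ _ Hds))) as S1.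
    replace (qseries u (tau + h) - qseries u tau - h * d)%C with
      (qseries u (tau + h) + (- (1) * qseries u tau + - h * d))%C by ring.
    eapply C_is_series_ext; [|exact S1]. intros n. cbv beta. unfold v, qterm.
    rewrite Cmult_plus_distr_l, Cexp_add. ring. }
  assert (B : Cmod (qseries u (tau + h) - qseries u tau - h * d)%C <= (4 * (64 / y ^ 2) * C0 * Cmod h ^ 2) / (1 - r)).
  { eapply geom_C_is_series_bound; [exact Hr | | exact Hsum]. intros n. cbv beta. fold (qterm u tau n).
    rewrite Cmod_mult, Cmod_qterm. fold y. pose proof (Cexp_sub_affine_bound (Ci * PI * INR (S n) * h)%C) as E.
    assert (hn : 1 <= INR (S n)) by (apply (le_INR 1); lia).
    assert (Em : Cmod (Ci * PI * INR (S n) * h)%C = PI * INR (S n) * Cmod h).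
    { rewrite !Cmod_mult, Cmod_Ci, !Cmod_R, !Rabs_pos_eq by lra. ring. }
    rewrite Em in E. specialize (H n). specialize (Hx n). rewrite Hsplit in H.
    set (q := Cmod (u (S n)) * exp (- (PI * y * INR (S n)))) in *.
    assert (hq : 0 <= q) by (apply Rmult_le_pos; [apply Cmod_ge_0 | left; apply exp_pos]).
    assert (e2 : exp (PI * INR (S n) * Cmod h) <= exp (PI * (y / 4) * INR (S n))).
    { apply exp_le_compat. replace (PI * (y / 4) * INR (S n)) with (PI * INR (S n) * (y / 4)) by ring.
      apply Rmult_le_compat_l; nra. }
    set (X := exp (PI * (y / 4) * INR (S n))) in *. apply Rle_trans with (q * (4 * (64 / y ^ 2 * X * Cmod h ^ 2) * X)).
    - apply Rmult_le_compat_l; auto. eapply Rle_trans; [exact E|].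
      apply Rmult_le_compat; auto.
      + pose proof (pow2_ge_0 (PI * INR (S n) * Cmod h)). lra.
      + left; apply exp_pos.
      + rewrite Rpow_mult_distr. apply Rmult_le_compat_l; [lra|]. apply Rmult_le_compat_r; [apply pow2_ge_0 | auto].
    - replace (q * (4 * (64 / y ^ 2 * X * Cmod h ^ 2) * X)) with (4 * (64 / y ^ 2) * Cmod h ^ 2 * (q * (X * X))) by ring.
      replace (4 * (64 / y ^ 2) * C0 * Cmod h ^ 2 * r ^ n) with (4 * (64 / y ^ 2) * Cmod h ^ 2 * (C0 * r ^ n)) by ring.
      apply Rmult_le_compat_l; auto. apply Rmult_le_pos; [lra | apply pow2_ge_0]. }
  eapply Rle_trans; [exact B|].
  replace (4 * (64 / y ^ 2) * C0 * Cmod h ^ 2 / (1 - r)) with (K * Cmod h * Cmod h) by (unfold K; field; lra).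
  apply Rmult_le_compat_r; [apply Cmod_ge_0|]. apply Rle_div_r in Hh2; [|lra]. nra.
Qed.

Lemma cdiff_plus (F G : C -> C) (z d e : C) : cdiff F z d -> cdiff G z e ->
  cdiff (fun t => F t + G t)%C z (d + e)%C.
Proof.
  intros HF HG eps He. destruct (HF (eps / 2) ltac:(lra)) as [d1 [h1 H1]]. destruct (HG (eps / 2) ltac:(lra)) as [d2 [h2 H2]].
  exists (Rmin d1 d2). split; [apply Rmin_case; auto|]. intros h Hh.
  specialize (H1 h ltac:(eapply Rle_trans; [exact Hh | apply Rmin_l])).
  specialize (H2 h ltac:(eapply Rle_trans; [exact Hh | apply Rmin_r])).
  replace (_ - _)%C with ((F (z + h) - F z - h * d) + (G (z + h) - G z - h * e))%C by ring.
  eapply Rle_trans; [apply Cmod_triangle|]. lra.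
Qed.

(** The increment of [- 1 / z] is [k = h / (z (z + h))], and [k - h / z^2 = - k h / z] is of second
    order. *)
Lemma cdiff_inv_neg (G : C -> C) (z d : C) : 0 < Im z -> cdiff G (inv_neg z) d ->
  exists e, cdiff (fun t => G (inv_neg t)) z e.
Proof.
  intros Hz HG. exists (d / (z * z))%C. intros eps He. pose proof (H_neq_0 z Hz) as hz.
  set (m := Cmod z). assert (hm : 0 < m) by (apply Cmod_gt_0; auto).
  assert (hD : 0 <= Cmod d) by apply Cmod_ge_0.
  destruct (HG (eps * m ^ 2 / 4)) as [d1 [hd1 H1]].
  { apply Rdiv_lt_0_compat; [apply Rmult_lt_0_compat; auto; apply pow_lt; auto | lra]. }
  (* [d2] brings [k] into the range [d1] where the estimate for [G] holds, [d3] controls the second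
     order term, and the radius [m / 2] keeps [z + h] away from 0. *)
  set (d2 := m ^ 2 / 2 * d1). set (d3 := eps * m ^ 3 / (4 * (Cmod d + 1))).
  assert (hd2 : 0 < d2). { unfold d2. apply Rmult_lt_0_compat; auto. apply Rdiv_lt_0_compat; [apply pow_lt; auto | lra]. }
  assert (hd3 : 0 < d3). { unfold d3. apply Rdiv_lt_0_compat; [apply Rmult_lt_0_compat; auto; apply pow_lt; auto | lra]. }
  exists (Rmin (m / 2) (Rmin d2 d3)). split; [repeat apply Rmin_case; lra|].
  intros h Hh.
  assert (a1 : Cmod h <= m / 2) by (eapply Rle_trans; [exact Hh | apply Rmin_l]).
  assert (a2 : Cmod h <= d2) by (eapply Rle_trans; [exact Hh |]; eapply Rle_trans; [apply Rmin_r | apply Rmin_l]).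
  assert (a3 : Cmod h <= d3) by (eapply Rle_trans; [exact Hh |]; eapply Rle_trans; [apply Rmin_r | apply Rmin_r]).
  pose proof (Cmod_ge_0 h) as h0.
  assert (hzh : m / 2 <= Cmod (z + h)%C).
  { pose proof (Cmod_sub_lower z (- h)%C) as K. rewrite Cmod_opp in K. fold m in K.
    replace (z - - h)%C with (z + h)%C in K by ring. lra. }
  assert (hzh0 : (z + h)%C <> 0) by (apply Cmod_gt_0; lra).
  set (k := (h / (z * (z + h)))%C).
  assert (Ek : inv_neg (z + h) = (inv_neg z + k)%C) by (unfold inv_neg, k; field; auto).
  assert (hk : Cmod k <= 2 / m ^ 2 * Cmod h).
  { unfold k. rewrite Cmod_div, Cmod_mult by (apply Cmult_neq_0; auto). fold m.
    replace (2 / m ^ 2 * Cmod h) with (Cmod h / (m * (m / 2))) by (field; lra).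
    unfold Rdiv at 1. unfold Rdiv at 1. apply Rmult_le_compat_l; auto. apply Rinv_le_contravar; nra. }
  assert (hk1 : Cmod k <= d1).
  { eapply Rle_trans; [exact hk|]. apply Rle_trans with (2 / m ^ 2 * d2).
    - apply Rmult_le_compat_l; auto. apply Rdiv_le_0_compat; [lra | apply pow_lt; auto].
    - right. unfold d2. field. lra. }
  specialize (H1 k hk1). rewrite Ek.
  replace (G (inv_neg z + k) - G (inv_neg z) - h * (d / (z * z)))%C with
    ((G (inv_neg z + k) - G (inv_neg z) - k * d) - k * h / z * d)%C by (unfold k; field; auto).
  eapply Rle_trans; [apply Cmod_sub_upper|].
  assert (E2 : Cmod (k * h / z * d)%C <= eps / 2 * Cmod h).
  { rewrite Cmod_mult, Cmod_div, Cmod_mult by auto. fold m.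
    apply Rle_trans with (2 / m ^ 2 * Cmod h * Cmod h / m * Cmod d).
    - apply Rmult_le_compat_r; auto. unfold Rdiv. apply Rmult_le_compat_r; [left; apply Rinv_0_lt_compat; auto|].
      apply Rmult_le_compat_r; auto.
    - replace (2 / m ^ 2 * Cmod h * Cmod h / m * Cmod d) with (2 / m ^ 3 * (Cmod h * Cmod d) * Cmod h) by (field; lra).
      apply Rmult_le_compat_r; auto.
      assert (hm3 : 0 < m ^ 3) by (apply pow_lt; auto).
      unfold d3 in a3. apply Rle_div_r in a3; [|lra].
      apply Rmult_le_reg_r with (m ^ 3); auto.
      replace (2 / m ^ 3 * (Cmod h * Cmod d) * m ^ 3) with (2 * (Cmod h * Cmod d)) by (field; lra). nra. }
  assert (E1 : eps * m ^ 2 / 4 * Cmod k <= eps / 2 * Cmod h).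
  { apply Rle_trans with (eps * m ^ 2 / 4 * (2 / m ^ 2 * Cmod h)).
    - apply Rmult_le_compat_l; auto. apply Rdiv_le_0_compat; [|lra]. apply Rmult_le_pos; [lra | apply pow2_ge_0].
    - right. field. lra. }
  lra.
Qed.

(** The mean value theorem along the segment, for the real and the imaginary part. These enter only
    as 1-Lipschitz functions, which suffices since the derivative is 0. *)
Lemma cdiff_zero_const (F : C -> C) : (forall z, 0 < Im z -> cdiff F z 0) ->
  forall z w, 0 < Im z -> 0 < Im w -> F w = F z.
Proof.
  intros HF z w Hz Hw. set (v := (w - z)%C).
  assert (K : forall g : C -> R, (forall a b, Rabs (g a - g b) <= Cmod (a - b)%C) -> g (F w) = g (F z)).
  { intros g Hg. set (f := fun s : R => g (F (z + s * v)%C)).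
    assert (Hseg : forall s, 0 <= s <= 1 -> 0 < Im (z + s * v)%C).
    { intros s Hs. unfold v. destruct z as [z1 z2], w as [w1 w2]. simpl in *. nra. }
    assert (Hf : forall s, 0 <= s <= 1 -> derivable_pt_lim f s 0).
    { intros s Hs eps He. pose proof (Cmod_ge_0 v) as hv.
      destruct (HF _ (Hseg s Hs) (eps / 2 / (Cmod v + 1))) as [dl [hd Hd]].
      { apply Rdiv_lt_0_compat; lra. }
      assert (hdd : 0 < dl / (Cmod v + 1)) by (apply Rdiv_lt_0_compat; lra).
      exists (mkposreal _ hdd). intros h hn hh. simpl in hh.
      assert (Hhv : Cmod (h * v)%C = Rabs h * Cmod v) by (rewrite Cmod_mult, Cmod_R; reflexivity).
      assert (hh' : Rabs h * (Cmod v + 1) < dl) by (apply Rlt_div_r; lra).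
      pose proof (Rabs_pos_lt h hn) as hp.
      specialize (Hd (h * v)%C ltac:(rewrite Hhv; nra)). rewrite Hhv in Hd.
      unfold f. rewrite RtoC_plus.
      replace (z + (s + h) * v)%C with (z + s * v + h * v)%C by ring.
      specialize (Hg (F (z + s * v + h * v)%C) (F (z + s * v)%C)).
      replace (F (z + s * v + h * v) - F (z + s * v) - h * v * 0)%C with (F (z + s * v + h * v) - F (z + s * v))%C in Hd by ring.
      rewrite Rminus_0_r. unfold Rdiv. rewrite Rabs_mult, Rabs_inv.
      apply Rmult_lt_reg_r with (Rabs h); auto. rewrite Rmult_assoc, Rinv_l by lra. rewrite Rmult_1_r.
      eapply Rle_lt_trans; [exact Hg|]. eapply Rle_lt_trans; [exact Hd|].
      replace (eps / 2 / (Cmod v + 1) * (Rabs h * Cmod v)) with (eps / 2 * Rabs h * (Cmod v / (Cmod v + 1))) by (field; lra).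
      assert (Cmod v / (Cmod v + 1) <= 1) by (apply Rle_div_l; lra).
      assert (0 < eps / 2 * Rabs h) by nra. nra. }
    destruct (MVT_gen f 0 1 (fun _ => 0)) as [c [_ E]].
    - intros x Hx. rewrite Rmin_left, Rmax_right in Hx by lra. apply is_derive_Reals, Hf. lra.
    - intros x Hx. rewrite Rmin_left, Rmax_right in Hx by lra. apply derivable_continuous_pt.
      exists 0. apply Hf. lra.
    - unfold f in E. replace (z + 1 * v)%C with w in E by (unfold v; ring).
      replace (z + 0 * v)%C with z in E by ring. lra. }
  apply Ceq; apply K.
  - intros a b. apply (re_le_Cmod (a - b)%C).
  - intros a b. apply (Im_le_Cmod (a - b)%C).
Qed.

Lemma Im_neg_conj (z : C) : Im (- Cconj z)%C = Im z.
Proof. destruct z; simpl; ring. Qed.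

(* Comparing real and imaginary increments, [F' = K'] and [F' = - K']. *)
Lemma holomorphic_plus_antiholomorphic (F K : C -> C) (s : C) :
  (forall z, 0 < Im z -> exists d, cdiff F z d) -> (forall z, 0 < Im z -> exists d, cdiff K z d) ->
  (forall z, 0 < Im z -> (F z + K (- Cconj z) = s)%C) ->
  exists c, forall z, 0 < Im z -> F z = c /\ K z = (s - c)%C.
Proof.
  intros HF HK H.
  assert (H0 : forall z, 0 < Im z -> cdiff F z 0).
  { intros z Hz. destruct (HF z Hz) as [d Hd].
    destruct (HK (- Cconj z)%C ltac:(rewrite Im_neg_conj; auto)) as [e Hde].
    replace (RtoC 0) with d; auto. apply Cmod_small_eq. intros eps He.
    destruct (Hd (eps / 2) ltac:(lra)) as [d1 [h1 D1]]. destruct (Hde (eps / 2) ltac:(lra)) as [d2 [h2 D2]].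
    set (t := Rmin (Im z / 2) (Rmin d1 d2)).
    assert (ht : 0 < t) by (unfold t; repeat apply Rmin_case; lra).
    assert (t1 : t <= d1) by (unfold t; eapply Rle_trans; [apply Rmin_r | apply Rmin_l]).
    assert (t2 : t <= d2) by (unfold t; eapply Rle_trans; [apply Rmin_r | apply Rmin_r]).
    assert (t0 : t <= Im z / 2) by apply Rmin_l.
    assert (G : forall h, Cmod h = t -> Cmod (h * d - Cconj h * e)%C <= eps * t).
    { intros h hh. pose proof (D1 h ltac:(lra)) as A1.
      assert (hc : Cmod (- Cconj h)%C = t) by (rewrite Cmod_opp, Cmod_conj; auto).
      pose proof (D2 (- Cconj h)%C ltac:(lra)) as A2. rewrite hc in A2. rewrite hh in A1.
      pose proof (H z Hz) as E1.
      assert (Hzh : 0 < Im (z + h)%C).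
      { pose proof (Im_le_Cmod h) as B. rewrite hh in B. apply Rabs_le_between in B. unfold Im in *. simpl. lra. }
      pose proof (H (z + h)%C Hzh) as E2.
      replace (- Cconj (z + h))%C with (- Cconj z + - Cconj h)%C in E2 by (rewrite Cplus_conj; ring).
      replace (h * d - Cconj h * e)%C with
        ((F (z + h) + K (- Cconj z + - Cconj h)) - (F z + K (- Cconj z)) -
         ((F (z + h) - F z - h * d) + (K (- Cconj z + - Cconj h) - K (- Cconj z) - - Cconj h * e)))%C by ring.
      rewrite E1, E2. replace (s - s)%C with (0 : C) by ring.
      eapply Rle_trans; [apply Cmod_sub_upper|]. rewrite Cmod_0.
      eapply Rle_trans; [apply Rplus_le_compat_l, Cmod_triangle|]. lra. }
    (* The increments [t] and [i t] give [|d - e| <= eps] and [|d + e| <= eps], hence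
       [|d| <= eps]. *)
    pose proof (G t ltac:(rewrite Cmod_R, Rabs_pos_eq; lra)) as G1.
    pose proof (G (Ci * t)%C ltac:(rewrite Cmod_mult, Cmod_Ci, Cmod_R, Rabs_pos_eq; lra)) as G2.
    replace (t * d - Cconj t * e)%C with (t * (d - e))%C in G1.
    2:{ replace (Cconj t) with (RtoC t) by (apply Ceq; simpl; ring). ring. }
    replace (Ci * t * d - Cconj (Ci * t) * e)%C with (Ci * t * (d + e))%C in G2.
    2:{ replace (Cconj (Ci * t)) with (- (Ci * t))%C by (apply Ceq; simpl; ring). ring. }
    rewrite !Cmod_mult, ?Cmod_Ci, Cmod_R, Rabs_pos_eq in G1 by lra.
    rewrite !Cmod_mult, ?Cmod_Ci, Cmod_R, Rabs_pos_eq in G2 by lra.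
    assert (G1' : Cmod (d - e)%C <= eps) by nra. assert (G2' : Cmod (d + e)%C <= eps) by nra.
    pose proof (Cmod_triangle (d - e)%C (d + e)%C) as T.
    replace (d - e + (d + e))%C with (2 * d)%C in T by ring.
    rewrite Cmod_mult, Cmod_R, Rabs_pos_eq in T by lra.
    replace (d - 0)%C with d by ring. lra. }
  exists (F Ci). intros z Hz.
  assert (hCi : 0 < Im Ci) by (simpl; lra).
  pose proof (cdiff_zero_const F H0 Ci z hCi Hz) as E. split; auto.
  assert (Hz' : 0 < Im (- Cconj z)%C) by (rewrite Im_neg_conj; auto).
  pose proof (H _ Hz') as E2. pose proof (cdiff_zero_const F H0 Ci _ hCi Hz') as E3.
  replace (- Cconj (- Cconj z))%C with z in E2 by (apply Ceq; destruct z; simpl; ring).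
  rewrite E3 in E2. rewrite <- E2. ring.
Qed.

Lemma qhol_const_unique (F G : C -> C) (c d : C) : qhol F c -> qhol G d ->
  (forall tau, 0 < Im tau -> F tau = G tau) -> c = d.
Proof.
  intros HF HG E. apply Cmod_small_eq. intros eps He.
  destruct (qholy_lim 1 F c (HF 1 ltac:(lra)) (eps / 2) ltac:(lra)) as [Y1 [h1 H1]].
  destruct (qholy_lim 1 G d (HG 1 ltac:(lra)) (eps / 2) ltac:(lra)) as [Y2 [h2 H2]].
  set (t := (0, Y1 + Y2) : C).
  specialize (H1 t ltac:(simpl; lra)). specialize (H2 t ltac:(simpl; lra)).
  rewrite E in H1 by (simpl; lra).
  replace (c - d)%C with ((G t - d) - (G t - c))%C by ring.
  eapply Rle_trans; [apply Cmod_sub_upper|]. lra.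
Qed.

(** * From functions of level 2 to exceptional sequences *)

Lemma poly_eval_csum (k : nat) (p : nat -> C) (z : C) :
  poly_eval k p z = csum (fun j => p j * z ^ j)%C (S k).
Proof. unfold poly_eval. apply sum_n_csum. Qed.

(** At [1 - 1 / tau] the height is [t = y / (x^2 + y^2)], so that [1 / t = y + x^2 / y <= y + 4];
    the excess 4 is paid for by the constant [E]. *)
Lemma qseries_cusp_1_growth (a : nat -> C) (k : nat) : (1 <= k)%nat -> subexp a ->
  (forall eps, 0 < eps -> exists N, forall n, (N <= n)%nat ->
     Cmod (a n) <= eps * (Rpower (INR n) (- (3 / 4)) * exp (2 * PI * sqrt (INR k * INR n)))) ->
  cusp_1_growth k (qseries a).
Proof.
  intros Hk Ha Hg eps He. pose proof PI_RGT_0 as hpi.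
  assert (hk : 1 <= INR k) by (apply (le_INR 1); auto).
  set (E := exp (PI * INR k * 4)). assert (hE : 0 < E) by apply exp_pos.
  destruct (series_growth a (INR k) hk Hg (eps / E)) as [t0 [Ht0 H]]; [apply Rdiv_lt_0_compat; auto|].
  (* The summand [/ t0] forces [t <= 1 / y <= t0], and the 1 gives [x^2 / y <= 4]. *)
  exists (1 + / t0). assert (0 < / t0) by (apply Rinv_0_lt_compat; lra). split; [lra|].
  intros tau hr hi. set (y := Im tau) in *. set (x := Re tau) in *.
  assert (hy : 0 < y) by lra.
  assert (hz : 0 < Im (inv_neg tau + 1)%C) by (rewrite Im_add_1; apply Im_neg_inv; auto).
  assert (hx : x ^ 2 <= 2 ^ 2) by (rewrite <- (pow2_abs x); apply pow_incr; split; [apply Rabs_pos | auto]).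
  set (t := Im (inv_neg tau + 1)%C) in *.
  assert (Et : t = y / (x ^ 2 + y ^ 2)) by (unfold t; rewrite Im_add_1, Im_inv_neg; auto).
  pose proof (pow2_ge_0 x) as hx0.
  assert (hy2 : 0 < y ^ 2) by (apply pow_lt; auto).
  assert (ht : t <= t0).
  { rewrite Et. apply Rle_trans with (/ y).
    - apply Rle_div_l; [lra|]. replace (/ y * (x ^ 2 + y ^ 2)) with (x ^ 2 / y + y) by (field; lra).
      assert (0 <= x ^ 2 / y) by (apply Rdiv_le_0_compat; auto). lra.
    - rewrite <- (Rinv_inv t0). apply Rinv_le_contravar; lra. }
  assert (hti : / t <= y + 4).
  { rewrite Et. replace (/ (y / (x ^ 2 + y ^ 2))) with (x ^ 2 / y + y) by (field; lra).
    assert (x ^ 2 / y <= 4); [apply Rle_div_l; auto; nra | lra]. }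
  eapply Rle_trans.
  - apply (C_is_series_bound _ _ (eps / E * exp (PI * INR k / t)) (qseries_is_series a _ Ha hz)).
    intros n. eapply Rle_trans; [|apply (H t (conj hz ht) n)].
    apply rsum_le. intros i _. rewrite Cmod_qterm. fold t. lra.
  - replace (eps * exp (PI * INR k * y)) with (eps / E * (exp (PI * INR k * y) * E)) by (field; lra).
    apply Rmult_le_compat_l; [left; apply Rdiv_lt_0_compat; auto|].
    unfold E. rewrite <- exp_plus. apply exp_le_compat. unfold Rdiv.
    replace (PI * INR k * y + PI * INR k * 4) with (PI * INR k * (y + 4)) by ring.
    apply Rmult_le_compat_l; [nra | auto].
Qed.

(** [k] coefficients mean degree [k - 1]. [P(0)] is the value of the series of [a] at the cusp, and
    the series of [b] is recovered from [P(1 - lambda)] through the inversion. *)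
Lemma one_sided_exceptional_of_growth (k : nat) (a0 : C) (a b : nat -> C) : (1 <= k)%nat ->
  subexp a -> subexp b ->
  (forall tau, 0 < Im tau -> (qseries a tau + qseries b (inv_neg tau) = - a0)%C) ->
  (forall eps, 0 < eps -> exists N, forall n, (N <= n)%nat ->
     Cmod (a n) <= eps * (Rpower (INR n) (- (3 / 4)) * exp (2 * PI * sqrt (INR k * INR n)))) ->
  one_sided_exceptional (k - 1) a0 a b.
Proof.
  intros Hk Ha Hb Heq Hg.
  assert (HU : forall tau, 0 < Im tau -> qseries a (inv_neg tau) = (- a0 + - (1) * qseries b tau)%C).
  { intros tau Ht. pose proof (Heq (inv_neg tau) (Im_neg_inv tau Ht)) as E. rewrite inv_neg_invol in E by auto.
    rewrite <- E. ring. }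
  assert (HUq : qhol (fun t => qseries a (inv_neg t)) (- a0 + - (1) * 0)%C).
  { eapply qhol_ext; [|apply (qhol_plus _ _ _ _ (qhol_const (- a0)%C) (qhol_mult _ _ _ _ (qhol_const (- (1))%C) (qseries_qhol b Hb)))].
    intros tau Ht. symmetry. apply HU; auto. }
  destruct (level2_polynomial k (qseries a) 0 _ (qseries_qhol a Ha) HUq (qseries_cusp_1_growth a k Hk Ha Hg)) as [p [Hp0 Hp]].
  specialize (Hp0 ltac:(lia)).
  assert (HP : forall z, poly_eval (k - 1) p z = csum (fun j => p j * z ^ j)%C k).
  { intros z. rewrite poly_eval_csum. f_equal. lia. }
  assert (HPi : forall tau, 0 < Im tau -> qseries a (inv_neg tau) = csum (fun j => p j * (1 - modular_lambda tau) ^ j)%C k).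
  { intros tau Ht. rewrite (Hp (inv_neg tau) (Im_neg_inv tau Ht)). unfold inv_neg. rewrite lambda_inv by auto. reflexivity. }
  exists p. split; [|split].
  - rewrite HP. destruct k as [|k]; [lia|]. rewrite csum_shift, csum_zero.
    + rewrite Hp0. simpl. ring.
    + intros i _. simpl. ring.
  - rewrite HP.
    (* [P(1)] is the value of [P(1 - lambda)] at the cusp, where lambda vanishes; comparison with
       [HUq] shows that it is [- a0]. *)
    assert (Q : qhol (fun t => csum (fun j => p j * (1 + - (1) * modular_lambda t) ^ j)%C k) (csum (fun j => p j * (1 + - (1) * 0) ^ j)%C k)).
    { intros y Hy. apply (qholy_csum y (fun j t => p j * (1 + - (1) * modular_lambda t) ^ j)%C (fun j => p j * (1 + - (1) * 0) ^ j)%C).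
      intros i. apply (qholy_mult y (fun _ => p i)); auto; [apply qholy_const|]. apply qholy_pow; auto.
      apply (qholy_plus y (fun _ => 1)); [apply qholy_const|]. apply (qholy_mult y (fun _ => - (1))%C); auto; [apply qholy_const|].
      apply lambda_qhol; auto. }
    pose proof (qhol_const_unique _ _ _ _ Q HUq) as E.
    replace (- a0)%C with (- a0 + - (1) * 0)%C by ring. rewrite <- E.
    + apply csum_ext. intros i _. do 2 f_equal. ring.
    + intros tau Ht. rewrite HPi by auto. apply csum_ext. intros i _. do 2 f_equal. ring.
  - intros tau Ht. split.
    + rewrite HP, <- Hp by auto. apply qseries_is_series; auto.
    + rewrite HP, <- HPi by auto. replace (- a0 - qseries a (inv_neg tau))%C with (qseries b tau).
      * apply qseries_is_series; auto.
      * rewrite HU by auto. ring.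
Qed.

Lemma subexp_of_Z (u : Z -> C) (g : nat -> Z) : subexponential u ->
  (forall n, Z.abs (g n) = Z.of_nat n) -> subexp (fun n => u (g n)).
Proof.
  intros Hu Hg. apply subexp_of_eventually. intros eps He. destruct (Hu eps He) as [M [N HN]].
  exists M, (Z.to_nat N). intros n Hn. specialize (HN (g n)). rewrite Hg, <- INR_IZR_INZ in HN.
  apply HN. lia.
Qed.

Lemma growth_of_Z (a : Z -> C) (k : nat) (g : nat -> Z) :
  (forall n, Z.abs (g n) = Z.of_nat n) ->
  @is_domin Z R_AbsRing C_AbsRing R_NormedModule C_NormedModule Z_infty
     (fun n : Z => Rpower (IZR (Z.abs n)) (- (3 / 4)) * exp (2 * PI * sqrt (INR k * IZR (Z.abs n)))) a ->
  forall eps, 0 < eps -> exists N, forall n, (N <= n)%nat ->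
     Cmod (a (g n)) <= eps * (Rpower (INR n) (- (3 / 4)) * exp (2 * PI * sqrt (INR k * INR n))).
Proof.
  intros Hg H eps He. destruct (H (mkposreal eps He)) as [N HN].
  exists (Z.to_nat N). intros n Hn. specialize (HN (g n)). rewrite Hg, <- INR_IZR_INZ in HN.
  specialize (HN ltac:(lia)). simpl in HN.
  change (Cmod (a (g n)) <= eps * Rabs (Rpower (INR n) (- (3 / 4)) * exp (2 * PI * sqrt (INR k * INR n)))) in HN.
  rewrite Rabs_pos_eq in HN; auto. apply Rmult_le_pos; left; apply exp_pos.
Qed.

Theorem theorem3p7p3 (a b : Z -> C) (k : nat)
  (ha : subexponential a) (hb : subexponential b)
  (htriv : forall tau : C, upper_half_plane tau -> is_harmonic_hfs a b tau 0)
  (hk : (1 <= k)%nat)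
  (hgrowth : @is_domin Z R_AbsRing C_AbsRing R_NormedModule C_NormedModule Z_infty
     (fun n : Z => Rpower (IZR (Z.abs n)) (- (3 / 4))
                   * exp (2 * PI * sqrt (INR k * IZR (Z.abs n))))
     a) :
  E_harm (k - 1) a b.
Proof.
  set (ap := fun n : nat => a (Z.of_nat n)). set (bp := fun n : nat => b (Z.of_nat n)).
  set (am := fun n : nat => a (- Z.of_nat n)%Z). set (bm := fun n : nat => b (- Z.of_nat n)%Z).
  assert (Hap : subexp ap) by (apply (subexp_of_Z a Z.of_nat); auto; intros; lia).
  assert (Hbp : subexp bp) by (apply (subexp_of_Z b Z.of_nat); auto; intros; lia).
  assert (Ham : subexp am) by (apply (subexp_of_Z a (fun n => - Z.of_nat n)%Z); auto; intros; lia).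
  assert (Hbm : subexp bm) by (apply (subexp_of_Z b (fun n => - Z.of_nat n)%Z); auto; intros; lia).
  set (F := fun t => (qseries ap t + qseries bp (inv_neg t))%C).
  set (K := fun t => (qseries am t + qseries bm (inv_neg t))%C).
  assert (D : forall u v : nat -> C, subexp u -> subexp v -> forall z, 0 < Im z ->
     exists d, cdiff (fun t => qseries u t + qseries v (inv_neg t))%C z d).
  { intros u v Hu Hv z Hz. destruct (qseries_cdiff u z Hu Hz) as [d1 H1].
    destruct (qseries_cdiff v (inv_neg z) Hv (Im_neg_inv z Hz)) as [d2 H2].
    destruct (cdiff_inv_neg _ _ _ Hz H2) as [d3 H3]. exists (d1 + d3)%C. apply cdiff_plus; auto. }
  assert (FK : forall z, 0 < Im z -> (F z + K (- Cconj z) = - a 0%Z)%C).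
  { intros z Hz. pose proof (H_neq_0 z Hz) as hz.
    assert (Hz' : 0 < Im (- Cconj z)%C) by (rewrite Im_neg_conj; auto).
    assert (hcz : Cconj z <> 0).
    { intros e. apply (H_neq_0 _ Hz'). rewrite e. ring. }
    destruct (htriv z Hz) as [sp [sm [Hsp [Hsm E]]]].
    assert (E1 : sp = F z).
    { eapply C_is_series_unique; [exact Hsp|].
      eapply C_is_series_ext; [|apply (C_is_series_plus _ _ _ _ (qseries_is_series ap z Hap Hz)
         (qseries_is_series bp (inv_neg z) Hbp (Im_neg_inv z Hz)))].
      intros n. unfold qterm, ap, bp. rewrite INR_IZR_INZ. do 3 f_equal. unfold inv_neg. field. auto. }
    (* The index [- n] contributes [i pi (- n) conj z = i pi n (- conj z)], so this half is a series
       of the same kind at [- conj z]. *)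
    assert (E2 : sm = K (- Cconj z)%C).
    { eapply C_is_series_unique; [exact Hsm|].
      eapply C_is_series_ext; [|apply (C_is_series_plus _ _ _ _ (qseries_is_series am (- Cconj z)%C Ham Hz')
         (qseries_is_series bm (inv_neg (- Cconj z)) Hbm (Im_neg_inv _ Hz')))].
      intros n. unfold qterm, am, bm. rewrite INR_IZR_INZ, opp_IZR, RtoC_opp.
      f_equal; do 2 f_equal; unfold inv_neg; [ring | field; auto]. }
    rewrite <- E1, <- E2.
    transitivity ((a 0%Z + sp + sm) - a 0%Z)%C; [ring|]. rewrite <- E. ring. }
  destruct (holomorphic_plus_antiholomorphic F K (- a 0%Z)%C (D _ _ Hap Hbp) (D _ _ Ham Hbm) FK) as [c Hc].
  (* The constant [c] of [F] must be [- (a0 - c0)], and the constant [- a0 - c] of [K] must be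
     [- c0]; both give [c0 = a0 + c]. *)
  exists (a 0%Z + c)%C. split.
  - apply one_sided_exceptional_of_growth; auto.
    + intros tau Ht. destruct (Hc tau Ht) as [h _]. unfold F in h. fold ap bp. rewrite h. ring.
    + apply (growth_of_Z a k Z.of_nat); auto. intros; lia.
  - apply one_sided_exceptional_of_growth; auto.
    + intros tau Ht. destruct (Hc tau Ht) as [_ h]. unfold K in h. fold am bm. rewrite h. ring.
    + apply (growth_of_Z a k (fun n => - Z.of_nat n)%Z); auto. intros; lia.
Qed.
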